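(* With the notation of the context, for every $\epsilon>0$ and every $p>4$, as $l,k\to\infty$ with $l/k\to w>s(R)$ (and $m$ arbitrary, $1\le m\le\dim H_l$), $$\frac{\|u_{klm}\|_{L^p(D(w/g_R(w),\epsilon)\cap\Omega_{\mathrm{shell}})}}{\|u_{klm}\|_{L^p(\Omega_{\mathrm{shell}})}}\to0,$$ where $D(r,\epsilon)=\{x\in\mathbb{R}^d:||x|-r|\ge\epsilon\}$.
   Context: $R>1$, $\Omega_{\mathrm{shell}}=\{x\in\mathbb{R}^d:1<|x|<R\}$. $L u=-\Delta u+\frac{c^2}{|x|^2}u$, $d\ge2$, $c\ge0$; $\nu_l=\sqrt{(l+\tfrac d2-1)^2+c^2}$. $J_\nu,Y_\nu$ are the Bessel functions of the first and second kinds. $a_{\nu,k}$ is the $k$-th positive zero of $f_{\nu,R}(z)=J_\nu(z)Y_\nu(Rz)-Y_\nu(z)J_\nu(Rz)$. $\{Y_{lm}\}$ is an orthonormal basis of the space $H_l$ of spherical harmonics of degree $l$ on $S^{d-1}$. The Dirichlet eigenfunctions of $L$ in $\Omega_{\mathrm{shell}}$ are, in spherical coordinates $x=r\xi$, $u_{klm}(r,\xi)=r^{1-d/2}\big[J_{\nu_l}(a_{\nu_l,k})Y_{\nu_l}(a_{\nu_l,k}r)-Y_{\nu_l}(a_{\nu_l,k})J_{\nu_l}(a_{\nu_l,k}r)\big]Y_{lm}(\xi)$. $g_R$ is the unique solution on $[0,\infty)$ of $$y'(w)=\frac{\arccos\!\big(\frac{w}{Ry}\big)-\arccos\!\big(\frac{w}{y}\big)\mathbf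 1_{\{|w|\le|y|\}}}{R\sqrt{1-\big(\frac{w}{Ry}\big)^2}-\sqrt{1-\big(\frac{w}{y}\big)^2}\,\mathbf 1_{\{|w|\le|y|\}}},\qquad y(0)=\frac{\pi}{R-1},$$ and $s(R)$ is the unique $w>0$ with $g_R(w)=w$. *)

(* Defs.v *)
From HB Require Import structures.
From mathcomp Require Import all_boot all_order all_algebra.
From mathcomp Require Import all_classical all_reals all_analysis.
Set Implicit Arguments. Unset Strict Implicit. Unset Printing Implicit Defensive.
Import Order.TTheory GRing.Theory Num.Theory.
Import numFieldNormedType.Exports.
Local Open Scope classical_set_scope.
Local Open Scope ring_scope.

Section Defs.
Variable R : realType.

Definition rint (D : set R) (f : R -> R) : R :=
  Rintegral (@lebesgue_measure R) D f.

Definition sinhR (t : R) : R := (expR t - expR (- t)) / 2.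

(* Bessel functions of the first and second kinds, for real order nu and
   argument z > 0, via the standard Schlaefli integral representations
   (DLMF 10.9.6, 10.9.7), valid for Re z > 0.  Only z > 0 is ever used. *)
Definition BesselJ (nu z : R) : R :=
  pi^-1 * rint `[0, pi] (fun th => cos (z * sin th - nu * th))
  - sin (nu * pi) / pi *
    rint `[0, +oo[ (fun t => expR (- (z * sinhR t) - nu * t)).

Definition BesselY (nu z : R) : R :=
  pi^-1 * rint `[0, pi] (fun th => sin (z * sin th - nu * th))
  - pi^-1 *
    rint `[0, +oo[ (fun t => (expR (nu * t) + expR (- (nu * t)) * cos (nu * pi))
                             * expR (- (z * sinhR t))).

Definition fBessel (nu Rr z : R) : R :=
  BesselJ nu z * BesselY nu (Rr * z) - BesselY nu z * BesselJ nu (Rr * z).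

Definition kth_pos_zero (f : R -> R) (k : nat) (z : R) : Prop :=
  (0 < k)%N /\ 0 < z /\ f z = 0 /\
  exists s : seq R, uniq s /\ size s = k.-1 /\
    forall x, x \in s <-> (0 < x /\ x < z /\ f x = 0).

Definition nu_l (d l : nat) (c : R) : R :=
  Num.sqrt ((l%:R + d%:R / 2 - 1) ^+ 2 + c ^+ 2).

Definition eucl (d : nat) (x : 'rV[R]_d) : R :=
  Num.sqrt (\sum_(i < d) x ord0 i ^+ 2).

Definition ebasis (d : nat) (i : 'I_d) : 'rV[R]_d := \row_(j < d) (i == j)%:R.

Definition homog_poly_fun (d l : nat) (P : 'rV[R]_d -> R) : Prop :=
  exists c : {ffun 'I_d -> 'I_l.+1} -> R,
    forall x, P x = \sum_(a : {ffun 'I_d -> 'I_l.+1} | (\sum_(i < d) (a i : nat) == l)%N)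
                      c a * \prod_(i < d) x ord0 i ^+ (a i).

Definition harmonic_fun (d : nat) (P : 'rV[R]_d -> R) : Prop :=
  forall x, \sum_(i < d) ('D_(ebasis i) ('D_(ebasis i) P)) x = 0.

Definition sph_harm (d l : nat) (Y : 'rV[R]_d -> R) : Prop :=
  exists P, homog_poly_fun l P /\ harmonic_fun P /\
    forall xi, eucl xi = 1 -> Y xi = P xi.

(* Iterated Lebesgue integral over R^n of a nonnegative function
   (Tonelli: this is the Lebesgue integral on R^n). *)
Fixpoint iint (n : nat) (f : seq R -> \bar R) : \bar R :=
  match n with
  | 0 => f [::]
  | n'.+1 => (\int[@lebesgue_measure R]_(x in [set: R]) iint n' (fun s => f (x :: s)))%E
  end.

Definition vec_of (d : nat) (s : seq R) : 'rV[R]_d := \row_(i < d) nth 0 s i.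

Definition intRd (d : nat) (F : 'rV[R]_d -> \bar R) : \bar R :=
  iint d (fun s => F (vec_of d s)).

Definition LpNorm (d : nat) (p : R) (A : set 'rV[R]_d) (u : 'rV[R]_d -> R) : R :=
  fine (intRd (fun x => (\1_A x * `|u x| `^ p)%:E)) `^ p^-1.

(* L^2(S^{d-1}) squared norm of Y, with surface measure
   sigma(E) = d * |{r xi : 0 < r <= 1, xi in E}| (polar coordinates) *)
Definition sphere_L2sq (d : nat) (Y : 'rV[R]_d -> R) : R :=
  d%:R * fine (intRd (fun x =>
     (\1_[set y : 'rV[R]_d | 0 < eucl y <= 1] x * Y ((eucl x)^-1 *: x) ^+ 2)%:E)).

Definition shell (d : nat) (Rr : R) : set 'rV[R]_d :=
  [set x | 1 < eucl x < Rr].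

Definition Dset (d : nat) (r eps : R) : set 'rV[R]_d :=
  [set x | eps <= `|eucl x - r|].

(* u_{klm}(x), with a = a_{nu,k}, Y = Y_{lm} *)
Definition u_eig (d : nat) (nu a : R) (Y : 'rV[R]_d -> R) (x : 'rV[R]_d) : R :=
  eucl x `^ (1 - d%:R / 2) *
  (BesselJ nu a * BesselY nu (a * eucl x) - BesselY nu a * BesselJ nu (a * eucl x))
  * Y ((eucl x)^-1 *: x).

Definition gR_rhs (Rr w y : R) : R :=
  let ind := if `|w| <= `|y| then 1 else 0 in
  (acos (w / (Rr * y)) - acos (w / y) * ind) /
  (Rr * Num.sqrt (1 - (w / (Rr * y)) ^+ 2) - Num.sqrt (1 - (w / y) ^+ 2) * ind).

Definition is_gR (Rr : R) (g : R -> R) : Prop :=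
  g 0 = pi / (Rr - 1) /\
  g x @[x --> 0^'+] --> g 0 /\
  forall w : R, 0 < w -> is_derive w (1:R) g (gR_rhs Rr w (g w)).

End Defs.

(* Main.v *)
Require Import Defs.
From HB Require Import structures.
From mathcomp Require Import all_boot all_order all_algebra.
From mathcomp Require Import all_classical all_reals all_analysis.
From mathcomp Require Import measurable_realfun ring lra.
Import Order.TTheory GRing.Theory Num.Theory.
Import numFieldNormedType.Exports.
Local Open Scope classical_set_scope.
Local Open Scope ring_scope.
Set Implicit Arguments. Unset Strict Implicit. Unset Printing Implicit Defensive.

(* In the variable t = ln r the radial factor r^(d/2-1) u solves
   v'' + (e^(2t) - nu^2) v = 0 after scaling, with turning point r = nu / a.

   Location of the turning point.  The phase alpha of the pair (J_nu, Y_nu)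
   advances by exactly k pi between ln a and ln (R a) when a is the k-th zero:
   at each zero of f_{nu,R} the phase shift alpha(t + ln R) - alpha(t) crosses
   a multiple of pi upwards.  Sturm comparison on small cells gives
   k pi = Phi(nu, a) + o(k), where Phi(w, y) is the integral of
   sqrt (1 - (w/x)^2)_+ over [y, R y].  The equation defining g_R says that
   Phi(w, g_R w) = pi, so a / k -> g_R(w) and nu / a -> w / g_R(w), which lies
   strictly inside the shell because g_R(w) < w for w > s(R).

   Concentration.  Put nu = lam^3.  Beyond distance lam^-2 of the turning point
   an adiabatic invariant W is constant up to a factor.  Hence v^2 is at least
   of order W / lam^2 on a window of width about lam^-2, while at fixed distance
   from the turning point it is at most of order W / lam^3, by the invariant on
   the oscillatory side and by convexity on the evanescent side.  The quotient
   of p-th powers of norms is O(lam^(2 - p/2)), which vanishes since p > 4.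
   The spherical factor cancels, u being a product in polar coordinates. *)

(** Order and argument grow at the same rate, so estimates must be uniform across the turning point.
    No Bessel asymptotics enter: the integral formulas serve only to establish the Bessel equation,
    and the rest concerns [v'' + Q v = 0] with [Q] increasing. The value of the Wronskian of [J],
    [Y] is never computed. Either sign will do, by exchanging the two functions; the value zero
    would make [f] vanish identically, while a [k]-th zero has only finitely many zeros below it.
    The scale [lam^-2 = nu^(-2/3)] is that of the Airy transition: the frequency there is of order
    [lam^2], so the phase gained over the distance to the turning point is of order one and the
    adiabatic correction stops being small. The Sturm error for [n] cells is [O(a / n) + O(n)], so
    [n] is fixed before [k] tends to infinity. For [g_R] the difficulty is circular: conservation of
    the phase along the differential equation requires [w < R g_R(w)], which is itself deduced from
    conservation, by looking at the first point where it would fail. *)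

(** * Derivatives on the line, mean values and up-crossings *)

Section PointwiseDerivatives.
Variable R : realType.
Implicit Types (f g : R -> R) (x a b c : R).

Lemma dv_cst c x : is_derive x 1 (fun=> c) 0.
Proof. exact: is_derive_cst. Qed.
Lemma dv_id x : is_derive x 1 (fun y => y) 1.
Proof. exact: is_derive_id. Qed.
Lemma dv_add f g x a b : is_derive x 1 f a -> is_derive x 1 g b ->
  is_derive x 1 (fun y => f y + g y) (a + b).
Proof. by move=> ? ?; apply: is_deriveD. Qed.
Lemma dv_opp f x a : is_derive x 1 f a -> is_derive x 1 (fun y => - f y) (- a).
Proof. by move=> ?; apply: is_deriveN. Qed.
Lemma dv_mul f g x a b : is_derive x 1 f a -> is_derive x 1 g b ->
  is_derive x 1 (fun y => f y * g y) (a * g x + f x * b).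
Proof.
move=> fa gb; eapply is_derive_eq; first exact: (is_deriveM fa gb).
by rewrite /GRing.scale/=; ring.
Qed.
Lemma dv_exp f x a n : is_derive x 1 f a ->
  is_derive x 1 (fun y => f y ^+ n) (n%:R * f x ^+ n.-1 * a).
Proof.
move=> fa; have -> : (fun y => f y ^+ n) = f ^+ n.
  by apply/funext => y; rewrite exprfctE.
eapply is_derive_eq; first exact: (is_deriveX n fa).
by rewrite /GRing.scale/=.
Qed.
Lemma dv_inv f x a : f x != 0 -> is_derive x 1 f a ->
  is_derive x 1 (fun y => (f y)^-1) (- (f x ^- 2) * a).
Proof.
move=> fx fa; eapply is_derive_eq; first exact: (is_deriveV fx fa).
by rewrite /GRing.scale/=.
Qed.
Lemma dv_comp f g x a b : is_derive (g x) 1 f a -> is_derive x 1 g b ->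
  is_derive x 1 (fun y => f (g y)) (a * b).
Proof. by move=> ? ?; apply: (@is_derive1_comp R f g x a b). Qed.
Lemma dv_continuous f x a : is_derive x 1 f a -> {for x, continuous f}.
Proof. by move=> [fx _]; apply: differentiable_continuous; apply/derivable1_diffP. Qed.

Lemma dv_derivable f x a : is_derive x 1 f a -> derivable f x 1.
Proof. by case. Qed.
Lemma dv_derive1 f x a : is_derive x 1 f a -> derive1 f x = a.
Proof. by move=> [_ <-]; rewrite derive1E. Qed.

Lemma dv_cvg_right f x a : is_derive x 1 f a -> f @ x^'+ --> f x.
Proof. by move=> /dv_continuous fx; apply: cvg_at_right_filter. Qed.

Lemma mvt f f' a b : a < b ->
  (forall x, a <= x <= b -> is_derive x 1 f (f' x)) ->
  exists2 c, a < c < b & f b - f a = f' c * (b - a).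
Proof.
move=> ab fd.
have D x : x \in `]a, b[%R -> is_derive x 1 f (f' x).
  by rewrite in_itv/= => /andP[ax xb]; apply: fd; rewrite !ltW.
have C : {within `[a, b], continuous f}.
  apply: derivable_within_continuous => x; rewrite in_itv/= => xab.
  by have [] := fd _ xab.
by have [c] := MVT ab D C; rewrite in_itv/= => cab e; exists c.
Qed.

Lemma derive_ge0_le f f' a b : a <= b ->
  (forall x, a <= x <= b -> is_derive x 1 f (f' x)) ->
  (forall x, a < x < b -> 0 <= f' x) -> f a <= f b.
Proof.
rewrite le_eqVlt => /orP[/eqP-> //|ab] fd f0.
have [c cab e] := mvt ab fd.
by rewrite -subr_ge0 e mulr_ge0 ?f0// subr_ge0 ltW.
Qed.

Lemma derive_le0_le f f' a b : a <= b ->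
  (forall x, a <= x <= b -> is_derive x 1 f (f' x)) ->
  (forall x, a < x < b -> f' x <= 0) -> f b <= f a.
Proof.
move=> ab fd f0; rewrite -lerN2.
apply: (@derive_ge0_le (fun x => - f x) (fun x => - f' x)) => // x /[dup] xab.
  by move=> /fd; exact: dv_opp.
by move=> /f0; rewrite oppr_ge0.
Qed.

Lemma derive_gt0_lt f f' a b : a < b ->
  (forall x, a <= x <= b -> is_derive x 1 f (f' x)) ->
  (forall x, a < x < b -> 0 < f' x) -> f a < f b.
Proof.
move=> ab fd f0.
have [c cab e] := mvt ab fd.
by rewrite -subr_gt0 e mulr_gt0 ?f0// subr_gt0.
Qed.

Lemma derive_eq0_cst f a b : a <= b ->
  (forall x, a <= x <= b -> is_derive x 1 f 0) -> f a = f b.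
Proof.
move=> ab fd; apply/eqP; rewrite eq_le.
by rewrite (derive_ge0_le ab fd)// (derive_le0_le ab fd).
Qed.

Lemma ivt f a b v : a <= b -> (forall x, a <= x <= b -> {for x, continuous f}) ->
  f a <= v <= f b -> exists2 c, a <= c <= b & f c = v.
Proof.
move=> ab cf /andP[av vb].
have [||c] := @IVT R f a b v ab.
- apply: continuous_in_subspaceT => x; rewrite inE/= in_itv/=; exact: cf.
- by rewrite ge_min av/= le_max vb orbT.
- by rewrite in_itv/= => cab e; exists c.
Qed.

Lemma mvt_open f f' a b : a < b ->
  (forall x, a < x < b -> is_derive x 1 f (f' x)) ->
  (forall x, a <= x <= b -> {for x, continuous f}) ->
  exists2 c, a < c < b & f b - f a = f' c * (b - a).
Proof.
move=> ab fd fc.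
have D x : x \in `]a, b[%R -> is_derive x 1 f (f' x).
  by rewrite in_itv/=; exact: fd.
have C : {within `[a, b], continuous f}.
  by apply: continuous_in_subspaceT => x; rewrite inE/= in_itv/=; exact: fc.
by have [c] := MVT ab D C; rewrite in_itv/= => cab e; exists c.
Qed.

Lemma sqrt_derive f x a : 0 < f x -> is_derive x 1 f a ->
  is_derive x 1 (fun y => Num.sqrt (f y)) (a / (2 * Num.sqrt (f x))).
Proof.
move=> f0 dfx; eapply is_derive_eq.
  exact: (dv_comp (is_derive1_sqrt f0) dfx).
by rewrite mulrC.
Qed.

Lemma derive_gt0_local f x l : is_derive x 1 f l -> 0 < l ->
  exists2 e, 0 < e & forall h, 0 < h < e -> f (x - h) < f x < f (x + h).
Proof.
move=> [df dfl] l0.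
have : h^-1 *: (f (h *: (1:R) + x) - f x) @[h --> (0:R)^'] --> l by rewrite -dfl.
move=> /cvgr_gt /(_ _ l0); rewrite near_withinE => /nbhs_ballP [e /= e0 he].
exists e => // h /andP[h0 hle].
have b1 : ball (0:R) e h by rewrite /ball/= sub0r normrN gtr0_norm.
have b2 : ball (0:R) e (- h) by rewrite /ball/= sub0r opprK gtr0_norm.
have hn0 : h != 0 by rewrite gt_eqF.
have nhn0 : - h != 0 by rewrite oppr_eq0.
have := he _ b1 hn0; have := he _ b2 nhn0.
rewrite /GRing.scale/= !mulr1 (addrC h) (addrC (- h)) invrN mulNr oppr_gt0.
by rewrite pmulr_rlt0 ?invr_gt0// pmulr_rgt0 ?invr_gt0// subr_lt0 subr_gt0 => -> ->.
Qed.

Lemma continuous_gt0_local f x : {for x, continuous f} -> 0 < f x ->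
  exists2 e, 0 < e & forall y, `|x - y| < e -> 0 < f y.
Proof.
move=> cf fx0; have : nbhs x [set t | 0 < f t] by exact: (cvgr_gt (f x) cf 0 fx0).
by move=> /nbhs_ballP [e /= e0 he]; exists e => // y xy; apply: he.
Qed.

(* The zeros of [f] are all up-crossings, so [f] stays positive after the first one. *)
Lemma upcrossing f f' a b : a < b ->
  (forall x, a <= x <= b -> is_derive x 1 f (f' x)) -> f a = 0 ->
  (forall x, a <= x <= b -> f x = 0 -> 0 < f' x) -> 0 < f b.
Proof.
move=> ab fd fa f0; rewrite ltNge; apply/negP => fb.
(* At [c = sup S], a negative value contradicts continuity; a zero with [a < c] would, being an
   up-crossing, make [f] negative just before [c]; in the remaining cases [S] extends beyond [c]. *)
pose S := [set x | a <= x <= b /\ forall y, a <= y <= x -> 0 <= f y].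
have Sa : S a.
  split; first by rewrite lexx ltW.
  by move=> y; rewrite -eq_le => /eqP <-; rewrite fa.
have Sb : has_sup S by split; [exists a|exists b => x [/andP[]]].
set c := sup S.
have ac : a <= c by exact: ub_le_sup Sb.2 _ Sa.
have cb : c <= b by apply: sup_le_ub => [|x [/andP[]]//]; exists a.
have fy y : a <= y -> y < c -> 0 <= f y.
  move=> ay yc; have [|x [xab fx] yx] := @sup_adherent R S (c - y) _ Sb.
    by rewrite subr_gt0.
  by apply: fx; rewrite ay ltW//; move: yx; rewrite -/c; lra.
have cab : a <= c <= b by rewrite ac.
have cf : {for c, continuous f} by exact: dv_continuous (fd _ cab).
have extend e : 0 < e -> (forall h, 0 < h < e -> 0 < f (c + h)) -> c < b -> 0 <= f c -> False.
  move=> e0 fe clb fc.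
  pose h := Num.min (e / 2) (b - c).
  have h0 : 0 < h by rewrite lt_min subr_gt0 clb divr_gt0.
  have he : h <= e / 2 by rewrite ge_min lexx.
  have hb : h <= b - c by rewrite ge_min lexx orbT.
  have : S (c + h).
    split; first by apply/andP; split; lra.
    move=> y /andP[ay ych]; have [yc|] := ltP y c; first exact: fy.
    rewrite le_eqVlt => /orP[/eqP <-//|cy].
    by rewrite -(subrK c y) addrC ltW// fe// subr_gt0 cy/=; lra.
  by move=> /(ub_le_sup Sb.2); rewrite -/c; lra.
have [fc|fc|fc] := ltgtP (f c) 0.
- have [||e e0 he] := @continuous_gt0_local (fun y => - f y) c.
    + exact: cvgN.
    + by rewrite oppr_gt0.
  have ca : a < c.
    by rewrite lt_neqAle ac andbT; apply/eqP => e1; move: fc; rewrite -e1 fa ltxx.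
  pose y := Num.max a (c - e / 2).
  have yc : y < c by rewrite gt_max ca/=; lra.
  have ay : a <= y by rewrite le_max lexx.
  have := fy y ay yc; apply/negP; rewrite -ltNge -oppr_gt0; apply: he.
  have : c - e / 2 <= y by rewrite le_max lexx orbT.
  by rewrite ger0_norm; lra.
- have [e e0 he] := continuous_gt0_local cf fc.
  apply: (extend e e0) => //; last exact: ltW.
    move=> h /andP[h0 hle]; apply: he.
    by rewrite opprD addrA subrr add0r normrN gtr0_norm.
  by rewrite lt_neqAle cb andbT; apply/eqP => e1; move: fb; rewrite -e1 leNgt fc.
- have [e e0 he] := derive_gt0_local (fd _ cab) (f0 _ cab fc).
  have [ca|ca] := ltrP a c.
    pose h := Num.min (e / 2) (c - a).
    have h0 : 0 < h by rewrite lt_min subr_gt0 ca divr_gt0.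
    have h1 : h <= e / 2 by rewrite ge_min lexx.
    have h2 : h <= c - a by rewrite ge_min lexx orbT.
    have [|] := andP (he h _); first by rewrite h0/=; lra.
    rewrite fc ltNge => /negP + _; apply; apply: fy; lra.
  apply: (extend e e0) => //; rewrite ?fc//.
    by move=> h /he /andP[_]; rewrite fc.
  lra.
Qed.

End PointwiseDerivatives.

(** Syntax-directed differentiation, taking the derivatives of unknown functions from the context.
    [dv] leaves the equality of the computed derivative with the claimed one, and the nonvanishing
    conditions of inverses. *)
Ltac dv_step := first [
 lazymatch goal with |- is_derive _ _ (fun _ => ?c) _ => eapply (dv_cst c) end
| lazymatch goal with
 | |- is_derive _ _ (fun x => x) _ => eapply dv_id
 | |- is_derive _ _ (fun x => @?f x + @?g x) _ => eapply (dv_add (f:=f) (g:=g)); [dv_step|dv_step]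
 | |- is_derive _ _ (fun x => - @?f x) _ => eapply (dv_opp (f:=f)); dv_step
 | |- is_derive _ _ (fun x => @?f x * @?g x) _ => eapply (dv_mul (f:=f) (g:=g)); [dv_step|dv_step]
 | |- is_derive _ _ (fun x => @?f x ^+ ?n) _ => eapply (dv_exp (f:=f) n); dv_step
 | |- is_derive _ _ (fun x => (@?f x)^-1) _ => eapply (dv_inv (f:=f)); [|dv_step]
 | |- is_derive _ _ (fun x => expR (@?f x)) _ => eapply (dv_comp (g:=f)); [apply: is_derive_expR|dv_step]
 | |- is_derive _ _ (fun x => cos (@?f x)) _ => eapply (dv_comp (g:=f)); [apply: is_derive_cos|dv_step]
 | |- is_derive _ _ (fun x => sin (@?f x)) _ => eapply (dv_comp (g:=f)); [apply: is_derive_sin|dv_step]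
 | |- is_derive _ _ (fun x => ?h (@?f x)) _ => first
     [ solve [eauto]
     | eapply (dv_comp (f:=h) (g:=f)); [solve [eauto]|dv_step] ]
 | |- is_derive _ _ ?f _ => solve [eauto]
 end].
Ltac dv := eapply is_derive_eq; [dv_step|].

Ltac dvr := lazymatch goal with |- context [fmap ?f _] => eapply (dv_cvg_right (f:=f)); dv_step end.

(** * Differentiation under the integral and exact integrals *)

Section RealIntegrals.
Variable R : realType.
Notation mu := (@lebesgue_measure R).

Lemma dominated_integrable (B : set R) (f G : R -> R) : measurable B ->
  continuous f -> mu.-integrable B (EFin \o G) ->
  (forall y, B y -> `|f y| <= G y) -> mu.-integrable B (EFin \o f).
Proof.
move=> mB cf iG fG; apply: (@le_integrable _ _ _ mu B mB _ _ _ _ iG).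
  apply/measurable_EFinP; apply: measurable_funTS; exact: continuous_measurable_fun.
by move=> y By; rewrite lee_fin/= (le_trans (fG y By))// ler_norm.
Qed.

Lemma integrable_scale (B : set R) (c : R) (f : R -> R) : measurable B ->
  mu.-integrable B (EFin \o f) -> mu.-integrable B (EFin \o (fun y => c * f y)).
Proof. by move=> mB fi; exact: (@integrableZl _ _ _ mu B mB c _ fi). Qed.

Lemma integrable_add (B : set R) (f g : R -> R) : measurable B ->
  mu.-integrable B (EFin \o f) -> mu.-integrable B (EFin \o g) ->
  mu.-integrable B (EFin \o (fun y => f y + g y)).
Proof. by move=> mB fi gi; exact: (@integrableD _ _ _ mu B mB _ _ fi gi). Qed.

Lemma rintD (B : set R) (f g : R -> R) : measurable B ->
  mu.-integrable B (EFin \o f) -> mu.-integrable B (EFin \o g) ->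
  rint B (fun y => f y + g y) = rint B f + rint B g.
Proof. by move=> mB fi gi; exact: (@RintegralD _ _ _ mu B f g mB). Qed.

Lemma rintZ (B : set R) (c : R) (f : R -> R) : measurable B ->
  mu.-integrable B (EFin \o f) -> rint B (fun y => c * f y) = c * rint B f.
Proof. by move=> mB fi; exact: (@RintegralZl _ _ _ mu B f c mB). Qed.

Lemma rint_derive (B : set R) (f f1 : R -> R -> R) (G : R -> R) (z u v : R) :
  measurable B -> u < z < v -> mu.-integrable B (EFin \o G) ->
  (forall y, 0 <= G y) ->
  (forall x, continuous (f x)) ->
  (forall x y, is_derive x (1:R) (f ^~ y) (f1 x y)) ->
  (forall x y, u < x < v -> B y -> `|f x y| <= G y) ->
  (forall x y, u < x < v -> B y -> `|f1 x y| <= G y) ->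
  is_derive z (1:R) (fun x => rint B (f x)) (rint B (f1 z)).
Proof.
move=> mB zuv iG G0 cf fd fG f1G.
have d1E x y : partial1of2 f x y = f1 x y.
  by rewrite partial1of2E; have [_ ->] := fd x y.
have Ifz x : `]u, v[%classic x -> mu.-integrable B (EFin \o f x).
  by rewrite /= in_itv/= => xuv; apply: dominated_integrable iG _ => // y; exact: fG.
have zI : `]u, v[%classic z by rewrite /= in_itv.
have dI x y : `]u, v[%classic x -> B y -> derivable (f ^~ y) x 1.
  by move=> _ _; have [] := fd x y.
have GI x y : `]u, v[%classic x -> B y -> `|partial1of2 f x y| <= G y.
  by rewrite /= in_itv/= d1E; exact: f1G.
have D := @derivable_under_integral R _ _ mu f B mB z u v zI Ifz dI G G0 iG GI.
have E := @differentiation_under_integral R _ _ mu f B mB z u v zI Ifz dI G G0 iG GI.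
apply: DeriveDef => //.
rewrite -derive1E E; apply: eq_Rintegral => y _; exact: d1E.
Qed.

Lemma rint_segment_derive (F f : R -> R) (a b : R) : a < b ->
  continuous f -> (forall x, is_derive x (1:R) F (f x)) ->
  rint `[a, b] f = F b - F a.
Proof.
move=> ab cf Ff; rewrite /rint /Rintegral (@continuous_FTC2 _ f F)//.
- exact: continuous_subspaceT.
- have cF x : {for x, continuous F} by exact: dv_continuous (Ff x).
  split => [x _||]; first by have [] := Ff x.
    exact/cvg_at_right_filter/cF.
  exact/cvg_at_left_filter/cF.
- by move=> x _; rewrite derive1E; have [_ ->] := Ff x.
Qed.

Lemma cvg_expRN : expR (- x) @[x --> +oo%R] --> (0:R).
Proof. exact: cvgr_expR. Qed.

Lemma integrable_expRN (C : R) : 0 <= C ->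
  mu.-integrable `[0, +oo[ (EFin \o (fun t => C * expR (- t))).
Proof.
move=> C0; have cf : continuous (fun t : R => C * expR (- t)).
  by move=> t; apply: (@dv_continuous _ _ _ (C * (expR (-t) * -1))); dv => //; ring.
apply/integrableP; split.
  apply/measurable_EFinP; apply: measurable_funTS; exact: continuous_measurable_fun.
under eq_integral => t _.
  rewrite /= ger0_norm; last by rewrite mulr_ge0// expR_ge0.
  over.
rewrite (@ge0_continuous_FTC2y _ (fun t => C * expR (- t)) (fun t => - (C * expR (-t))) 0 (- (C * 0))) //=.
- by rewrite ltry.
- by move=> x _; rewrite mulr_ge0// expR_ge0.
- exact: continuous_subspaceT.
- by apply: cvgN; apply: cvgMr; exact: cvg_expRN.
- by dvr.
- by move=> x _; eapply dv_derive1; dv; ring.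
Qed.

(* [f] may change sign, so a multiple of [expR (- t)] is added to it before
   the fundamental theorem on the half-line is applied. *)
Lemma rint_halfline_derive (F f : R -> R) (C : R) : 0 <= C ->
  continuous f -> (forall x, is_derive x (1:R) F (f x)) ->
  (forall x, 0 <= x -> `|f x| <= C * expR (- x)) ->
  (forall x, 0 <= x -> `|F x| <= C * expR (- x)) ->
  rint `[0, +oo[ f = - F 0.
Proof.
move=> C0 cf Ff fC FC.
have iC := integrable_expRN C0.
have mD : measurable (`[0, +oo[%classic : set R) by [].
have if_ : mu.-integrable `[0, +oo[ (EFin \o f).
  apply: (dominated_integrable mD cf iC) => y /=.
  by rewrite in_itv/= andbT; exact: fC.
have cC : continuous (fun t : R => C * expR (- t)).
  by move=> t; apply: (@dv_continuous _ _ _ (C * (expR (-t) * -1))); dv => //; ring.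
have E1 : rint `[0, +oo[ (fun t => f t + C * expR (- t)) = 0 - (F 0 - C * expR (- 0)).
  apply: (@Rintegral_ge0_continuous_FTC2y _ _ (fun t => F t - C * expR (- t))).
  - by move=> x x0; have := fC x x0; rewrite ler_norml => /andP[]; lra.
  - by apply: continuous_subspaceT => x; apply: cvgD; [exact: cf|exact: cC].
  - rewrite -(subr0 (0:R)); apply: cvgB; last first.
      by rewrite -(mulr0 C); apply: cvgMr; exact: cvg_expRN.
    apply/norm_cvg0P; apply: (@squeeze_cvgr _ _ _ _ (cst 0) (fun t => C * expR (- t))).
    + near=> t; rewrite normr_ge0/= FC//; near: t; exact: nbhs_pinfty_ge.
    + exact: cvg_cst.
    + by rewrite -(mulr0 C); apply: cvgMr; exact: cvg_expRN.
  - by move=> x _; eapply dv_derivable; dv_step.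
  - by dvr.
  - by move=> x _; eapply dv_derive1; dv; ring.
have E2 : rint `[0, +oo[ (fun t => C * expR (- t)) = 0 - (- (C * expR (- 0))).
  apply: (@Rintegral_ge0_continuous_FTC2y _ _ (fun t => - (C * expR (- t)))).
  - by move=> x _; rewrite mulr_ge0// expR_ge0.
  - exact: continuous_subspaceT.
  - by rewrite -oppr0 -(mulr0 C); apply: cvgN; apply: cvgMr; exact: cvg_expRN.
  - by move=> x _; eapply dv_derivable; dv_step.
  - by dvr.
  - by move=> x _; eapply dv_derive1; dv; ring.
have := E1; rewrite /rint RintegralD//.
move: E2; rewrite /rint => ->; lra.
Unshelve. all: end_near. Qed.

End RealIntegrals.

(** * The Bessel equation from the integral representations *)

Section BesselEquation.
Variable R : realType.
Notation mu := (@lebesgue_measure R).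

(** The majorant [G u] depends on a lower bound [u] of the argument, because the exponential kernel
    has no common majorant down to [0]. It is applied with [u = z / 2]. *)
Lemma kernel_derive2 (B : set R) (K K1 K2 G : R -> R -> R) :
  measurable B ->
  (forall x, continuous (K x)) -> (forall x, continuous (K1 x)) ->
  (forall x, continuous (K2 x)) ->
  (forall x y : R, is_derive x (1:R) (K ^~ y) (K1 x y)) ->
  (forall x y : R, is_derive x (1:R) (K1 ^~ y) (K2 x y)) ->
  (forall u : R, 0 < u -> mu.-integrable B (EFin \o G u)) ->
  (forall u y, 0 <= G u y) ->
  (forall u x y : R, 0 < u -> u < x -> B y ->
     [/\ `|K x y| <= G u y, `|K1 x y| <= G u y & `|K2 x y| <= G u y]) ->
  forall z nu : R, 0 < z ->
  [/\ is_derive z (1:R) (fun x => rint B (K x)) (rint B (K1 z)),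
      is_derive z (1:R) (fun x => rint B (K1 x)) (rint B (K2 z)) &
      z ^+ 2 * rint B (K2 z) + z * rint B (K1 z) + (z ^+ 2 - nu ^+ 2) * rint B (K z)
      = rint B (fun y => z ^+ 2 * K2 z y + z * K1 z y + (z ^+ 2 - nu ^+ 2) * K z y)].
Proof.
move=> mB cK cK1 cK2 dK dK1 iG G0 KG z nu z0.
have zI : z / 2 < z < z + 1 by apply/andP; split; lra.
have u0 : 0 < z / 2 by lra.
have b x y : z / 2 < x < z + 1 -> B y -> [/\ `|K x y| <= G (z / 2) y,
   `|K1 x y| <= G (z / 2) y & `|K2 x y| <= G (z / 2) y].
  by move=> /andP[zx _]; exact: KG.
have bz y : B y -> [/\ `|K z y| <= G (z / 2) y,
   `|K1 z y| <= G (z / 2) y & `|K2 z y| <= G (z / 2) y] by exact: b.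
split.
- by apply: (rint_derive mB zI (iG _ u0)) => // x y xI /(b _ _ xI)[].
- by apply: (rint_derive mB zI (iG _ u0)) => // x y xI /(b _ _ xI)[].
- have iK : mu.-integrable B (EFin \o K z).
    by apply: (dominated_integrable mB _ (iG _ u0)) => // y /bz[].
  have iK1 : mu.-integrable B (EFin \o K1 z).
    by apply: (dominated_integrable mB _ (iG _ u0)) => // y /bz[].
  have iK2 : mu.-integrable B (EFin \o K2 z).
    by apply: (dominated_integrable mB _ (iG _ u0)) => // y /bz[].
  rewrite rintD//; last 2 first.
  - by apply: integrable_add => //; exact: integrable_scale.
  - exact: integrable_scale.
  by rewrite rintD ?rintZ//; exact: integrable_scale.
Qed.

(** The shift [phi] treats both kinds at once: [phi = 0] gives the integrand of [J],
    [phi = - pi / 2] that of [Y]. *)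
Definition trigK (nu phi x th : R) := cos (x * sin th - nu * th + phi).
Definition trigK1 (nu phi x th : R) := - sin th * sin (x * sin th - nu * th + phi).
Definition trigK2 (nu phi x th : R) := - sin th ^+ 2 * cos (x * sin th - nu * th + phi).

Lemma trig_bessel (nu phi z : R) : 0 < z ->
  [/\ is_derive z (1:R) (fun x => rint `[0, pi] (trigK nu phi x)) (rint `[0, pi] (trigK1 nu phi z)),
      is_derive z (1:R) (fun x => rint `[0, pi] (trigK1 nu phi x)) (rint `[0, pi] (trigK2 nu phi z)) &
      z ^+ 2 * rint `[0, pi] (trigK2 nu phi z) + z * rint `[0, pi] (trigK1 nu phi z)
        + (z ^+ 2 - nu ^+ 2) * rint `[0, pi] (trigK nu phi z)
      = (nu - z) * sin (phi - nu * pi) - (nu + z) * sin phi].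
Proof.
move=> z0.
have cK x : continuous (trigK nu phi x).
  by move=> t; eapply dv_continuous; rewrite /trigK; dv_step.
have cK1 x : continuous (trigK1 nu phi x).
  by move=> t; eapply dv_continuous; rewrite /trigK1; dv_step.
have cK2 x : continuous (trigK2 nu phi x).
  by move=> t; eapply dv_continuous; rewrite /trigK2; dv_step.
have sin1 (x : R) : `|sin x| <= 1 by rewrite ler_norml sin_geN1 sin_le1.
have cos1 (x : R) : `|cos x| <= 1 by rewrite ler_norml cos_geN1 cos_le1.
have mB : measurable (`[0, pi]%classic : set R) by [].
have d0 (x y : R) : is_derive x (1:R) (trigK nu phi ^~ y) (trigK1 nu phi x y).
  by rewrite /trigK /trigK1; dv; ring.
have d1 (x y : R) : is_derive x (1:R) (trigK1 nu phi ^~ y) (trigK2 nu phi x y).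
  by rewrite /trigK1 /trigK2; dv; ring.
have i1 (u : R) : 0 < u -> mu.-integrable `[0, pi] (EFin \o (fun=> 1)).
  move=> _; apply: continuous_compact_integrable; first exact: segment_compact.
  by apply: continuous_subspaceT; exact: cst_continuous.
have b1 (u x y : R) : 0 < u -> u < x -> `[0, pi]%classic y ->
    [/\ `|trigK nu phi x y| <= 1, `|trigK1 nu phi x y| <= 1 & `|trigK2 nu phi x y| <= 1].
  move=> _ _ _; rewrite /trigK /trigK1 /trigK2 !normrM !normrN normrX; split => //.
    by rewrite mulr_ile1.
  by rewrite mulr_ile1 ?exprn_ge0// exprn_ile1.
have [D1 D2 ->] := @kernel_derive2 _ _ _ _ (fun _ _ => 1) mB cK cK1 cK2 d0 d1 i1
  (fun _ _ => ler01) b1 z nu z0.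
split => //.
(* The Bessel operator applied to the kernel is exactly the [th]-derivative of [F], so that only
   boundary values survive. *)
pose F (th : R) := (z * cos th + nu) * sin (z * sin th - nu * th + phi).
transitivity (F pi - F 0).
  apply: rint_segment_derive; first exact: pi_gt0.
    by move=> t; eapply dv_continuous; rewrite /trigK /trigK1 /trigK2; dv_step.
  move=> t; rewrite /trigK /trigK1 /trigK2 /F.
  dv.
  have := cos2Dsin2 t => /(canRL (addKr _)) ->.
  ring.
rewrite /F cos0 cospi.
have -> : z * sin pi - nu * pi + phi = phi - nu * pi by rewrite sinpi; ring.
have -> : z * sin 0 - nu * 0 + phi = phi by rewrite sin0; ring.
ring.
Qed.

Definition expK (m x t : R) := expR (- (x * sinhR t) - m * t).
Definition expK1 (m x t : R) := - sinhR t * expR (- (x * sinhR t) - m * t).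
Definition expK2 (m x t : R) := sinhR t ^+ 2 * expR (- (x * sinhR t) - m * t).

Let coshR (t : R) : R := (expR t + expR (- t)) / 2.

Lemma sinhR_derive (t : R) : is_derive t (1:R) (@sinhR R) (coshR t).
Proof. by rewrite /sinhR /coshR; dv; ring. Qed.

Lemma sinhR_ge_sqr (t : R) : 0 <= t -> t ^+ 2 / 4 <= sinhR t.
Proof.
move=> t0; rewrite /sinhR.
have h1 := expR_ge1Dxn 1 t0.
have h2 : expR (- t) <= 1 by rewrite expR_le1; lra.
by move: h1; rewrite (_ : 2`! = 2)%N//; nra.
Qed.

(** The quadratic lower bound on [sinhR] absorbs every linear exponent by completing a square. In
    [|m| + 3], two units pay for [s <= expR t ^+ 2] and one for the decay [expR (- t)] on the
    right. *)
Lemma expK_bound (m u x s t : R) : 0 < u -> u <= x -> 0 <= t ->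
  0 <= s <= expR t ^+ 2 ->
  s * expR (- (x * sinhR t) - m * t) <= expR ((`|m| + 3) ^+ 2 / u) * expR (- t).
Proof.
move=> u0 ux t0 /andP[s0 st].
apply: (@le_trans _ _ (expR t ^+ 2 * expR (- (x * sinhR t) - m * t))).
  by rewrite ler_wpM2r// expR_ge0.
rewrite -expRM_natl -!expRD ler_expR.
have h := sinhR_ge_sqr t0.
have mm : - m * t <= `|m| * t.
  by rewrite ler_wpM2r// -normrN ler_norm.
set M := `|m| in mm *.
have h1 : u * (t ^+ 2 / 4) <= x * sinhR t.
  apply: le_trans (ler_wpM2r _ ux) => //; last by apply: le_trans h; apply: divr_ge0 => //; apply: sqr_ge0.
  by rewrite ler_pM2l.
have h2 : (M + 3) * t <= u * (t ^+ 2 / 4) + (M + 3) ^+ 2 / u.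
  rewrite -subr_ge0.
  have -> : u * (t ^+ 2 / 4) + (M + 3) ^+ 2 / u - (M + 3) * t
     = (u * t / 2 - (M + 3)) ^+ 2 / u by field; rewrite gt_eqF.
  by rewrite divr_ge0 ?sqr_ge0// ltW.
lra.
Qed.

Lemma exp_bessel (m z : R) : 0 < z ->
  [/\ is_derive z (1:R) (fun x => rint `[0, +oo[ (expK m x)) (rint `[0, +oo[ (expK1 m z)),
      is_derive z (1:R) (fun x => rint `[0, +oo[ (expK1 m x)) (rint `[0, +oo[ (expK2 m z)),
      mu.-integrable `[0, +oo[ (EFin \o expK m z) &
      z ^+ 2 * rint `[0, +oo[ (expK2 m z) + z * rint `[0, +oo[ (expK1 m z)
        + (z ^+ 2 - m ^+ 2) * rint `[0, +oo[ (expK m z) = z - m].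
Proof.
move=> z0.
have dS := sinhR_derive.
have cK x : continuous (expK m x).
  by move=> t; eapply dv_continuous; rewrite /expK; dv_step.
have cK1 x : continuous (expK1 m x).
  by move=> t; eapply dv_continuous; rewrite /expK1; dv_step.
have cK2 x : continuous (expK2 m x).
  by move=> t; eapply dv_continuous; rewrite /expK2; dv_step.
have d0 (x y : R) : is_derive x (1:R) (expK m ^~ y) (expK1 m x y).
  by rewrite /expK /expK1; dv; ring.
have d1 (x y : R) : is_derive x (1:R) (expK1 m ^~ y) (expK2 m x y).
  by rewrite /expK1 /expK2; dv; ring.
pose C u : R := expR ((`|m| + 3) ^+ 2 / u).
have mB : measurable (`[0, +oo[%classic : set R) by [].
have i1 (u : R) : 0 < u -> mu.-integrable `[0, +oo[ (EFin \o (fun t => C u * expR (- t))).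
  by move=> _; apply: integrable_expRN; exact: expR_ge0.
have p1 (u y : R) : 0 <= C u * expR (- y) by rewrite mulr_ge0 ?expR_ge0.
have s0 (t : R) : 0 <= t -> [/\ 1 <= expR t, 0 <= sinhR t & sinhR t <= expR t].
  move=> t0; have h : expR (- t) <= 1 by rewrite expR_le1; lra.
  have h1 := expR_ge0 (- t).
  have h2 : 1 <= expR t by have := expR_ge1Dx t; lra.
  by rewrite /sinhR; split; lra.
have b1 (u x y : R) : 0 < u -> u < x -> `[0, +oo[%classic y ->
    [/\ `|expK m x y| <= C u * expR (- y), `|expK1 m x y| <= C u * expR (- y)
      & `|expK2 m x y| <= C u * expR (- y)].
  move=> u0 ux; rewrite /= in_itv/= andbT => y0.
  have [e1 s1 s2] := s0 y y0.
  have e2 : expR y <= expR y ^+ 2 by rewrite expr2 ler_peMr// expR_ge0.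
  rewrite /expK /expK1 /expK2 (normrM (- sinhR y)) (normrM (sinhR y ^+ 2))
    !normrN !(ger0_norm (expR_ge0 _)) (ger0_norm s1) (ger0_norm (sqr_ge0 _)).
  split; last 2 first.
  - by apply: expK_bound => //; [exact: ltW|rewrite s1 (le_trans s2)].
  - apply: expK_bound => //; first exact: ltW.
    by rewrite sqr_ge0/= !expr2 ler_pM.
  by rewrite -[leLHS]mul1r; apply: expK_bound => //; [exact: ltW|lra].
have [D1 D2 ->] := @kernel_derive2 _ _ _ _ (fun u t => C u * expR (- t)) mB cK cK1 cK2 d0 d1 i1
  p1 b1 z m z0.
have u0 : 0 < z / 2 by lra.
have uz : z / 2 < z by lra.
split => //.
  by apply: (dominated_integrable mB (cK z) (i1 _ u0)) => y /(b1 _ z _ u0 uz)[].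
(* Again an exact primitive; it vanishes at infinity, and [- F 0 = z - m]. *)
pose F (t : R) := (m - z * coshR t) * expR (- (z * sinhR t) - m * t).
transitivity (- F 0); last first.
  rewrite /F /coshR /sinhR oppr0 expR0.
  have -> : - (z * ((1 - 1) / 2)) - m * 0 = 0 by ring.
  by rewrite expR0; field.
(* One constant has to bound both the integrand, through its three coefficients, and [F], through
   [|m| + z]. *)
pose K := z ^+ 2 + z + `|z ^+ 2 - m ^+ 2| + `|m|.
have K0 : 0 <= K by rewrite /K !addr_ge0// ?sqr_ge0// ltW.
have CK0 : 0 <= C (z / 2) by exact: expR_ge0.
apply: (@rint_halfline_derive _ _ _ (K * C (z / 2))).
- by rewrite mulr_ge0.
- move=> t; eapply dv_continuous; rewrite /expK /expK1 /expK2; dv_step.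
- move=> t; rewrite /F /expK /expK1 /expK2 /coshR; dv.
  have e : expR t * expR (- t) = 1 by exact: expRxMexpNx_1.
  set E := expR (_ - _); rewrite /sinhR /coshR.
  have -> : ((expR t - expR (- t)) / 2) ^+ 2 = ((expR t + expR (- t)) / 2) ^+ 2
      - expR t * expR (- t) by field.
  by rewrite e; field.
- move=> t t0; have tB : `[0, +oo[%classic t by rewrite /= in_itv/= t0.
  have [k0 k1 k2] := b1 (z / 2) z t u0 uz tB.
  have z2 : `|z ^+ 2| = z ^+ 2 by rewrite ger0_norm// sqr_ge0.
  have z1 : `|z| = z by rewrite gtr0_norm.
  apply: le_trans (ler_normD _ _) _.
  apply: le_trans (lerD (ler_normD _ _) (lexx _)) _.
  rewrite (normrM (z ^+ 2)) z2 (normrM z) (normrM (_ - _)) z1 -mulrA.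
  set E := C _ * _ in k0 k1 k2 *.
  rewrite /K !mulrDl.
  apply: (@le_trans _ _ (z ^+ 2 * E + z * E + `|z ^+ 2 - m ^+ 2| * E)); last first.
    by rewrite lerDl mulr_ge0// /E p1.
  by rewrite !lerD// ler_wpM2l// ?sqr_ge0// ltW.
- move=> t t0; have [e1 s1 s2] := s0 t t0.
  have h : expR (- t) <= 1 by rewrite expR_le1; lra.
  have h1 := expR_ge0 (- t).
  have c1 : `|coshR t| <= expR t by rewrite /coshR ger0_norm; lra.
  rewrite /F normrM (ger0_norm (expR_ge0 _)).
  apply: (@le_trans _ _ ((`|m| + z) * (expR t * expR (- (z * sinhR t) - m * t)))).
    rewrite [leRHS]mulrA ler_wpM2r ?expR_ge0// mulrDl.
    apply: le_trans (ler_normB _ _) _; rewrite normrM (gtr0_norm z0).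
    apply: lerD; first by rewrite ler_peMr.
    by rewrite ler_pM2l.
  rewrite -mulrA; apply: ler_pM.
  - by rewrite addr_ge0// ltW.
  - by apply: mulr_ge0; exact: expR_ge0.
  - by have := sqr_ge0 z; have := normr_ge0 (z ^+ 2 - m ^+ 2); rewrite /K; lra.
  - by apply: expK_bound => //; [exact: ltW|rewrite expR_ge0 expr2 ler_peMr ?expR_ge0].
Qed.

(** Neither integral solves the equation alone: the trigonometric one leaves the defect
    [(z - nu) sin (nu pi)], which the exponential one cancels. *)
Lemma BesselJ_ode (nu : R) : exists J1 J2 : R -> R, forall z : R, 0 < z ->
  [/\ is_derive z (1:R) (BesselJ nu) (J1 z), is_derive z (1:R) J1 (J2 z) &
      z ^+ 2 * J2 z + z * J1 z + (z ^+ 2 - nu ^+ 2) * BesselJ nu z = 0].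
Proof.
exists (fun z => pi^-1 * rint `[0, pi] (trigK1 nu 0 z)
   - sin (nu * pi) / pi * rint `[0, +oo[ (expK1 nu z)).
exists (fun z => pi^-1 * rint `[0, pi] (trigK2 nu 0 z)
   - sin (nu * pi) / pi * rint `[0, +oo[ (expK2 nu z)).
move=> z z0.
have JE : BesselJ nu = fun z => pi^-1 * rint `[0, pi] (trigK nu 0 z)
   - sin (nu * pi) / pi * rint `[0, +oo[ (expK nu z).
  apply/funext => x; rewrite /BesselJ; congr (_ * rint _ _ - _).
  by apply/funext => t; rewrite /trigK addr0.
have [a1 a2 a3] := trig_bessel nu 0 z0.
have [b1 b2 _ b3] := exp_bessel nu z0.
rewrite JE; split; [by dv; ring|by dv; ring|].
set T2 := rint _ (trigK2 _ _ _) in a3 *; set T1 := rint _ (trigK1 _ _ _) in a3 *.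
set T0 := rint _ (trigK _ _ _) in a3 *.
set E2 := rint _ (expK2 _ _) in b3 *; set E1 := rint _ (expK1 _ _) in b3 *.
set E0 := rint _ (expK _ _) in b3 *.
transitivity (pi^-1 * (z ^+ 2 * T2 + z * T1 + (z ^+ 2 - nu ^+ 2) * T0)
  - sin (nu * pi) / pi * (z ^+ 2 * E2 + z * E1 + (z ^+ 2 - nu ^+ 2) * E0)); first by ring.
by rewrite a3 b3 sub0r sinN sin0; ring.
Qed.

(** The same cancellation, with [phi = - pi / 2] and the exponents [m = - nu] and [m = nu], the
    latter weighted by [cos (nu pi)]. *)
Lemma BesselY_ode (nu : R) : exists J1 J2 : R -> R, forall z : R, 0 < z ->
  [/\ is_derive z (1:R) (BesselY nu) (J1 z), is_derive z (1:R) J1 (J2 z) &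
      z ^+ 2 * J2 z + z * J1 z + (z ^+ 2 - nu ^+ 2) * BesselY nu z = 0].
Proof.
have p0 : (pi : R) != 0 by rewrite gt_eqF// pi_gt0.
pose H (k : R -> R -> R -> R) z := rint `[0, +oo[ (k (- nu) z)
  + cos (nu * pi) * rint `[0, +oo[ (k nu z).
exists (fun z => pi^-1 * rint `[0, pi] (trigK1 nu (- (pi / 2)) z) - pi^-1 * H expK1 z).
exists (fun z => pi^-1 * rint `[0, pi] (trigK2 nu (- (pi / 2)) z) - pi^-1 * H expK2 z).
have mB : measurable (`[0, +oo[%classic : set R) by [].
have JE x : 0 < x -> BesselY nu x =
    pi^-1 * rint `[0, pi] (trigK nu (- (pi / 2)) x) - pi^-1 * H expK x.
  move=> x0; rewrite /BesselY; congr (_ * rint _ _ - _ * _).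
    by apply/funext => t; rewrite /trigK -cosBpihalf.
  have [_ _ i1 _] := exp_bessel nu x0.
  have [_ _ i2 _] := exp_bessel (- nu) x0.
  rewrite /H -rintZ// -rintD//; last exact: integrable_scale.
  congr rint; apply/funext => t; rewrite /expK mulNr opprK mulrDl.
  rewrite -expRD (addrC (nu * t)); congr (_ + _).
  by rewrite mulrAC -expRD (addrC (- (nu * t))) mulrC.
move=> z z0.
have [a1 a2 a3] := trig_bessel nu (- (pi / 2)) z0.
have [b1 b2 _ b3] := exp_bessel nu z0.
have [c1 c2 _ c3] := exp_bessel (- nu) z0.
split.
- have D : is_derive z (1:R) (fun x => pi^-1 * rint `[0, pi] (trigK nu (- (pi / 2)) x)
      - pi^-1 * H expK x)
    (pi^-1 * rint `[0, pi] (trigK1 nu (- (pi / 2)) z) - pi^-1 * H expK1 z).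
    by rewrite /H; dv; ring.
  apply: near_eq_is_derive D.
  near=> x; apply/esym/JE; near: x; exact: lt_nbhsr.
- by rewrite /H; dv; ring.
rewrite JE// /H.
set T2 := rint _ (trigK2 _ _ _) in a3 *; set T1 := rint _ (trigK1 _ _ _) in a3 *.
set T0 := rint _ (trigK _ _ _) in a3 *.
set E2 := rint _ (expK2 nu _) in b3 *; set E1 := rint _ (expK1 nu _) in b3 *.
set E0 := rint _ (expK nu _) in b3 *.
set G2 := rint _ (expK2 (- nu) _) in c3 *; set G1 := rint _ (expK1 (- nu) _) in c3 *.
set G0 := rint _ (expK (- nu) _) in c3 *.
transitivity (pi^-1 * (z ^+ 2 * T2 + z * T1 + (z ^+ 2 - nu ^+ 2) * T0)
  - pi^-1 * ((z ^+ 2 * G2 + z * G1 + (z ^+ 2 - (- nu) ^+ 2) * G0)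
      + cos (nu * pi) * (z ^+ 2 * E2 + z * E1 + (z ^+ 2 - nu ^+ 2) * E0))); first by ring.
rewrite a3 b3 c3.
rewrite sinB sinN cosN sin_pihalf cos_pihalf; ring.
Unshelve. all: end_near. Qed.

End BesselEquation.

(** * Measurability, monotonicity and scaling of iterated integrals *)

Section IteratedIntegral.
Variable R : realType.
Notation mu := (@lebesgue_measure R).
Notation mR := (measurableTypeR R).

(* Since [seq R] carries no sigma-algebra, joint measurability in a parameter
   and [n] coordinates is tested along measurable curves. *)
Definition measurable_coords (n : nat) d (T : measurableType d) (F : T -> seq R -> \bar R) :=
  forall d' (T' : measurableType d') (h : T' -> T) (gs : seq (T' -> mR)),
    measurable_fun setT h -> size gs = n ->
    (forall i, (i < n)%N -> measurable_fun setT (nth (fun=> 0 : mR) gs i)) ->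
    measurable_fun setT (fun t => F (h t) [seq g t | g <- gs]).

Lemma measurable_coords_cons n d (T : measurableType d) (F : T -> seq R -> \bar R) :
  measurable_coords n.+1 F ->
  measurable_coords n (fun (tx : T * mR) s => F tx.1 ((tx.2 : R) :: s)).
Proof.
move=> mF d' T' h gs mh sgs mgs.
apply: (mF _ _ (fst \o h) ((snd \o h) :: gs)) => /=.
- exact: measurableT_comp.
- by rewrite sgs.
- by move=> [|i] /= ilt; [exact: measurableT_comp|exact: mgs].
Qed.

Lemma measurable_coords_comp n d (T : measurableType d) d2 (T2 : measurableType d2)
    (k : T2 -> T) (F : T -> seq R -> \bar R) : measurable_fun setT k ->
  measurable_coords n F -> measurable_coords n (fun t => F (k t)).
Proof.
move=> mk mF d' T' h gs mh sgs mgs; apply: (mF _ _ (k \o h)) => //.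
exact: measurableT_comp.
Qed.

Lemma iint_ge0 n (f : seq R -> \bar R) : (forall s, 0 <= f s)%E -> (0 <= iint n f)%E.
Proof.
elim: n f => [|n IH] f f0 /=; first exact: f0.
by apply: integral_ge0 => x _; apply: IH => s; exact: f0.
Qed.

(** Induction on [n] moves one coordinate into the parameter, from [T] to [T * mR], and Tonelli
    removes it again; hence the quantification over all parameter spaces. *)
Lemma measurable_iint n d (T : measurableType d) (F : T -> seq R -> \bar R) :
  (forall t s, 0 <= F t s)%E -> measurable_coords n F ->
  measurable_fun setT (fun t => iint n (F t)).
Proof.
elim: n d T F => [|n IH] d T F F0 mF /=.
  by apply: (mF _ _ id [::]) => //; exact: measurable_id.
pose H (tx : T * mR) := iint n (fun s => F tx.1 ((tx.2 : R) :: s)).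
have mH : measurable_fun setT H.
  by apply: IH => [[t x] s|]; [exact: F0|exact: measurable_coords_cons].
apply: (@measurable_fun_fubini_tonelli_F _ _ T mR R mu H) => //.
by move=> tx; apply: iint_ge0 => s; exact: F0.
Qed.

Definition measurable_seq n (f : seq R -> \bar R) :=
  measurable_coords n (fun _ : mR => f).

Lemma measurable_iint_head n (f : seq R -> \bar R) : (forall s, 0 <= f s)%E ->
  measurable_seq n.+1 f -> measurable_fun setT (fun x : mR => iint n (fun s => f ((x : R) :: s))).
Proof.
move=> f0 mf; apply: measurable_iint => [x s|]; first exact: f0.
apply: (@measurable_coords_comp n _ _ _ _ (fun x : mR => (x, x) : mR * mR)
  (fun (tx : mR * mR) s => f ((tx.2 : R) :: s))).
  exact: measurable_fun_pair.
exact: (@measurable_coords_cons n _ _ (fun _ : mR => f) mf).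
Qed.

Lemma measurable_seq_cons n (f : seq R -> \bar R) (x : R) :
  measurable_seq n.+1 f -> measurable_seq n (fun s => f (x :: s)).
Proof.
move=> mf; apply: (@measurable_coords_comp n _ _ _ _ (fun t : mR => (t, x) : mR * mR)
  (fun (tx : mR * mR) s => f ((tx.2 : R) :: s))).
  exact: measurable_fun_pair.
exact: (@measurable_coords_cons n _ _ (fun _ : mR => f) mf).
Qed.

(** A nonnegative integral is a supremum over the simple functions below, so monotonicity holds for
    arbitrary functions. The [L^p] integrals can then be compared with radial models, the only ones
    shown to be measurable. *)
Lemma le_integral_ge0 (f g : R -> \bar R) : (forall x, 0 <= f x)%E ->
  (forall x, f x <= g x)%E -> (\int[mu]_x f x <= \int[mu]_x g x)%E.
Proof.
move=> f0 fg; rewrite !ge0_integralTE//; last first.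
  by move=> x; rewrite (le_trans (f0 x)).
apply: le_ereal_sup => _ [h /= hf <-]; exists h => //= x.
exact: le_trans (hf x) (fg x).
Qed.

Lemma le_iint n (f g : seq R -> \bar R) : (forall s, 0 <= f s)%E ->
  (forall s, size s = n -> f s <= g s)%E -> (iint n f <= iint n g)%E.
Proof.
elim: n f g => [|n IH] f g f0 fg /=; first exact: fg.
apply: le_integral_ge0 => x; first by apply: iint_ge0 => s; exact: f0.
by apply: IH => s; [exact: f0|move=> sn; apply: fg; rewrite /= sn].
Qed.

Lemma iintD n (f g : seq R -> \bar R) : (forall s, 0 <= f s)%E -> (forall s, 0 <= g s)%E ->
  measurable_seq n f -> measurable_seq n g ->
  iint n (fun s => f s + g s)%E = (iint n f + iint n g)%E.
Proof.
elim: n f g => [//|n IH] f g f0 g0 mf mg /=.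
under eq_integral => x _.
  rewrite IH//; first over.
  - exact: measurable_seq_cons.
  - exact: measurable_seq_cons.
rewrite ge0_integralD//.
- by move=> x _; apply: iint_ge0.
- exact: measurable_iint_head.
- by move=> x _; apply: iint_ge0.
- exact: measurable_iint_head.
Qed.

Lemma iintZ n (c : R) (f : seq R -> \bar R) : 0 <= c -> (forall s, 0 <= f s)%E ->
  measurable_seq n f -> iint n (fun s => c%:E * f s)%E = (c%:E * iint n f)%E.
Proof.
move=> c0; elim: n f => [//|n IH] f f0 mf /=.
under eq_integral => x _.
  rewrite IH//; first over.
  exact: measurable_seq_cons.
rewrite ge0_integralZl//.
- exact: measurable_iint_head.
- by move=> x _; apply: iint_ge0.
Qed.

Lemma ge0_integral_scale (t : R) (f : R -> \bar R) : 0 < t ->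
  measurable_fun setT (f : mR -> \bar R) -> (forall x, 0 <= f x)%E ->
  (\int[mu]_x f (t * x)%R = (t^-1)%:E * \int[mu]_x f x)%E.
Proof.
move=> t0 mf f0.
have mphi : measurable_fun setT (fun x : mR => (t * x : mR)).
  by apply: continuous_measurable_fun => x; apply: (@mulrl_continuous R).
have ti0 : 0 <= t by exact: ltW.
have E := @ge0_integral_pushforward _ _ mR mR R _ mphi mu setT f measurableT mf (fun x _ => f0 x).
rewrite preimage_setT in E.
transitivity ((t^-1)%:E * (t%:E * \int[mu]_x f (t * x)%R))%E.
  by rewrite muleA -EFinM mulVf ?mul1e// gt_eqF.
congr (_ * _)%E.
(* The pushforward of Lebesgue measure under dilation by [t], rescaled by [t], agrees with Lebesgue
   measure on half-open intervals, hence everywhere. *)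
pose nu0 := mscale (NngNum ti0) (pushforward mu (fun x : mR => (t * x : mR))).
pose nu := nu0 mphi.
rewrite -[X in (_ * X)%E]E.
transitivity (\int[nu]_x f x)%E.
  by rewrite /nu /nu0 ge0_integral_mscale.
apply: eq_measure_integral => A mA _; apply/esym.
apply: lebesgue_measure_unique => // _ [[a b]] _ <-.
change (mu `]a, b]%classic = t%:E * mu ((fun x : R => (t * x)%R) @^-1` `]a, b]%classic))%E.
rewrite (_ : _ @^-1` _ = `]a / t, b / t]%classic); last first.
  apply/seteqP; split => x /=; rewrite !in_itv/= ltr_pdivrMr// ler_pdivlMr//;
    by rewrite (mulrC t).
rewrite !lebesgue_measure_itv/= !lte_fin ltr_pM2r ?invr_gt0//.
case: ifP => _; rewrite ?mule0// -?EFinD -?EFinM; congr EFin.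
by field; rewrite gt_eqF.
Qed.

Lemma iint_scale n (t : R) (f : seq R -> \bar R) : 0 < t -> (forall s, 0 <= f s)%E ->
  measurable_seq n f ->
  iint n (fun s => f [seq t * x | x <- s]) = ((t^-1 ^+ n)%:E * iint n f)%E.
Proof.
move=> t0; elim: n f => [|n IH] f f0 mf /=; first by rewrite expr0 mul1e.
have tn0 : 0 <= t^-1 ^+ n by rewrite exprn_ge0// invr_ge0 ltW.
under eq_integral => x _.
  rewrite (IH (fun s => f (t * x :: s)))//; first over.
  exact: measurable_seq_cons.
rewrite ge0_integralZl//; last 2 first.
- apply: (measurableT_comp (measurable_iint_head f0 mf)).
  by apply: continuous_measurable_fun => x; apply: (@mulrl_continuous R).
- by move=> x _; apply: iint_ge0.
rewrite (@ge0_integral_scale t (fun x => iint n (fun s => f (x :: s))))//.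
- by rewrite muleA -EFinM -exprSr.
- exact: measurable_iint_head.
- by move=> x; apply: iint_ge0.
Qed.

Lemma iint0 n : iint n (fun=> 0%E : \bar R) = 0%E.
Proof. by elim: n => [//|n IH] /=; rewrite integral0_eq. Qed.

Lemma iint_cube n (C : R) : 0 <= C ->
  (iint n (fun s => (C * (all (fun x : R => `|x| <= 1) s)%:R)%:E) <= (C * 2 ^+ n)%:E)%E.
Proof.
move=> C0; elim: n => [//|n IH] /=.
apply: (@le_trans _ _ (\int[mu]_x ((C * 2 ^+ n)%:E * (\1_`[-1, 1] x)%:E))%E).
  apply: le_integral_ge0 => x.
    by apply: iint_ge0 => s; rewrite lee_fin mulr_ge0.
  rewrite indicE mem_setE/= in_itv/= -ler_norml.
  by case: (`|x| <= 1); rewrite /= ?mulr1 ?mulr0 ?mule1 ?mule0 ?iint0.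
rewrite ge0_integralZl//; last 2 first.
- by apply/measurable_EFinP; exact: measurable_indic.
- by rewrite lee_fin mulr_ge0// exprn_ge0.
have E : mu (`[(-1), 1]%classic) = 2%:E.
  by rewrite lebesgue_measure_itv/= lte_fin ifT; [rewrite -EFinB; congr EFin; lra|lra].
rewrite integral_indic// setIT [X in (_ * X)%E]E.
by rewrite -EFinM lee_fin exprSr mulrA.
Qed.
End IteratedIntegral.

(** * Cancellation of the spherical factor *)

Section RadialMass.
Variable R : realType.
Notation mu := (@lebesgue_measure R).
Notation mR := (measurableTypeR R).
Variables (d l : nat) (P : 'rV[R]_d -> R) (p : R).
Hypothesis (p0 : 0 < p) (hP : homog_poly_fun l P).

Let dir (x : 'rV[R]_d) := (eucl x)^-1 *: x.
(** Half-open, so that annuli sharing a radius add up exactly. *)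
Definition annulus (r1 r2 : R) : set 'rV[R]_d := [set x | r1 < eucl x <= r2].
(** The angular factor is invariant under dilations; scaling and additivity of [mass] therefore
    stand in for integration in polar coordinates. *)
Definition density (r1 r2 : R) (x : 'rV[R]_d) : \bar R :=
  (\1_(annulus r1 r2) x * `|P (dir x)| `^ p)%:E.
Definition mass (r1 r2 : R) := intRd (density r1 r2).

Lemma density_ge0 r1 r2 x : (0 <= density r1 r2 x)%E.
Proof. by rewrite lee_fin mulr_ge0 ?powR_ge0. Qed.

Lemma eucl_scale (c : R) (x : 'rV[R]_d) : 0 <= c -> eucl (c *: x) = c * eucl x.
Proof.
move=> c0; rewrite /eucl.
under eq_bigr do rewrite mxE exprMn.
by rewrite -mulr_sumr sqrtrM ?sqr_ge0// sqrtr_sqr ger0_norm.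
Qed.

Lemma norm_coord_le_eucl (x : 'rV[R]_d) i : `|x ord0 i| <= eucl x.
Proof.
rewrite -sqrtr_sqr /eucl ler_sqrt; last by apply: sumr_ge0 => j _; exact: sqr_ge0.
by rewrite (bigD1 i)//= lerDl; apply: sumr_ge0 => j _; exact: sqr_ge0.
Qed.

Lemma vec_of_scale (c : R) (s : seq R) : vec_of d [seq c * x | x <- s] = c *: vec_of d s.
Proof.
apply/rowP => i; rewrite !mxE; have [ilt|ige] := ltnP i (size s).
  by rewrite (nth_map 0).
by rewrite !nth_default ?mulr0// size_map.
Qed.

Lemma measurable_density r1 r2 :
  measurable_seq d (fun s => density r1 r2 (vec_of d s)).
Proof.
move=> d' T' h gs mh sgs mgs.
pose X (i : 'I_d) (t : T') : R := nth (fun=> 0 : mR) gs i t.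
have mX i : measurable_fun setT (X i) by exact: mgs.
have vE t i : vec_of d [seq g t | g <- gs] ord0 i = X i t.
  by rewrite mxE (nth_map (fun=> 0 : mR)) ?sgs.
pose E t := Num.sqrt (\sum_(i < d) X i t ^+ 2).
have EE t : eucl (vec_of d [seq g t | g <- gs]) = E t.
  by rewrite /eucl /E; congr Num.sqrt; apply: eq_bigr => i _; rewrite vE.
have mE : measurable_fun setT E.
  apply: (measurableT_comp (f := @Num.sqrt R)).
    by apply: continuous_measurable_fun => x; exact: sqrt_continuous.
  by apply: measurable_sum => i; exact: measurable_funX.
have mEV : measurable_fun setT (fun t => (E t)^-1).
  rewrite (_ : (fun t => _) = (@powR R ^~ (-1)) \o E).
    exact: measurableT_comp (measurable_powR _) mE.
  by apply/funext => t /=; rewrite powR_inv1// sqrtr_ge0.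
case: hP => c cP.
pose Q t := \sum_(a : {ffun 'I_d -> 'I_l.+1} | (\sum_(i < d) (a i : nat) == l)%N)
   c a * \prod_(i < d) ((E t)^-1 * X i t) ^+ (a i).
have QE t : P (dir (vec_of d [seq g t | g <- gs])) = Q t.
  rewrite cP; apply: eq_bigr => a _; congr (_ * _); apply: eq_bigr => i _.
  by rewrite /dir mxE EE vE.
have mQ : measurable_fun setT Q.
  rewrite /Q; under eq_fun do rewrite big_mkcond/=.
  apply: measurable_sum => a; case: (_ == l)%N => //.
  apply: measurable_funM => //; apply: measurable_prod => i _.
  by apply: measurable_funX; apply: measurable_funM.
rewrite /density; apply/measurable_EFinP.
apply: measurable_funM; last first.
  under eq_fun do rewrite QE.
  apply: (measurableT_comp (measurable_powR p)).
  exact: (measurableT_comp (@normr_measurable R setT)).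
rewrite (_ : (fun t => _) = (\1_(`]r1, r2]%classic : set R) \o E)).
  by apply: measurableT_comp => //; exact: measurable_indic.
apply/funext => t /=; rewrite !indicE; congr (_ %:R); congr nat_of_bool.
by apply/idP/idP; rewrite !inE /annulus/= in_itv/= EE.
Qed.

Lemma mass_add r1 r2 : 0 <= r1 -> r1 <= r2 ->
  mass 0 r2 = (mass 0 r1 + mass r1 r2)%E.
Proof.
move=> r10 r12; rewrite /mass /intRd -iintD//; last 4 first.
- by move=> s; exact: density_ge0.
- by move=> s; exact: density_ge0.
- exact: measurable_density.
- exact: measurable_density.
congr iint; apply/funext => s; rewrite /density -EFinD -mulrDl.
congr ((_ * _)%:E); rewrite !indicE -natrD; congr (_ %:R).
set x := vec_of d s.
have -> : (x \in annulus 0 r2) = (0 < eucl x <= r2) by apply/idP/idP; rewrite inE.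
have -> : (x \in annulus 0 r1) = (0 < eucl x <= r1) by apply/idP/idP; rewrite inE.
have -> : (x \in annulus r1 r2) = (r1 < eucl x <= r2) by apply/idP/idP; rewrite inE.
have [h1|h1] := lerP (eucl x) r1.
  by rewrite (le_trans h1 r12) addn0.
by rewrite (le_lt_trans r10 h1).
Qed.

Lemma mass_scale r : 0 < r -> mass 0 r = ((r ^+ d)%:E * mass 0 1)%E.
Proof.
move=> r0; have ri0 : 0 < r^-1 by rewrite invr_gt0.
have := iint_scale ri0 (fun s => density_ge0 0 1 (vec_of d s)) (@measurable_density 0 1).
rewrite invrK -/(intRd _) -/(mass _ _) => <-.
rewrite /mass /intRd; congr iint; apply/funext => s; rewrite vec_of_scale.
set x := vec_of d s; rewrite /density.
have e : eucl (r^-1 *: x) = r^-1 * eucl x by rewrite eucl_scale// ltW.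
congr ((_ * _)%:E).
  rewrite !indicE; congr (_ %:R); congr nat_of_bool.
  apply/idP/idP; rewrite !inE /annulus/= e pmulr_rgt0// ler_pdivrMl// mulr1//.
congr (`|P _| `^ _).
rewrite /dir e invfM invrK scalerA; congr (_ *: _).
by rewrite mulrAC mulfV ?mul1r// gt_eqF.
Qed.

Lemma mass_fin_num : mass 0 1 \is a fin_num.
Proof.
rewrite ge0_fin_numE; last by apply: iint_ge0 => s; exact: density_ge0.
case: hP => c cP.
pose C := \sum_(a : {ffun 'I_d -> 'I_l.+1} | (\sum_(i < d) (a i : nat) == l)%N) `|c a|.
have C0 : 0 <= C by apply: sumr_ge0.
apply: (@le_lt_trans _ _ (iint d (fun s =>
    (C `^ p * (all (fun x : R => `|x| <= 1) s)%:R)%:E))%E); last first.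
  by apply: le_lt_trans (iint_cube _ (powR_ge0 _ _)) _; rewrite ltry.
  apply: le_iint => s; first exact: density_ge0.
  move=> sd; rewrite /density lee_fin mulrC.
  set x := vec_of d s; rewrite indicE.
  have [|xn] := boolP (x \in _); last by rewrite mulr0 mulr_ge0 ?powR_ge0.
  rewrite inE /annulus/= => /andP[x0 x1].
  have -> : all (fun y : R => `|y| <= 1) s.
    apply/(all_nthP 0) => i; rewrite sd => ilt.
    have := norm_coord_le_eucl x (Ordinal ilt); rewrite mxE/= => /le_trans; exact.
  rewrite !mulr1 ge0_ler_powR ?nnegrE//; first exact: ltW.
  rewrite cP (le_trans (ler_norm_sum _ _ _))// ler_sum// => a _.
  rewrite normrM ler_piMr// normr_prod.
  apply: prodr_ile1 => i _; rewrite normr_ge0 normrX exprn_ile1//.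
  rewrite /dir mxE normrM ger0_norm ?invr_ge0 ?sqrtr_ge0//.
  by rewrite ler_pdivrMl// mulr1 norm_coord_le_eucl.
Qed.

Lemma le_intRd (F G : 'rV[R]_d -> \bar R) : (forall x, 0 <= F x)%E ->
  (forall x, F x <= G x)%E -> (intRd F <= intRd G)%E.
Proof. by move=> F0 FG; apply: le_iint. Qed.

Lemma intRdZ_density (c r1 r2 : R) : 0 <= c ->
  intRd (fun x => c%:E * density r1 r2 x)%E = (c%:E * mass r1 r2)%E.
Proof.
move=> c0; apply: iintZ => //; first by move=> s; exact: density_ge0.
exact: measurable_density.
Qed.

Variables (Y : 'rV[R]_d -> R) (phi : R -> R) (A : set 'rV[R]_d) (Rr r1 r2 B b : R).
Hypothesis (YP : forall xi, eucl xi = 1 -> Y xi = P xi).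
Hypotheses (d0 : (0 < d)%N) (r11 : 1 <= r1) (r12 : r1 < r2) (r2R : r2 < Rr).
Hypotheses (b0 : 0 < b).
Hypothesis (AS : A `<=` shell (d := d) Rr).
Hypothesis (AB : forall x, A x -> `|phi (eucl x)| <= B).
Hypothesis (bphi : forall r, r1 < r <= r2 -> b <= `|phi r|).

Let u x := phi (eucl x) * Y (dir x).
Let K := B `^ p * Rr ^+ d / (b `^ p * (r2 - r1)).

Let Ydir x : 0 < eucl x -> Y (dir x) = P (dir x).
Proof.
move=> x0; apply: YP; rewrite /dir eucl_scale ?invr_ge0 ?sqrtr_ge0//.
by rewrite mulVf// gt_eqF.
Qed.

Let upper : (intRd (fun x => (\1_A x * `|u x| `^ p)%:E) <= (B `^ p)%:E * mass 0 Rr)%E.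
Proof.
rewrite -intRdZ_density ?powR_ge0//; apply: le_intRd => x.
  by rewrite lee_fin mulr_ge0 ?powR_ge0.
rewrite /density -EFinM lee_fin indicE.
have [|xA] := boolP (x \in A); last first.
  by rewrite mul0r !mulr_ge0 ?powR_ge0.
rewrite inE => xA; rewrite mul1r.
have /andP[x1 xR] := AS xA.
have x0 : 0 < eucl x by apply: lt_trans x1.
rewrite indicE mem_set ?mul1r; last by rewrite /annulus/= x0 ltW.
rewrite /u Ydir// normrM powRM//.
rewrite ler_wpM2r ?powR_ge0// ge0_ler_powR ?nnegrE ?AB//; first exact: ltW.
exact: le_trans (normr_ge0 _) (AB xA).
Qed.

Let lower : ((b `^ p)%:E * mass r1 r2 <=
  intRd (fun x => (\1_(shell (d := d) Rr) x * `|u x| `^ p)%:E))%E.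
Proof.
rewrite -intRdZ_density ?powR_ge0//; apply: le_intRd => x.
  by rewrite /density -EFinM lee_fin !mulr_ge0 ?powR_ge0.
rewrite /density -EFinM lee_fin indicE.
have [|xA] := boolP (x \in annulus _ _); last first.
  by rewrite mul0r mulr0 mulr_ge0 ?powR_ge0.
rewrite inE /annulus => /= xA; rewrite mul1r.
have /andP[x1 xR] := xA.
have x1' : 1 < eucl x by apply: le_lt_trans x1.
have x0 : 0 < eucl x by apply: lt_trans x1'.
rewrite indicE mem_set ?mul1r; last by rewrite /shell/= x1' (le_lt_trans xR).
rewrite /u Ydir// normrM powRM//.
rewrite ler_wpM2r ?powR_ge0// ge0_ler_powR ?nnegrE ?bphi//; exact: ltW.
Qed.

(** Numerator and denominator are both compared with multiples of [mass 0 1], the angular integral,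
    which cancels. The width [r2 - r1] appears because [r2 ^+ d - r1 ^+ d >= r2 - r1] when
    [1 <= r1]. *)
Lemma LpNorm_ratio_bound :
  0 <= LpNorm p A u / LpNorm p (shell (d := d) Rr) u <= K `^ p^-1.
Proof.
rewrite divr_ge0 ?powR_ge0//=.
have [m mE] : exists m, mass 0 1 = m%:E by exists (fine (mass 0 1)); rewrite fineK// mass_fin_num.
have m0 : 0 <= m by rewrite -lee_fin -mE; apply: iint_ge0 => s; exact: density_ge0.
have r10 : 0 < r1 by exact: lt_le_trans r11.
have r20 : 0 < r2 by exact: lt_trans r12.
have R0 : 0 < Rr by exact: lt_trans r2R.
have [m12 m12E] : exists m12, mass r1 r2 = m12%:E.
  exists (fine (mass r1 r2)); rewrite fineK// ge0_fin_numE; last first.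
    by apply: iint_ge0 => s; exact: density_ge0.
  have := mass_add (ltW r10) (ltW r12).
  rewrite (mass_scale r20) (mass_scale r10) mE -!EFinM.
  by case: (mass r1 r2) => [x _|//|//]; rewrite ltry.
have m12_ge : (r2 - r1) * m <= m12.
  have := mass_add (ltW r10) (ltW r12).
  rewrite (mass_scale r20) (mass_scale r10) mE m12E -!EFinM -EFinD => -[e].
  have -> : m12 = (r2 ^+ d - r1 ^+ d) * m by rewrite mulrBl e; ring.
  rewrite ler_wpM2r//.
  case: d d0 => [//|n _]; rewrite !exprS.
  have h1 : 1 <= r1 ^+ n by rewrite exprn_ege1.
  have h2 : r1 ^+ n <= r2 ^+ n by apply: lerXn2r; rewrite ?nnegrE ?(ltW r10) ?(ltW r20) ?(ltW r12).
  have := mulr_ge0 (ltW r20) (etrans (subr_ge0 _ _) h2).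
  have := mulr_ge0 (etrans (subr_ge0 _ _) (ltW r12)) (etrans (subr_ge0 _ _) h1).
  lra.
rewrite /LpNorm; move: lower upper.
set N := intRd (fun x => (\1_A x * `|u x| `^ p)%:E).
set D := intRd (fun x => (\1_(shell (d := d) Rr) x * `|u x| `^ p)%:E).
have N0 : (0 <= N)%E by apply: iint_ge0 => s; rewrite lee_fin mulr_ge0 ?powR_ge0.
have bp0 : 0 < b `^ p by exact: powR_gt0.
have K0 : 0 <= K.
  by apply: divr_ge0; apply: mulr_ge0; rewrite ?powR_ge0 ?exprn_ge0 ?subr_ge0 ?(ltW R0) ?(ltW r12).
rewrite m12E (mass_scale R0) mE -!EFinM.
case: D => [D||] /=.
- rewrite lee_fin => hD hN.
  have D0 : 0 <= D by apply: le_trans hD; rewrite !mulr_ge0 ?powR_ge0//;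
    apply: le_trans m12_ge; rewrite mulr_ge0// subr_ge0 ltW.
  have [n Nn] : exists n, N = n%:E.
    by exists (fine N); rewrite fineK// ge0_fin_numE// (le_lt_trans hN)// ltry.
  move: N0 hN; rewrite Nn /= !lee_fin => n0 hN.
  have nKD : n <= K * D.
    apply: (le_trans hN); apply: (@le_trans _ _ (K * (b `^ p * ((r2 - r1) * m)))).
      rewrite le_eqVlt; apply/orP; left; apply/eqP; rewrite /K; field.
      by apply/andP; split; rewrite gt_eqF// subr_gt0.
    by rewrite ler_wpM2l// (le_trans _ hD)// ler_wpM2l// ltW.
  (* A zero denominator gives the quotient [0] by convention. An infinite integral ends the same
     way, [fine] sending it to [0]. *)
  have [->|Dn0] := eqVneq D 0.
    by rewrite powR0 ?invr0 ?mulr0 ?powR_ge0// invr_eq0 gt_eqF.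
  have Dp : 0 < D by rewrite lt_neqAle eq_sym Dn0.
  rewrite ler_pdivrMr ?powR_gt0// -powRM//.
  have KD0 : 0 <= K * D by exact: mulr_ge0.
  by apply: ge0_ler_powR; rewrite ?nnegrE// invr_ge0 ltW.
- by move=> _ _; rewrite powR0 ?invr0 ?mulr0 ?powR_ge0// invr_eq0 gt_eqF.
- by [].
Qed.

End RadialMass.

(** * Phase of a pair of solutions, Sturm comparison and counting of zeros *)

Section PhaseFunction.
Variable R : realType.
Variables (Q J J1 Y Y1 : R -> R) (W t0 : R) (alpha : R -> R).
Hypothesis dJ : forall t : R, is_derive t (1:R) J (J1 t).
Hypothesis dJ1 : forall t : R, is_derive t (1:R) J1 (- (Q t * J t)).
Hypothesis dY : forall t : R, is_derive t (1:R) Y (Y1 t).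
Hypothesis dY1 : forall t : R, is_derive t (1:R) Y1 (- (Q t * Y t)).
Hypothesis W0 : 0 < W.
Hypothesis WE : forall t, J t * Y1 t - J1 t * Y t = W.
Hypothesis dalpha : forall t : R, t0 < t ->
  is_derive t (1:R) alpha (W / (J t ^+ 2 + Y t ^+ 2)).

Let N t := J t ^+ 2 + Y t ^+ 2.

Lemma modulus_gt0 t : 0 < N t.
Proof.
rewrite lt_neqAle eq_sym addr_ge0 ?sqr_ge0// andbT /N.
rewrite paddr_eq0 ?sqr_ge0// !sqrf_eq0; apply/negP => /andP[/eqP J0 /eqP Y0].
by move: W0; rewrite -(WE t) J0 Y0; lra.
Qed.

Lemma sqrt_modulus_gt0 t : 0 < Num.sqrt (N t).
Proof. by rewrite sqrtr_gt0 modulus_gt0. Qed.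

Let v t1 t := J t1 * Y t - Y t1 * J t.
Let v1 t1 t := J t1 * Y1 t - Y t1 * J1 t.

(** [alpha] is known only through its derivative [W / N]. That is the angular speed of the vector
    [(J, Y)], so no angle has to be lifted; [v t1] is the solution vanishing at [t1]. *)
Lemma polar t1 t : t0 < t1 -> t1 <= t ->
  v t1 t = Num.sqrt (N t1) * Num.sqrt (N t) * sin (alpha t - alpha t1) /\
  J t1 * J t + Y t1 * Y t = Num.sqrt (N t1) * Num.sqrt (N t) * cos (alpha t - alpha t1).
Proof.
move=> t01 t1t.
pose m x := Num.sqrt (N x).
have m0 x : 0 < m x by exact: sqrt_modulus_gt0.
have mm x : m x ^+ 2 = N x by rewrite sqr_sqrtr// ltW// modulus_gt0.
have dm x : is_derive x (1:R) m ((J x * J1 x + Y x * Y1 x) / m x).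
  eapply is_derive_eq.
    eapply (sqrt_derive (f := N)); first exact: modulus_gt0.
    by rewrite /N; dv_step.
  by rewrite -/(m x); field; rewrite gt_eqF.
pose c x := (J t1 * J x + Y t1 * Y x) / m x.
pose s x := v t1 x / m x.
have da x : t1 <= x <= t -> is_derive x (1:R) alpha (W / m x ^+ 2).
  by move=> /andP[t1x _]; rewrite mm; apply: dalpha; exact: lt_le_trans t1x.
have dc x : is_derive x (1:R) c (- (W / m x ^+ 2) * s x).
  rewrite /c; dv; first by rewrite gt_eqF.
  transitivity (((J t1 * J1 x + Y t1 * Y1 x) * m x ^+ 2
     - (J t1 * J x + Y t1 * Y x) * (J x * J1 x + Y x * Y1 x)) / m x ^+ 3).
    by field; rewrite gt_eqF.
  rewrite [X in X / _](_ : _ = - W * v t1 x); last by rewrite mm /N /v -(WE x); ring.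
  by rewrite /s; field; rewrite gt_eqF.
have ds x : is_derive x (1:R) s (W / m x ^+ 2 * c x).
  rewrite /s /v; dv; first by rewrite gt_eqF.
  transitivity (((J t1 * Y1 x - Y t1 * J1 x) * m x ^+ 2
     - (J t1 * Y x - Y t1 * J x) * (J x * J1 x + Y x * Y1 x)) / m x ^+ 3).
    by field; rewrite gt_eqF.
  rewrite [X in X / _](_ : _ = W * (J t1 * J x + Y t1 * Y x)); last by rewrite mm /N -(WE x); ring.
  by rewrite /c; field; rewrite gt_eqF.
(* [(c, s)] rotates with speed [alpha']; undoing the rotation leaves the constants [E1] and [E2]. *)
pose E1 x := c x * cos (alpha x - alpha t1) + s x * sin (alpha x - alpha t1).
pose E2 x := s x * cos (alpha x - alpha t1) - c x * sin (alpha x - alpha t1).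
have e1 : E1 t1 = E1 t.
  apply: (derive_eq0_cst (f := E1) t1t) => x /da ax.
  by rewrite /E1; dv; ring.
have e2 : E2 t1 = E2 t.
  apply: (derive_eq0_cst (f := E2) t1t) => x /da ax.
  by rewrite /E2; dv; ring.
have E1t1 : E1 t1 = m t1.
  rewrite /E1 subrr cos0 sin0 /c mulr1 mulr0 addr0.
  by rewrite -!expr2 -/(N t1) -mm; field; rewrite gt_eqF.
have E2t1 : E2 t1 = 0.
  by rewrite /E2 subrr cos0 sin0 /s /v; ring.
have cs := cos2Dsin2 (alpha t - alpha t1).
have sE : s t = m t1 * sin (alpha t - alpha t1).
  transitivity (E1 t * sin (alpha t - alpha t1) + E2 t * cos (alpha t - alpha t1)).
    by rewrite -[LHS]mulr1 -cs /E1 /E2; ring.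
  by rewrite -e1 -e2 E1t1 E2t1; ring.
have cE : c t = m t1 * cos (alpha t - alpha t1).
  transitivity (E1 t * cos (alpha t - alpha t1) - E2 t * sin (alpha t - alpha t1)).
    by rewrite -[LHS]mulr1 -cs /E1 /E2; ring.
  by rewrite -e1 -e2 E1t1 E2t1; ring.
split.
  by rewrite mulrAC -/(m t1) -sE /s -/(m t) divfK// gt_eqF.
by rewrite mulrAC -/(m t1) -cE /c -/(m t) divfK// gt_eqF.
Qed.

Lemma alpha_incr t1 t2 : t0 < t1 -> t1 < t2 -> alpha t1 < alpha t2.
Proof.
move=> t01 t12; apply: (derive_gt0_lt t12) => [x /andP[t1x _]|x _].
  by apply: dalpha; exact: lt_le_trans t1x.
by rewrite divr_gt0// modulus_gt0.
Qed.

Lemma alpha_ndecr t1 t2 : t0 < t1 -> t1 <= t2 -> alpha t1 <= alpha t2.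
Proof.
by move=> t01; rewrite le_eqVlt => /orP[/eqP->//|/(alpha_incr t01)/ltW].
Qed.

Lemma alpha_ivt t1 t2 y : t0 < t1 -> t1 <= t2 -> alpha t1 <= y <= alpha t2 ->
  exists2 t, t1 <= t <= t2 & alpha t = y.
Proof.
move=> t01 t12; apply: ivt => // x /andP[t1x _].
by apply: dv_continuous; apply: dalpha; exact: lt_le_trans t1x.
Qed.

Lemma dv_solution t1 (t : R) : is_derive t (1:R) (v t1) (v1 t1 t).
Proof. by rewrite /v /v1; dv; ring. Qed.

Lemma dv1_solution t1 (t : R) : is_derive t (1:R) (v1 t1) (- (Q t * v t1 t)).
Proof. by rewrite /v /v1; dv; ring. Qed.

Lemma solution_ge0 t1 t : t0 < t1 -> t1 <= t -> alpha t - alpha t1 <= pi -> 0 <= v t1 t.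
Proof.
move=> t01 t1t h; have [-> _] := polar t01 t1t.
apply: mulr_ge0; first by rewrite mulr_ge0 ?sqrtr_ge0.
by apply: sin_ge0_pi; rewrite h subr_ge0 alpha_ndecr.
Qed.

Lemma solution_gt0 t1 t : t0 < t1 -> t1 < t -> alpha t - alpha t1 < pi -> 0 < v t1 t.
Proof.
move=> t01 t1t h; have [-> _] := polar t01 (ltW t1t).
apply: mulr_gt0; first by rewrite mulr_gt0 ?sqrt_modulus_gt0.
by apply: sin_gt0_pi; rewrite h subr_gt0 alpha_incr.
Qed.

Lemma solution_derive_modulus t1 t :
  v1 t1 t * N t = W * (J t1 * J t + Y t1 * Y t) + v t1 t * (J t * J1 t + Y t * Y1 t).
Proof. by rewrite /v /v1 /N -(WE t); ring. Qed.

(** This is the Wronskian of [v t1] and the comparison solution [sin (m (x - t1))]. While both are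
    nonnegative, its monotonicity is decided by the sign of [m ^+ 2 - Q]. *)
Let sturm_derive (m t1 t : R) : is_derive t (1:R)
  (fun x => v1 t1 x * sin (m * (x - t1)) - v t1 x * (m * cos (m * (x - t1))))
  ((m ^+ 2 - Q t) * (v t1 t * sin (m * (t - t1)))).
Proof.
have := dv_solution t1; have := dv1_solution t1 => h1 h2.
by dv; ring.
Qed.

(** Had the phase advanced by [pi] at some [t3], [v t1] would return to zero there with negative
    slope while the sine is still positive, making the increasing Wronskian negative. *)
Lemma sturm_upper (m t1 t2 : R) : t0 < t1 -> t1 <= t2 -> 0 < m ->
  (forall t, t1 <= t <= t2 -> Q t <= m ^+ 2) -> m * (t2 - t1) < pi ->
  alpha t2 - alpha t1 < pi.
Proof.
move=> t01 t12 m0 Qm mpi; rewrite ltNge; apply/negP => api.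
have [|t3 /andP[t13 t32] at3] := @alpha_ivt t1 t2 (alpha t1 + pi) t01 t12.
  by apply/andP; split; [have := pi_ge0 R; lra|lra].
have t13' : t1 < t3.
  rewrite lt_neqAle t13 andbT; apply/eqP => e; move: at3; rewrite e.
  by have := pi_gt0 R; lra.
have da3 : alpha t3 - alpha t1 = pi by rewrite at3; ring.
have [] := polar t01 t13; rewrite da3 sinpi cospi mulr0 => v3 c3.
have v13 : v1 t1 t3 < 0.
  rewrite -(pmulr_llt0 _ (modulus_gt0 t3)) solution_derive_modulus v3 c3 mul0r addr0.
  rewrite mulrN1 mulrN oppr_lt0.
  by rewrite mulr_gt0// mulr_gt0 ?sqrt_modulus_gt0.
pose G x := v1 t1 x * sin (m * (x - t1)) - v t1 x * (m * cos (m * (x - t1))).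
have : G t1 <= G t3.
  apply: (derive_ge0_le t13 (fun x _ => sturm_derive m t1 x)) => x /andP[t1x xt3].
  have xt1 : t1 <= x by exact: ltW.
  rewrite mulr_ge0 ?subr_ge0 ?Qm ?mulr_ge0//.
  - by rewrite xt1 (le_trans (ltW xt3)).
  - by apply: solution_ge0 => //; rewrite -da3 lerB// alpha_ndecr ?(lt_trans t01)// ltW.
  - apply: sin_ge0_pi; rewrite mulr_ge0 ?subr_ge0 ?(ltW m0)//=.
    apply: le_trans (ltW mpi); rewrite ler_pM2l//; lra.
rewrite /G v3 mul0r subr0 subrr mulr0 sin0 cos0 mulr0 mulr1.
have -> : v t1 t1 = 0 by rewrite /v; ring.
rewrite mul0r subr0; apply/negP; rewrite -ltNge nmulr_rlt0//.
apply: sin_gt0_pi; rewrite mulr_gt0 ?subr_gt0//=.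
apply: le_lt_trans mpi; rewrite ler_pM2l//; lra.
Qed.

(** Otherwise [v t1] is still positive at [t1 + pi / m], where the sine vanishes with slope [- m];
    the decreasing Wronskian would then be positive. *)
Lemma sturm_lower (m t1 t2 : R) : t0 < t1 -> t1 <= t2 -> 0 < m ->
  (forall t, t1 <= t <= t2 -> m ^+ 2 <= Q t) -> pi <= m * (t2 - t1) ->
  pi <= alpha t2 - alpha t1.
Proof.
move=> t01 t12 m0 Qm mpi; rewrite leNgt; apply/negP => api.
pose t3 := t1 + pi / m.
have pm : 0 < pi / m by rewrite divr_gt0// pi_gt0.
have t13 : t1 < t3 by rewrite /t3; lra.
have t32 : t3 <= t2.
  by rewrite /t3 -lerBrDl ler_pdivrMr// mulrC.
have a3 : alpha t3 - alpha t1 < pi.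
  by apply: le_lt_trans api; rewrite lerB// alpha_ndecr// (lt_trans t01).
pose G x := v1 t1 x * sin (m * (x - t1)) - v t1 x * (m * cos (m * (x - t1))).
have : G t3 <= G t1.
  apply: (derive_le0_le (ltW t13) (fun x _ => sturm_derive m t1 x)) => x /andP[t1x xt3].
  have xt1 : t1 <= x by exact: ltW.
  rewrite mulr_le0_ge0 ?subr_le0 ?Qm ?mulr_ge0//.
  - by rewrite xt1 (le_trans (ltW xt3)).
  - apply: solution_ge0 => //; apply: le_trans (ltW a3).
    by rewrite lerB// alpha_ndecr ?(lt_trans t01)// ltW.
  - apply: sin_ge0_pi; rewrite mulr_ge0 ?subr_ge0 ?(ltW m0)//=.
    by rewrite mulrC -ler_pdivlMr//; rewrite /t3 in xt3; lra.
have e3 : m * (t3 - t1) = pi by rewrite /t3; field; rewrite gt_eqF.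
rewrite /G e3 sinpi cospi subrr !mulr0 sin0 cos0 !mulr0 mulr1.
have -> : v t1 t1 = 0 by rewrite /v; ring.
have := solution_gt0 t01 t13 a3 => v3.
have := mulr_gt0 v3 m0; lra.
Qed.

Lemma nonoscillatory (t1 t2 : R) : t0 < t1 -> t1 <= t2 ->
  (forall t, t1 <= t <= t2 -> Q t <= 0) -> alpha t2 - alpha t1 < pi.
Proof.
move=> t01 t12 Q0; have p0 := pi_gt0 R.
have d0 : 0 < t2 - t1 + 1 by lra.
apply: (@sturm_upper (pi / (t2 - t1 + 1))) => //.
- exact: divr_gt0.
- by move=> t /Q0 /le_trans; apply; exact: sqr_ge0.
- by rewrite mulrAC ltr_pdivrMr// ltr_pM2l//; lra.
Qed.

Lemma sturm_upper_steps n (m t1 t2 : R) : t0 < t1 -> t1 <= t2 -> 0 < m ->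
  (forall t, t1 <= t <= t2 -> Q t <= m ^+ 2) -> m * (t2 - t1) < n.+1%:R * pi ->
  alpha t2 - alpha t1 < n.+1%:R * pi.
Proof.
move=> t01 + m0; elim: n t2 => [|n IH] t2 t12 Qm h.
  by rewrite mul1r; apply: (@sturm_upper m) => //; rewrite mul1r in h.
pose x := (t2 - t1) / n.+2%:R.
have n0 : 0 < n.+2%:R :> R by rewrite ltr0n.
have x0 : 0 <= x by rewrite divr_ge0 ?subr_ge0// ltW.
have mx : m * x < pi by rewrite mulrA ltr_pdivrMr// [X in _ < X]mulrC.
have t2E : t2 - x = t1 + n.+1%:R * x.
  have : n.+1%:R * x + x = t2 - t1.
    by rewrite -[X in _ + X]mul1r -mulrDl natr1 /x mulrC divfK// gt_eqF.
  lra.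
have t1x : t1 <= t2 - x by rewrite t2E lerDl mulr_ge0.
have a1 : alpha (t2 - x) - alpha t1 < n.+1%:R * pi.
  apply: IH => // [t /andP[t1t tx]|].
    by apply: Qm; rewrite t1t (le_trans tx)// lerBlDr lerDl.
  by rewrite t2E addrAC subrr add0r mulrCA ltr_pM2l ?ltr0n.
have a2 : alpha t2 - alpha (t2 - x) < pi.
  apply: (@sturm_upper m) => //.
  - exact: lt_le_trans t1x.
  - by rewrite lerBlDr lerDl.
  - by move=> t /andP[xt tt2]; apply: Qm; rewrite tt2 (le_trans t1x).
  - by rewrite opprB addrC subrK.
by rewrite -natr1 mulrDl mul1r; lra.
Qed.

Lemma sturm_lower_steps n (m t1 t2 : R) : t0 < t1 -> t1 <= t2 -> 0 < m ->
  (forall t, t1 <= t <= t2 -> m ^+ 2 <= Q t) -> n%:R * pi <= m * (t2 - t1) ->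
  n%:R * pi <= alpha t2 - alpha t1.
Proof.
move=> t01 + m0; elim: n t2 => [|n IH] t2 t12 Qm h.
  by rewrite mul0r subr_ge0 alpha_ndecr.
have pm : 0 < pi / m by rewrite divr_gt0// pi_gt0.
have mp : m * (pi / m) = pi by field; rewrite gt_eqF.
rewrite -natr1 mulrDl mul1r in h *.
have t1x : t1 <= t2 - pi / m.
  rewrite -subr_ge0 -(pmulr_rge0 _ m0).
  have -> : m * (t2 - pi / m - t1) = m * (t2 - t1) - pi by field; rewrite gt_eqF.
  by have := mulr_ge0 (ler0n R n) (pi_ge0 R); lra.
have a1 : n%:R * pi <= alpha (t2 - pi / m) - alpha t1.
  apply: IH => // [t /andP[t1t tx]|].
    by apply: Qm; rewrite t1t (le_trans tx)// lerBlDr lerDl ltW.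
  have -> : m * (t2 - pi / m - t1) = m * (t2 - t1) - pi by field; rewrite gt_eqF.
  by lra.
have a2 : pi <= alpha t2 - alpha (t2 - pi / m).
  apply: (@sturm_lower m) => //.
  - exact: lt_le_trans t1x.
  - by rewrite lerBlDr lerDl ltW.
  - by move=> t /andP[xt tt2]; apply: Qm; rewrite tt2 (le_trans t1x).
  - by rewrite opprB addrC subrK mp.
by lra.
Qed.

Lemma phase_upper (m t1 t2 : R) : t0 < t1 -> t1 <= t2 -> 0 < m ->
  (forall t, t1 <= t <= t2 -> Q t <= m ^+ 2) ->
  alpha t2 - alpha t1 <= m * (t2 - t1) + pi.
Proof.
move=> t01 t12 m0 Qm; have p0 := pi_gt0 R.
pose x := m * (t2 - t1) / pi.
have x0 : 0 <= x by rewrite divr_ge0 ?mulr_ge0 ?subr_ge0// ltW.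
have xE : m * (t2 - t1) = x * pi by rewrite /x divfK// gt_eqF.
have /andP[h1 h2] := truncn_itv x0.
apply/ltW; apply: (@lt_le_trans _ _ ((Num.truncn x).+1%:R * pi)).
  by apply: (@sturm_upper_steps _ m) => //; rewrite xE ltr_pM2r.
by rewrite xE -natr1 mulrDl mul1r lerD2r ler_pM2r.
Qed.

Lemma phase_lower (m t1 t2 : R) : t0 < t1 -> t1 <= t2 -> 0 < m ->
  (forall t, t1 <= t <= t2 -> m ^+ 2 <= Q t) ->
  m * (t2 - t1) - pi <= alpha t2 - alpha t1.
Proof.
move=> t01 t12 m0 Qm; have p0 := pi_gt0 R.
pose x := m * (t2 - t1) / pi.
have x0 : 0 <= x by rewrite divr_ge0 ?mulr_ge0 ?subr_ge0// ltW.
have xE : m * (t2 - t1) = x * pi by rewrite /x divfK// gt_eqF.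
have /andP[h1 h2] := truncn_itv x0.
apply: (@le_trans _ _ ((Num.truncn x)%:R * pi)); last first.
  by apply: (@sturm_lower_steps _ m) => //; rewrite xE ler_pM2r.
rewrite xE lerBlDr -[X in _ + X]mul1r -mulrDl natr1 ler_pM2r//; exact: ltW.
Qed.

(* [q] stands for the positive part of the square root of [Q], and [Th] for a
   primitive of [q]; the error is that of a Riemann sum with [n] cells, plus
   one half-turn per cell. *)
Lemma phase_riemann_sum (q Th : R -> R) (A B : R) (n : nat) : t0 < A -> A <= B ->
  (forall t, A <= t <= B -> 0 <= q t) ->
  (forall s t, A <= s -> s <= t -> t <= B -> q s <= q t) ->
  (forall t, A <= t <= B -> Q t <= q t ^+ 2) ->
  (forall t, A <= t <= B -> 0 < q t -> Q t = q t ^+ 2) ->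
  (forall s t, A <= s -> s <= t -> t <= B ->
     q s * (t - s) <= Th t - Th s <= q t * (t - s)) ->
  `|(alpha B - alpha A) - (Th B - Th A)| <=
    q B * ((B - A) / n.+1%:R) + (B - A) + n.+1%:R * pi.
Proof.
move=> t0A AB q0 qmono Qq qQ Thq; have p0 := pi_gt0 R.
pose D := (B - A) / n.+1%:R.
have n0 : 0 < n.+1%:R :> R by rewrite ltr0n.
have D0 : 0 <= D by rewrite divr_ge0 ?subr_ge0// ltW.
have cell s : A <= s -> s + D <= B ->
    `|(alpha (s + D) - alpha s) - (Th (s + D) - Th s)| <=
      (q (s + D) - q s) * D + D + pi.
  move=> As sB; have sD : s <= s + D by rewrite lerDl.
  have t0s : t0 < s by exact: lt_le_trans As.
  have /andP[T1 T2] := Thq s (s + D) As sD sB.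
  have q12 := qmono s (s + D) As sD sB.
  have ADB : A <= s + D <= B by rewrite sB (le_trans As).
  have AsB : A <= s <= B by rewrite As (le_trans sD).
  have q2 := q0 _ ADB; have q1 := q0 _ AsB.
  have dE : s + D - s = D by ring.
  rewrite dE in T1 T2.
  (* Sturm comparison needs a positive frequency and [q] may vanish: adding [1] settles this and
     costs the term [B - A] in total. *)
  have U : alpha (s + D) - alpha s <= (q (s + D) + 1) * D + pi.
    rewrite -[X in _ * X + _]dE; apply: phase_upper => //; first by lra.
    move=> t /andP[st tsD].
    have AtB : A <= t <= B by rewrite (le_trans As)// (le_trans tsD).
    apply: (le_trans (Qq t AtB)).
    have := qmono t (s + D) (le_trans As st) tsD sB; have := q0 t AtB => qt0 qt.
    by rewrite ler_pXn2r ?nnegrE//; lra.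
  have L : q s * D - pi <= alpha (s + D) - alpha s.
    have [q1p|q1n] := ltrP 0 (q s); last first.
      have -> : q s = 0 by apply/eqP; rewrite eq_le q1n q1.
      have := alpha_ndecr t0s sD; lra.
    rewrite -[X in _ * X - _]dE; apply: phase_lower => // t /andP[st tsD].
    have AtB : A <= t <= B by rewrite (le_trans As)// (le_trans tsD).
    have qst := qmono s t As st (le_trans tsD sB).
    rewrite (qQ t AtB) ?(lt_le_trans q1p)// ler_pXn2r ?nnegrE//; lra.
  by rewrite ler_norml; apply/andP; split; lra.
(* The oscillations of [q] over the cells telescope because [q] is monotone, leaving at most [q B]
   times one cell width. *)
have H k : (k <= n.+1)%N ->
    `|(alpha (A + k%:R * D) - alpha A) - (Th (A + k%:R * D) - Th A)| <=
      (q (A + k%:R * D) - q A) * D + k%:R * D + k%:R * pi.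
  elim: k => [_|k IH kn].
    by rewrite !mul0r addr0 !subrr normr0; lra.
  have kD : 0 <= k%:R * D by rewrite mulr_ge0.
  have kB : A + k%:R * D + D <= B.
    have -> : A + k%:R * D + D = A + k.+1%:R * D by rewrite -natr1; ring.
    have : k.+1%:R * D <= n.+1%:R * D by rewrite ler_wpM2r// ler_nat.
    have -> : n.+1%:R * D = B - A by rewrite /D mulrC divfK// gt_eqF.
    lra.
  have := IH (ltnW kn); have := cell (A + k%:R * D) _ kB.
  rewrite lerDl kD => /(_ isT).
  have -> : A + k.+1%:R * D = A + k%:R * D + D by rewrite -natr1; ring.
  rewrite !ler_norml -natr1 => /andP[a1 a2] /andP[a3 a4].
  apply/andP; split; lra.
have := H n.+1 (leqnn _).
have -> : A + n.+1%:R * D = B by rewrite /D mulrC divfK ?gt_eqF//; ring.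
have -> : n.+1%:R * D = B - A by rewrite /D mulrC divfK// gt_eqF.
move=> /le_trans; apply; rewrite !lerD2r -/D.
have AAB : A <= A <= B by rewrite lexx.
by rewrite mulrBl gerBl mulr_ge0// q0.
Qed.

Lemma sin_natpi m : sin (m%:R * pi) = 0 :> R.
Proof.
have := alternatingn (@sinDpi R) m 0; rewrite add0r sin0 mulr0 => <-.
by rewrite mulr_natl.
Qed.

Lemma sin_eq0_pos (x : R) : 0 < x -> sin x = 0 -> exists j, x = j.+1%:R * pi.
Proof.
move=> x0 sx; have p0 := pi_gt0 R.
have xp : 0 <= x / pi by rewrite divr_ge0 ?ltW.
have /andP[] := truncn_itv xp; rewrite ler_pdivlMr// ltr_pdivrMr//.
set j := Num.truncn _ => h1 h2.
have sj : sin (x - j%:R * pi) = 0.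
  have := alternatingn (@sinDpi R) j (x - j%:R * pi).
  rewrite (_ : _ + pi *+ j = x); last by rewrite mulr_natl subrK.
  rewrite sx => /eqP; rewrite eq_sym mulf_eq0.
  by rewrite expf_eq0 oppr_eq0 oner_eq0 andbF => /eqP.
have xj : x = j%:R * pi.
  apply/eqP; rewrite -subr_eq0; apply/eqP.
  have [y0|y0|//] := ltgtP (x - j%:R * pi) 0; first by lra.
  have y1 : 0 < x - j%:R * pi < pi by rewrite y0/=; rewrite -natr1 in h2; lra.
  by have := sin_gt0_pi y1; rewrite sj ltxx.
case: j xj {h1 h2 sj} => [|j] xj; last by exists j.
by move: x0; rewrite xj mul0r ltxx.
Qed.

Variables (T : R) (Q1 : R -> R).
Hypothesis T0 : 0 < T.
Hypothesis dQ : forall t : R, is_derive t (1:R) Q (Q1 t).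
Hypothesis Q1_gt0 : forall t, 0 < Q1 t.

Let D t := alpha (t + T) - alpha t.

Let dD (t : R) : t0 < t -> is_derive t (1:R) D (W / N (t + T) - W / N t).
Proof.
move=> t0t; have h1 := dalpha t0t.
have h2 : is_derive (t + T) (1:R) alpha (W / N (t + T)).
  by apply: dalpha; rewrite (lt_trans t0t)// ltrDl.
rewrite /D; eapply is_derive_eq.
  eapply (dv_add (f := fun x => alpha (x + T)) (g := fun x => - alpha x)).
    eapply (dv_comp (f := alpha) (g := fun x => x + T)); first exact: h2.
    by dv_step.
  by eapply (dv_opp (f := alpha)); exact: h1.
by rewrite /N; ring.
Qed.

Let D_gt0 t : t0 < t -> 0 < D t.
Proof. by move=> t0t; rewrite subr_gt0 alpha_incr// ltrDl. Qed.

Let zero_sin t : t0 < t -> v t (t + T) = 0 <-> sin (D t) = 0.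
Proof.
move=> t0t; have [|-> _] := @polar t (t + T) t0t; first by rewrite lerDl ltW.
split=> [/eqP|->]; last by rewrite mulr0.
by rewrite !mulf_eq0 (gt_eqF (sqrt_modulus_gt0 t)) (gt_eqF (sqrt_modulus_gt0 (t + T))) => /eqP.
Qed.

(* At a zero the quantity [Q v^2 + v'^2], which increases along the solution,
   reduces to [v'^2], i.e. to [W^2 N t / N (t + T)] at the right end. *)
Lemma phase_shift_upcrossing t : t0 < t -> v t (t + T) = 0 ->
  0 < W / N (t + T) - W / N t.
Proof.
move=> t0t vT; have p0 := pi_gt0 R.
have DT : pi <= D t.
  have [j ->] := sin_eq0_pos (D_gt0 t0t) ((zero_sin t0t).1 vT).
  by rewrite ler_peMl ?ler1n// ltW.
(* Up to a quarter turn [v t] is strictly positive, which makes the increase of [F] strict; beyond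
   [c] a weak inequality suffices. *)
have [||c /andP[tc cT] ac] := @alpha_ivt t (t + T) (alpha t + pi / 2) t0t.
- by rewrite lerDl ltW.
- by rewrite /D in DT; apply/andP; split; lra.
have {}tc : t < c.
  by rewrite lt_neqAle tc andbT; apply/eqP => e; move: ac; rewrite e; lra.
pose F x := Q x * v t x ^+ 2 + v1 t x ^+ 2.
have dF x : is_derive x (1:R) F (Q1 x * v t x ^+ 2).
  have := dv_solution t; have := dv1_solution t => a1 a2.
  by rewrite /F; dv; ring.
have F1 : F t < F c.
  apply: (derive_gt0_lt tc (fun x _ => dF x)) => x /andP[tx xc].
  rewrite mulr_gt0// exprn_gt0// solution_gt0//.
  have := @alpha_ndecr x c (lt_trans t0t tx) (ltW xc); lra.
have F2 : F c <= F (t + T).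
  apply: (derive_ge0_le cT (fun x _ => dF x)) => x _.
  by rewrite mulr_ge0 ?sqr_ge0// ltW.
have FT : F (t + T) = v1 t (t + T) ^+ 2 by rewrite /F vT; ring.
have Ft : F t = W ^+ 2 by rewrite /F /v /v1 -(WE t); ring.
(* Where [v] vanishes, Lagrange's identity reduces the squared scalar product of the two vectors
   [(J, Y)] to the product of their moduli [N]. *)
have key : v1 t (t + T) ^+ 2 * N (t + T) = W ^+ 2 * N t.
  have := solution_derive_modulus t (t + T); rewrite vT mul0r addr0 => e.
  apply: (mulIf (lt0r_neq0 (modulus_gt0 (t + T)))).
  rewrite -[LHS](_ : (v1 t (t + T) * N (t + T)) ^+ 2 = _); last by ring.
  rewrite e.
  have : (J t * J (t + T) + Y t * Y (t + T)) ^+ 2 + v t (t + T) ^+ 2 = N t * N (t + T).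
    by rewrite /v /N; ring.
  by rewrite vT expr0n/= addr0 exprMn => ->; ring.
have NT0 := modulus_gt0 (t + T); have Nt0 := modulus_gt0 t.
have NN : N (t + T) < N t.
  have W2 : 0 < W ^+ 2 by rewrite exprn_gt0.
  rewrite -(ltr_pM2l W2) -key ltr_pM2r//.
  by rewrite -FT -Ft (lt_le_trans F1).
by rewrite subr_gt0 ltr_pM2l// ltf_pV2 ?posrE.
Qed.

(** Every visit to the level [m pi] is an up-crossing, so the level is visited at most once. *)
Let D_after t t' m : t0 < t -> t < t' -> D t = m%:R * pi -> m%:R * pi < D t'.
Proof.
move=> t0t tt' Dm; rewrite -subr_gt0.
have sm x : D x = m%:R * pi -> sin (D x) = 0.
  by move=> ->; exact: sin_natpi.
apply: (@upcrossing R (fun x => D x - m%:R * pi) (fun x => W / N (x + T) - W / N x) t t' tt').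
- move=> x /andP[tx _]; have dDx := dD (lt_le_trans t0t tx).
  eapply is_derive_eq; first by eapply (dv_add (f := D)); [exact: dDx|exact: dv_cst].
  by rewrite addr0.
- by rewrite Dm subrr.
- move=> x /andP[tx _] /eqP; rewrite subr_eq0 => /eqP /sm sx.
  have t0x := lt_le_trans t0t tx.
  by apply: phase_shift_upcrossing => //; apply/zero_sin.
Qed.

(** The shift [D] is below [pi] at [c] and meets each level [m pi] at most once, upwards. The zeros
    before [ta] thus correspond to the levels [1, ..., j], and [ta] itself to level [j + 1]. *)
Lemma phase_shift_count (c ta : R) (s : seq R) : t0 < c -> c < ta ->
  (forall t, c <= t <= c + T -> Q t <= 0) -> v ta (ta + T) = 0 ->
  uniq s -> (forall t, t \in s <-> (c < t < ta /\ v t (t + T) = 0)) ->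
  alpha (ta + T) - alpha ta = (size s).+1%:R * pi.
Proof.
move=> t0c cta Qc vta us sP; have p0 := pi_gt0 R.
have Dc : D c < pi by apply: nonoscillatory => //; rewrite lerDl ltW.
have t0ta := lt_trans t0c cta.
have [j Dta] := sin_eq0_pos (D_gt0 t0ta) ((zero_sin t0ta).1 vta).
rewrite -/(D ta) Dta; congr (_.+1%:R * _).
(* At a zero [D t / pi] is a natural number, so truncation reads it off exactly. *)
pose lev t := Num.truncn (D t / pi).
have levE t m : D t = m%:R * pi -> lev t = m.
  by move=> e; rewrite /lev e mulfK ?gt_eqF// natrK.
have levD t : c < t -> v t (t + T) = 0 -> exists2 m, (0 < m)%N & D t = m%:R * pi.
  move=> ct vt; have t0t := lt_trans t0c ct.
  by have [m e] := sin_eq0_pos (D_gt0 t0t) ((zero_sin t0t).1 vt); exists m.+1.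
have sm m x : D x = m%:R * pi -> sin (D x) = 0.
  by move=> ->; exact: sin_natpi.
rewrite -(size_map lev s) -(size_iota 1 j); apply: perm_size.
rewrite perm_sym; apply: uniq_perm.
- rewrite map_inj_in_uniq// => t t' /sP[/andP[ct _] vt] /sP[/andP[ct' _] vt'] ltt'.
  have [m _ Dm] := levD t ct vt; have [m' _ Dm'] := levD t' ct' vt'.
  have mm' : m = m' by rewrite -(levE t m)// ltt' (levE t' m').
  have [tt'|tt'|//] := ltgtP t t'.
  + by have := D_after (lt_trans t0c ct) tt' Dm; rewrite Dm' mm' ltxx.
  + by have := D_after (lt_trans t0c ct') tt' Dm'; rewrite Dm mm' ltxx.
- exact: iota_uniq.
move=> m; rewrite mem_iota add1n; apply/mapP/idP.
- move=> [t /sP[/andP[ct tta] vt] ->].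
  have [n n0 Dn] := levD t ct vt; rewrite (levE t n Dn) n0/=.
  have := D_after (lt_trans t0c ct) tta Dn.
  by rewrite Dta ltr_pM2r// ltr_nat.
- move=> /andP[m0 mj].
  have [||t /andP[ct tta] Dt] := @ivt R D c ta (m%:R * pi) (ltW cta).
  + move=> x /andP[cx _]; exact: dv_continuous (dD (lt_le_trans t0c cx)).
  + apply/andP; split; last by rewrite Dta ler_pM2r// ler_nat ltnW.
    by apply: (le_trans (ltW Dc)); rewrite ler_peMl ?ler1n// ltW.
  exists t; last by rewrite (levE t m).
  have ct' : c < t.
    rewrite lt_neqAle ct andbT; apply/eqP => e; move: Dc; rewrite e Dt.
    by apply/negP; rewrite -leNgt ler_peMl ?ler1n// ltW.
  have tta' : t < ta.
    rewrite lt_neqAle tta andbT; apply/eqP => e; move: Dt; rewrite e Dta.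
    move=> /(mulIf (lt0r_neq0 p0)) /eqP; rewrite eqr_nat => /eqP e2.
    by move: mj; rewrite e2 ltnn.
  apply/sP; rewrite ct' tta'; split => //; apply/zero_sin; last exact: sm Dt.
  exact: lt_trans ct'.
Qed.
End PhaseFunction.

(** * The phase integral: derivatives, bounds and monotonicity *)

Section PhaseIntegral.
Variable R : realType.
Implicit Types (w z y t : R).

(** The tangent of [acos (w / z)] for [0 < w < z]. It converts the arccosines of [gR_rhs] into
    arctangents and is [0] for [0 <= z <= w]. *)
Definition tangent_ratio w z : R := Num.sqrt ((z / w) ^+ 2 - 1).

(* [theta w z] is the integral over [[w, z]] of [sqrt (1 - (w / x)^2)] for
   [w <= z] and vanishes for [z <= w], since [Num.sqrt] is [0] on negatives. *)
Definition theta w z : R := w * (tangent_ratio w z - atan (tangent_ratio w z)).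

Definition phase_integral (Rr w y : R) : R := theta w (Rr * y) - theta w y.

Lemma tangent_ratio_ge0 w z : 0 <= tangent_ratio w z.
Proof. exact: sqrtr_ge0. Qed.

Lemma tangent_ratio0 w z : 0 < w -> 0 <= z <= w -> tangent_ratio w z = 0.
Proof.
move=> w0 /andP[z0 zw]; apply: ler0_sqrtr; rewrite subr_le0 expr_le1 ?divr_ge0 ?(ltW w0)//.
by rewrite ler_pdivrMr// mul1r.
Qed.

Lemma theta0 w z : 0 < w -> 0 <= z <= w -> theta w z = 0.
Proof. by move=> w0 zw; rewrite /theta tangent_ratio0// atan0 subrr mulr0. Qed.

Lemma ratio_gt1 w z : 0 < w -> w < z -> 0 < (z / w) ^+ 2 - 1.
Proof.
move=> w0 wz; rewrite subr_gt0 exprn_egt1// ltr_pdivlMr// mul1r//.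
Qed.

Lemma tangent_ratio_gt0 w z : 0 < w -> w < z -> 0 < tangent_ratio w z.
Proof. by move=> w0 wz; rewrite sqrtr_gt0 ratio_gt1. Qed.

Lemma tangent_ratioE w z : 0 < w -> w < z ->
  1 + tangent_ratio w z ^+ 2 = (z / w) ^+ 2.
Proof. by move=> w0 wz; rewrite sqr_sqrtr ?ltW ?ratio_gt1//; ring. Qed.

Lemma theta_scale c w z : 0 < c -> theta (c * w) (c * z) = c * theta w z.
Proof.
move=> c0; rewrite /theta /tangent_ratio.
have -> : c * z / (c * w) = z / w by rewrite -mulf_div divff ?mul1r// gt_eqF.
by rewrite mulrA.
Qed.

Lemma phase_integral_scale c Rr w y : 0 < c ->
  phase_integral Rr (c * w) (c * y) = c * phase_integral Rr w y.
Proof. by move=> c0; rewrite /phase_integral mulrCA !theta_scale// mulrBr. Qed.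

(** The partial derivatives are [- acos (w / z)] and [sqrt (1 - (w / z)^2)], the ingredients of the
    numerator and the denominator of [gR_rhs]. *)
Lemma dv_theta (w z : R -> R) t w' z' : 0 < w t -> w t < z t ->
  is_derive t (1:R) w w' -> is_derive t (1:R) z z' ->
  is_derive t (1:R) (fun x => theta (w x) (z x))
    (- w' * atan (tangent_ratio (w t) (z t)) + w t * tangent_ratio (w t) (z t) * z' / z t).
Proof.
move=> w0 wz dw dz.
have z0 : 0 < z t by exact: lt_trans wz.
have wn0 : w t != 0 by rewrite gt_eqF.
have zn0 : z t != 0 by rewrite gt_eqF.
pose u x := tangent_ratio (w x) (z x).
have u0 : 0 < u t by exact: tangent_ratio_gt0.
have un0 : u t != 0 by rewrite gt_eqF.
have u2 := tangent_ratioE w0 wz; rewrite -/(u t) in u2.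
pose r' := (z' * w t - z t * w') / w t ^+ 2.
have du : is_derive t (1:R) u (z t / w t * r' / u t).
  eapply is_derive_eq.
    eapply (sqrt_derive (f := fun x => (z x / w x) ^+ 2 - 1)); first exact: ratio_gt1.
    by dv_step.
  by rewrite -/(tangent_ratio _ _) -/(u t) /r'; field; apply/andP.
have da : is_derive t (1:R) (fun x => atan (u x)) ((1 + u t ^+ 2)^-1 * (z t / w t * r' / u t)).
  exact: (dv_comp (is_derive1_atan (u t)) du).
eapply is_derive_eq.
  rewrite /theta; eapply (dv_mul (f := w)); first exact: dw.
  eapply (dv_add (f := u)); first exact: du.
  by eapply (dv_opp (f := fun x => atan (u x))); exact: da.
rewrite /= -/(u t) u2.
have key : 1 - ((z t / w t) ^+ 2)^-1 = u t ^+ 2 / (z t / w t) ^+ 2.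
  have -> : u t ^+ 2 = (z t / w t) ^+ 2 - 1 by rewrite -u2; ring.
  by field; apply/andP.
transitivity (w' * (u t - atan (u t)) + w t * (z t / w t * r' / u t * (1 - ((z t / w t) ^+ 2)^-1))).
  by ring.
rewrite key /r'; field.
by rewrite un0 wn0 zn0.
Qed.

Lemma acos_tangent_ratio w z : 0 < w -> w < z -> acos (w / z) = atan (tangent_ratio w z).
Proof.
move=> w0 wz; have z0 : 0 < z by exact: lt_trans wz.
set u := tangent_ratio w z.
have -> : w / z = cos (atan u).
  rewrite cos_atan tangent_ratioE// sqrtr_sqr ger0_norm ?invf_div//.
  by rewrite divr_ge0 ?ltW.
rewrite cosK// in_itv/=; apply/andP; split.
  by rewrite -(@atan0 R) le_atan// tangent_ratio_ge0.
by have := atan_ltpi2 u; have := pi_ge0 R; lra.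
Qed.

Lemma sqrt_tangent_ratio w z : 0 < w -> w < z ->
  Num.sqrt (1 - (w / z) ^+ 2) = w * tangent_ratio w z / z.
Proof.
move=> w0 wz; have z0 : 0 < z by exact: lt_trans wz.
have -> : 1 - (w / z) ^+ 2 = (w / z) ^+ 2 * ((z / w) ^+ 2 - 1).
  by field; rewrite !gt_eqF.
rewrite sqrtrM ?sqr_ge0// sqrtr_sqr ger0_norm ?divr_ge0 ?ltW//.
by rewrite mulrAC.
Qed.

Lemma cvg_theta {T : Type} (F : set_system T) {FF : Filter F} (f g : T -> R) w z : w != 0 ->
  f @ F --> w -> g @ F --> z -> (fun x => theta (f x) (g x)) @ F --> theta w z.
Proof.
move=> w0 fw gz.
have ut : (fun x => tangent_ratio (f x) (g x)) @ F --> tangent_ratio w z.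
  apply: continuous_cvg; first exact: sqrt_continuous.
  apply: cvgB; last exact: cvg_cst.
  rewrite (_ : (fun x => _) = (fun x => (g x / f x) * (g x / f x))); last by apply/funext => x; rewrite expr2.
  by rewrite expr2; apply: cvgM; apply: cvgM => //; exact: cvgV.
apply: cvgM => //; apply: cvgB => //.
by apply: continuous_cvg => //; exact: continuous_atan.
Qed.

(** The loss [3 w] is one [w] from [z / w <= u + 1], with [u] the tangent, and two from
    [atan u <= 2]. *)
Lemma theta_bounds w z : 0 < w -> 0 < z -> z - 3 * w <= theta w z <= z.
Proof.
move=> w0 z0; have [zw|wz] := leP z w.
  rewrite theta0 ?(ltW z0) ?zw//; apply/andP; split; lra.
have u0 := tangent_ratio_ge0 w z; have u2 := tangent_ratioE w0 wz.
rewrite /theta; set u := tangent_ratio w z in u0 u2 *.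
have a0 : 0 <= atan u by rewrite -(@atan0 R) le_atan.
have a2 : atan u <= 2 by have := atan_ltpi2 u; have := pihalf_lt2 R; lra.
have r0 : 0 <= z / w by rewrite divr_ge0 ?ltW.
have ur : u <= z / w by rewrite -ler_sqr ?nnegrE// -u2; lra.
have ru : z / w <= u + 1 by rewrite -ler_sqr ?nnegrE ?addr_ge0// -u2; nra.
have zE : w * (z / w) = z by field; rewrite gt_eqF.
have h1 := ler_wpM2l (ltW w0) ur; have h2 := ler_wpM2l (ltW w0) ru.
have h3 := mulr_ge0 (ltW w0) a0; have h4 := ler_wpM2l (ltW w0) a2.
rewrite zE in h1 h2.
by apply/andP; split; lra.
Qed.

Lemma phase_integral_lower Rr w y : 1 < Rr -> 0 < w -> 0 < y ->
  (Rr - 1) * y - 3 * w <= phase_integral Rr w y.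
Proof.
move=> R1 w0 y0.
have Ry0 : 0 < Rr * y by rewrite mulr_gt0//; lra.
have /andP[h1 h2] := theta_bounds w0 Ry0; have /andP[h3 h4] := theta_bounds w0 y0.
rewrite /phase_integral; lra.
Qed.

Lemma phase_integral_approx Rr w y : 1 < Rr -> 0 < w -> 0 < y ->
  `|phase_integral Rr w y - (Rr - 1) * y| <= 3 * w.
Proof.
move=> R1 w0 y0.
have Ry0 : 0 < Rr * y by rewrite mulr_gt0//; lra.
have /andP[h1 h2] := theta_bounds w0 Ry0; have /andP[h3 h4] := theta_bounds w0 y0.
by rewrite /phase_integral ler_norml; apply/andP; split; lra.
Qed.

Lemma theta_lt w z1 z2 : 0 < w -> w <= z1 -> z1 < z2 -> theta w z1 < theta w z2.
Proof.
move=> w0 wz1 z12.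
pose f' z := - 0 * atan (tangent_ratio w z) + w * tangent_ratio w z * 1 / z.
have [x /andP[z1x xz2]||c /andP[z1c cz2] e] := @mvt_open R (theta w) f' z1 z2 z12.
- exact: (@dv_theta (fun=> w) id x 0 1 w0 (le_lt_trans wz1 z1x) (dv_cst w x) (dv_id x)).
- by move=> x _; apply: (@cvg_theta _ _ _ (fun=> w) id); [rewrite gt_eqF|exact: cvg_cst|exact: cvg_id].
have wc : w < c by exact: le_lt_trans z1c.
rewrite -subr_gt0 e; apply: mulr_gt0; last by rewrite subr_gt0.
rewrite /f' oppr0 mul0r add0r mulr1; apply: divr_gt0; last exact: lt_trans wc.
by apply: mulr_gt0 => //; exact: tangent_ratio_gt0.
Qed.

(** The positive part of [sqrt (expR t ^+ 2 - nu ^+ 2)], which is the slope of [theta nu] in the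
    logarithmic variable. *)
Definition log_slope nu t : R := nu * tangent_ratio nu (expR t).

Lemma log_slope_ge0 nu t : 0 < nu -> 0 <= log_slope nu t.
Proof. by move=> nu0; rewrite mulr_ge0 ?tangent_ratio_ge0 ?ltW. Qed.

Lemma log_slope_mono nu s t : 0 < nu -> s <= t -> log_slope nu s <= log_slope nu t.
Proof.
move=> nu0 st; rewrite ler_pM2l// ler_wsqrtr// lerB// lerXn2r ?nnegrE ?divr_ge0 ?expR_ge0 ?(ltW nu0)//.
by rewrite ler_pM2r ?invr_gt0// ler_expR.
Qed.

Lemma log_slope_sqr nu t : 0 < nu -> 0 < log_slope nu t ->
  expR t ^+ 2 - nu ^+ 2 = log_slope nu t ^+ 2.
Proof.
move=> nu0; rewrite pmulr_rgt0// sqrtr_gt0 => h.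
rewrite /log_slope exprMn sqr_sqrtr ?ltW//; field.
by rewrite gt_eqF.
Qed.

Lemma log_slope_sqr_ge nu t : 0 < nu -> expR t ^+ 2 - nu ^+ 2 <= log_slope nu t ^+ 2.
Proof.
move=> nu0; have := log_slope_ge0 t nu0; rewrite le_eqVlt => /orP[/eqP e|h]; last first.
  by rewrite log_slope_sqr.
rewrite -e expr0n/= subr_le0 lerXn2r ?nnegrE ?expR_ge0 ?(ltW nu0)//.
rewrite leNgt; apply/negP => h; move: e; apply/eqP; rewrite lt_eqF//.
by rewrite mulr_gt0// tangent_ratio_gt0.
Qed.

Lemma log_slope_le nu t : 0 < nu -> log_slope nu t <= expR t.
Proof.
move=> nu0; have := log_slope_ge0 t nu0; rewrite le_eqVlt => /orP[/eqP <-|h].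
  exact: expR_ge0.
rewrite -ler_sqr ?nnegrE ?expR_ge0 ?(ltW h)// -log_slope_sqr//.
by rewrite gerBl sqr_ge0.
Qed.

Lemma theta_log_chord nu s t : 0 < nu -> s <= t ->
  log_slope nu s * (t - s) <= theta nu (expR t) - theta nu (expR s) <= log_slope nu t * (t - s).
Proof.
move=> nu0.
have cT x : {for x, continuous (fun y => theta nu (expR y))}.
  apply: (@cvg_theta _ _ _ (fun=> nu) expR); [by rewrite gt_eqF|exact: cvg_cst|].
  exact: continuous_expR.
have above x y : nu <= expR x -> x <= y ->
    log_slope nu x * (y - x) <= theta nu (expR y) - theta nu (expR x) <= log_slope nu y * (y - x).
  move=> nx; rewrite le_eqVlt => /orP[/eqP<-|xy].
    by rewrite !subrr !mulr0 lexx.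
  have [z /andP[xz zy]||c /andP[xc cy] ->] := @mvt_open R (fun y => theta nu (expR y)) (log_slope nu) x y xy.
  - have nz : nu < expR z by rewrite (le_lt_trans nx)// ltr_expR.
    eapply is_derive_eq.
      exact: (@dv_theta (fun=> nu) expR z 0 _ nu0 nz (dv_cst nu z) (is_derive_expR z)).
    by rewrite oppr0 mul0r add0r /log_slope mulfK// gt_eqF// expR_gt0.
  - by move=> z _; exact: cT.
  - by rewrite !ler_pM2r ?subr_gt0// !log_slope_mono// ltW.
move=> st.
have below x : expR x <= nu -> theta nu (expR x) = 0 /\ log_slope nu x = 0.
  by move=> h; rewrite theta0 /log_slope ?tangent_ratio0 ?mulr0 ?expR_ge0 ?h.
have [tn|nt] := leP (expR t) nu.
  have sn : expR s <= nu by rewrite (le_trans _ tn)// ler_expR.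
  have [-> ->] := below t tn; have [-> ->] := below s sn.
  by rewrite !mul0r subrr lexx.
have [ns|sn] := leP nu (expR s); first exact: above.
(* The interval straddles the turning point [ln nu]; only its right part contributes. *)
have [-> ->] := below s (ltW sn).
have lnE : expR (ln nu) = nu by rewrite lnK// posrE.
have slt : s < ln nu by rewrite -ltr_expR lnE.
have tgt : ln nu < t by rewrite -ltr_expR lnE.
have := above (ln nu) t; rewrite lnE lexx => /(_ isT (ltW tgt)) /andP[h1 h2].
have [|e1 e2] := below (ln nu); first by rewrite lnE.
rewrite lnE in e1; rewrite e1 subr0 in h1 h2.
rewrite mul0r subr0 (le_trans _ h1) /=; last by rewrite e2 mul0r.
apply: (le_trans h2); apply: ler_wpM2l; first exact: log_slope_ge0.
by rewrite lerB// ltW.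
Qed.

(** In the logarithmic variable this is the integral of the nondecreasing [log_slope] over a window
    of fixed length [ln Rr]. Overlapping windows are compared on their differences, disjoint ones as
    a whole. *)
Lemma phase_integral_ndecr Rr w y1 y2 : 1 < Rr -> 0 < w -> 0 < y1 -> y1 <= y2 ->
  phase_integral Rr w y1 <= phase_integral Rr w y2.
Proof.
move=> R1 w0 y10 y12.
have R0 : 0 < Rr by lra.
have y20 : 0 < y2 by exact: lt_le_trans y12.
pose T := ln Rr.
have T0 : 0 <= T by rewrite ln_ge0// ltW.
have E y : 0 < y -> Rr * y = expR (ln y + T) /\ y = expR (ln y).
  by move=> y0; rewrite expRD !lnK ?posrE// mulrC.
have [E1 e1] := E _ y10; have [E2 e2] := E _ y20.
have t12 : ln y1 <= ln y2 by rewrite ler_ln ?posrE.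
rewrite /phase_integral E1 E2 {2}e1 {2}e2.
move: (ln y1) (ln y2) t12 => t1 t2 t12.
have c s t := @theta_log_chord w s t w0.
have s1 s t := @log_slope_mono w s t w0.
have s0 t := @log_slope_ge0 w t w0.
have [h|h] := leP t2 (t1 + T).
  have /andP[a1 _] := c (t1 + T) (t2 + T) (lerD t12 (lexx T)).
  have /andP[_ a2] := c t1 t2 t12.
  have := s1 _ _ h => h1.
  have d0 : 0 <= t2 - t1 by rewrite subr_ge0.
  have := ler_wpM2r d0 h1.
  move: a1; have -> : t2 + T - (t1 + T) = t2 - t1 by ring.
  lra.
have T2 t : t <= t + T by rewrite lerDl.
have dT t : t + T - t = T by ring.
have /andP[a1 _] := c _ _ (T2 t2).
have /andP[_ a2] := c _ _ (T2 t1).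
have h1 := ler_wpM2r T0 (s1 _ _ (ltW h)).
rewrite !dT in a1 a2; lra.
Qed.

End PhaseIntegral.

(** * The differential equation for [g] as conservation of the phase *)

Section ImplicitEquation.
Variable R : realType.
Variables (Rr : R) (g : R -> R) (s : R).
Hypotheses (R1 : 1 < Rr) (hg : is_gR Rr g) (s0 : 0 < s) (gs : g s = s).
Hypothesis (s_unique : forall s', 0 < s' -> g s' = s' -> s' = s).

Let g0 : g 0 = pi / (Rr - 1). Proof. by case: hg. Qed.
Let g0cvg : g x @[x --> 0^'+] --> g 0. Proof. by case: hg => _ []. Qed.
Let dg (w : R) : 0 < w -> is_derive w (1:R) g (gR_rhs Rr w (g w)).
Proof. by case: hg => _ [_]; apply. Qed.
Let gcont (w : R) : 0 < w -> {for w, continuous g}.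
Proof. by move=> w0; exact: dv_continuous (dg w0). Qed.
Let Rr0 : 0 < Rr. Proof. exact: lt_trans R1. Qed.

Let psi t := phase_integral Rr t (g t).

Let psi_cont t : 0 < t -> {for t, continuous psi}.
Proof.
move=> t0; have gc := gcont t0.
apply: cvgB; apply: cvg_theta; rewrite ?gt_eqF//; try exact: cvg_id.
by apply: cvgM; [exact: cvg_cst|exact: gc].
Qed.

(** The equation for [g] is the implicit differentiation of [psi = const]. The point [s], the only
    one with [g t = t], is left out because the derivative formula for [theta] requires [w < z]. *)
Let dpsi t : 0 < t -> t < Rr * g t -> t != s -> is_derive t (1:R) psi 0.
Proof.
move=> t0 tg ts.
have gt0 : 0 < g t by rewrite -(pmulr_rgt0 _ Rr0) (lt_trans t0).
have Rg0 : 0 < Rr * g t by exact: mulr_gt0.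
have dgt := dg t0.
set g' := gR_rhs Rr t (g t) in dgt.
have d1 : is_derive t (1:R) (fun x => theta x (Rr * g x))
    (- 1 * atan (tangent_ratio t (Rr * g t))
      + t * tangent_ratio t (Rr * g t) * (Rr * g') / (Rr * g t)).
  have dRg : is_derive t (1:R) (fun x => Rr * g x) (Rr * g') by dv; ring.
  exact: (@dv_theta R id (fun x => Rr * g x) t 1 _ t0 tg (dv_id t) dRg).
have A1 := acos_tangent_ratio t0 tg.
have S1 := sqrt_tangent_ratio t0 tg.
have u10 := tangent_ratio_gt0 t0 tg.
have Sp : 0 < t * tangent_ratio t (Rr * g t) / (Rr * g t) by rewrite divr_gt0 ?mulr_gt0.
have [gtt|tgt|e] := ltgtP (g t) t; last first.
- by move: ts; rewrite (s_unique t0 e) eqxx.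
- have d2 : is_derive t (1:R) (fun x => theta x (g x))
    (- 1 * atan (tangent_ratio t (g t)) + t * tangent_ratio t (g t) * g' / g t).
    exact: (@dv_theta R id g t 1 _ t0 tgt (dv_id t) dgt).
  have A2 := acos_tangent_ratio t0 tgt.
  have S2 := sqrt_tangent_ratio t0 tgt.
  have g'E : g' = (acos (t / (Rr * g t)) - acos (t / g t)) /
     (Rr * Num.sqrt (1 - (t / (Rr * g t)) ^+ 2) - Num.sqrt (1 - (t / g t) ^+ 2)).
    by rewrite /g' /gR_rhs (gtr0_norm t0) (gtr0_norm gt0) (ltW tgt) !mulr1.
  (* Moving [Rr] under the root gives [sqrt (Rr^2 - (t / g t)^2)], larger than
     [sqrt (1 - (t / g t)^2)]. *)
  have den : 0 < Rr * Num.sqrt (1 - (t / (Rr * g t)) ^+ 2) - Num.sqrt (1 - (t / g t) ^+ 2).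
    rewrite subr_gt0 -{1}(ger0_norm (ltW Rr0)) -sqrtr_sqr -sqrtrM ?sqr_ge0//.
    rewrite ltr_sqrt.
      rewrite mulrBr mulr1 -exprMn.
      have -> : Rr * (t / (Rr * g t)) = t / g t by field; rewrite !gt_eqF.
      by rewrite ltrD2r exprn_egt1.
    rewrite mulr_gt0 ?exprn_gt0// subr_gt0 expr_lt1// ?divr_ge0 ?(ltW t0) ?(ltW Rg0)//.
    by rewrite ltr_pdivrMr// mul1r.
  eapply is_derive_eq.
    eapply (dv_add (f := fun x => theta x (Rr * g x))); first exact: d1.
    by eapply (dv_opp (f := fun x => theta x (g x))); exact: d2.
  rewrite -A1 -A2.
  transitivity (g' * (Rr * (t * tangent_ratio t (Rr * g t) / (Rr * g t))
     - t * tangent_ratio t (g t) / g t) - (acos (t / (Rr * g t)) - acos (t / g t))).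
    by ring.
  by rewrite -S1 -S2 g'E divfK ?subrr// gt_eqF.
(* Where [g t < t], the inner term vanishes on a whole neighbourhood, in agreement with the
   indicator in [gR_rhs]. *)
- have d2 : is_derive t (1:R) (fun x => theta x (g x)) 0.
    apply: near_eq_is_derive (dv_cst 0 t).
    have [e1 e10 h1] := continuous_gt0_local (gcont t0) gt0.
    have [|e2 e20 h2] := @continuous_gt0_local R (fun x => x - g x) t _ (etrans (subr_gt0 _ _) gtt).
      by apply: cvgB; [exact: cvg_id|exact: gcont].
    apply/nbhs_ballP; exists (Num.min t (Num.min e1 e2)); first by rewrite /= !lt_min t0 e10.
    move=> x; rewrite /ball/= !lt_min => /and3P[xt /h1 gx0 /h2].
    rewrite subr_gt0 => gxx; rewrite theta0 ?(ltW gx0) ?(ltW gxx)//.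
    by move: xt; rewrite ltr_norml; lra.
  have g'E : g' = acos (t / (Rr * g t)) / (Rr * Num.sqrt (1 - (t / (Rr * g t)) ^+ 2)).
    by rewrite /g' /gR_rhs (gtr0_norm t0) (gtr0_norm gt0) leNgt gtt/= !mulr0 !subr0.
  eapply is_derive_eq.
    eapply (dv_add (f := fun x => theta x (Rr * g x))); first exact: d1.
    by eapply (dv_opp (f := fun x => theta x (g x))); exact: d2.
  rewrite -A1.
  transitivity (g' * (Rr * (t * tangent_ratio t (Rr * g t) / (Rr * g t)))
     - acos (t / (Rr * g t))).
    by ring.
  by rewrite -S1 g'E divfK ?subrr// gt_eqF// mulr_gt0// S1.
Qed.

(** At [s] continuity alone joins the two intervals of constancy. *)
Let psi_eq b x : (forall t, 0 < t -> t < b -> t < Rr * g t) -> 0 < x -> x < b -> psi x = psi b.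
Proof.
move=> hb x0 xb.
have piece y z : 0 < y -> y < z -> z <= b -> ~ (y < s < z) -> psi y = psi z.
  move=> y0 yz zb ns.
  have [c /andP[yc cz]||c _ /eqP] := @mvt_open R psi (fun=> 0) y z yz.
  - apply: dpsi; [exact: lt_trans yc|apply: hb; [exact: lt_trans yc|exact: lt_le_trans zb]|].
    by apply/eqP => e; apply: ns; rewrite -e yc.
  - by move=> c /andP[yc _]; apply: psi_cont; exact: lt_le_trans yc.
  by rewrite mul0r subr_eq0 => /eqP.
have [/andP[xs sb]|/negP ns] := boolP (x < s < b); last exact: piece.
rewrite (piece x s)//; last 2 first.
- exact: ltW.
- by rewrite ltxx andbF.
by apply: piece => //; rewrite ltxx.
Qed.

(** The constant is found at [0]: [psi x] differs from [(Rr - 1) g x] by at most [3 x], and the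
    initial value makes the limit [pi]. *)
Let psi_pi b : 0 < b -> (forall t, 0 < t -> t < b -> t < Rr * g t) -> psi b = pi.
Proof.
move=> b0 hb; pose C := psi b.
have near0 : \forall x \near 0^'+, `|psi b - (Rr - 1) * g x| <= 3 * x.
  near=> x.
  have x0 : 0 < x by near: x; exact: nbhs_right_gt.
  have xb : x < b by near: x; exact: nbhs_right_lt.
  rewrite -(psi_eq hb x0 xb); apply: phase_integral_approx => //.
  by rewrite -(pmulr_rgt0 _ Rr0) (lt_trans x0)// hb.
have c1 : (fun x => (Rr - 1) * g x) @ 0^'+ --> (Rr - 1) * g 0.
  by apply: cvgM => //; exact: cvg_cst.
have c2 : (fun x => (Rr - 1) * g x) @ 0^'+ --> psi b.
  apply/cvgrPdist_le => e e0; near=> x.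
  have h : `|psi b - (Rr - 1) * g x| <= 3 * x by near: x.
  have xe : x < e / 3 by near: x; apply: nbhs_right_lt; rewrite divr_gt0.
  lra.
have : psi b = (Rr - 1) * g 0 by exact: (cvg_unique _ c2 c1).
by rewrite g0 => ->; field; rewrite gt_eqF// subr_gt0.
Unshelve. all: end_near. Qed.

(** At the first [c] with [Rr * g c = c] both [theta] terms vanish, so [psi c = 0], whereas
    conservation on [(0, c)] and continuity give [psi c = pi]. *)
Let above_turning t : 0 < t -> t < Rr * g t.
Proof.
move=> t0; rewrite ltNge; apply/negP => ht.
pose m x := Rr * g x - x.
have mc x : 0 < x -> {for x, continuous m}.
  move=> x0; apply: cvgB; last exact: cvg_id.
  by apply: cvgM; [exact: cvg_cst|exact: gcont].
have [e e0 me] : exists2 e, 0 < e & forall x, 0 < x < e -> 0 < m x.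
  have c1 : (fun x => m x) @ 0^'+ --> Rr * g 0 - 0.
    apply: cvgB; first by apply: cvgM => //; exact: cvg_cst.
    by apply: cvg_at_right_filter; exact: cvg_id.
  have l0 : 0 < Rr * g 0 - 0.
    by rewrite subr0 g0 mulr_gt0// divr_gt0 ?pi_gt0// subr_gt0.
  have hm : \forall x \near 0^'+, 0 < m x by exact: (cvgr_gt _ c1 _ l0).
  have : nbhs (0:R) [set x | 0 < x -> 0 < m x] by move: hm; rewrite near_withinE.
  move=> /nbhs_ballP [e /= e0 he].
  exists e => // x /andP[x0 xe]; apply: he => //.
  by rewrite /ball/= sub0r normrN gtr0_norm.
pose S := [set x | 0 < x <= t /\ forall y, 0 < y -> y < x -> 0 < m y].
have Sx : S (Num.min t e).
  split; first by rewrite lt_min t0 e0 ge_min lexx.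
  by move=> y y0; rewrite lt_min => /andP[_ ye]; apply: me; rewrite y0.
have Ss : has_sup S by split; [exists (Num.min t e)|exists t => x [/andP[]]].
set c := sup S.
have c0 : 0 < c.
  by apply: lt_le_trans (ub_le_sup Ss.2 Sx); rewrite lt_min t0.
have ct : c <= t by apply: sup_le_ub => [|x [/andP[]]//]; exists (Num.min t e).
have mlt y : 0 < y -> y < c -> 0 < m y.
  move=> y0 yc; have [|x [_ fx] yx] := @sup_adherent R S (c - y) _ Ss.
    by rewrite subr_gt0.
  by apply: fx => //; move: yx; rewrite -/c; lra.
have pc : psi c = pi.
  by apply: psi_pi => // y y0 yc; have := mlt y y0 yc; rewrite subr_gt0.
have [mc0|mc0|mc0] := ltgtP (m c) 0.
- have [||d d0 hd] := @continuous_gt0_local R (fun y => - m y) c.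
    + by apply: cvgN; exact: mc.
    + by rewrite oppr_gt0.
  pose y := Num.max (c / 2) (c - d / 2).
  have y0 : 0 < y by rewrite lt_max divr_gt0.
  have yc : y < c by rewrite gt_max; apply/andP; split; lra.
  have := mlt y y0 yc; apply/negP; rewrite -leNgt -oppr_ge0 ltW//; apply: hd.
  have : c - d / 2 <= y by rewrite le_max lexx orbT.
  by rewrite ger0_norm; lra.
- have [d d0 hd] := continuous_gt0_local (mc c c0) mc0.
  have clt : c < t.
    rewrite lt_neqAle ct andbT; apply/eqP => e1; move: mc0; rewrite e1 /m subr_gt0.
    by rewrite ltNge ht.
  pose x := Num.min t (c + d / 2).
  have cx : c < x by rewrite lt_min clt/=; lra.
  have : S x.
    split; first by rewrite (lt_trans c0 cx) ge_min lexx.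
    move=> y y0 yx; have [yc|cy] := ltP y c; first exact: mlt.
    apply: hd; have : x <= c + d / 2 by rewrite ge_min lexx orbT.
    by rewrite ler0_norm; lra.
  by move=> /(ub_le_sup Ss.2); rewrite -/c leNgt cx.
- have Rg : Rr * g c = c by move/eqP: mc0; rewrite subr_eq0 => /eqP.
  have gc : g c = c / Rr by rewrite -{2}Rg mulrAC mulfV ?mul1r// gt_eqF.
  move: pc; rewrite /psi /phase_integral Rg gc !theta0 ?subrr//.
  + by move=> e1; have := pi_gt0 R; rewrite -e1 ltxx.
  + rewrite divr_ge0 ?(ltW c0) ?(ltW Rr0)//= ler_pdivrMr// ler_peMr ?(ltW c0)//.
    exact: ltW.
  + by rewrite (ltW c0) lexx.
Qed.

Lemma gR_phase_integral w : 0 < w -> w < Rr * g w /\ phase_integral Rr w (g w) = pi.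
Proof.
move=> w0; split; first exact: above_turning.
by apply: psi_pi => // t t0 _; exact: above_turning.
Qed.

(** By homogeneity the phase on the diagonal is linear, and it equals [pi] at [s]. If [w <= g w]
    with [w > s], monotonicity would push the phase at [g w] above [pi]. *)
Lemma gR_lt_id w : s < w -> g w < w.
Proof.
move=> sw; have w0 : 0 < w by exact: lt_trans sw.
rewrite ltNge; apply/negP => wg.
have [_ e] := gR_phase_integral w0.
have [_ e2] := gR_phase_integral s0; rewrite gs in e2.
have E x : 0 < x -> phase_integral Rr x x = x * phase_integral Rr 1 1.
  by move=> x0; rewrite -(phase_integral_scale Rr 1 1 x0) mulr1.
have p0 := pi_gt0 R.
have c0 : 0 < phase_integral Rr 1 1 by rewrite -(pmulr_rgt0 _ s0) -E// e2.
have := phase_integral_ndecr R1 w0 w0 wg.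
rewrite e E// -e2 (E s)// ler_pM2r//.
by rewrite leNgt sw.
Qed.
End ImplicitEquation.

(** * The adiabatic invariant to the right of the turning point *)

Section TurningPoint.
Variable R : realType.

(** From [expR (- 2 x) >= 1 - 6 h]; the condition [24 h <= 1] is what [(1 + 8 h) (1 - 6 h) >= 1]
    requires. It is the origin of [5 <= lam]. *)
Lemma expR_le_linear (x h : R) : 0 < h -> 24 * h <= 1 -> x <= 3 * h ->
  expR (2 * x) <= 1 + 8 * h.
Proof.
move=> h0 h1 xh.
have e1 := expR_ge1Dx (- (2 * x)).
have e2 : expR (2 * x) * expR (- (2 * x)) = 1 by exact: expRxMexpNx_1.
have e3 := expR_gt0 (2 * x).
have d0 : 0 < 1 - 6 * h by lra.
have e4 : 1 - 6 * h <= expR (- (2 * x)) by lra.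
rewrite -(ler_pM2r d0); apply: (@le_trans _ _ 1).
  by have := ler_wpM2l (ltW e3) e4; rewrite e2.
nra.
Qed.

Lemma expR_le4 (c : R) : c <= 3 / 4 -> expR c <= 4.
Proof.
move=> c1; have := expR_ge1Dx (- c) => e1.
have e2 : expR c * expR (- c) = 1 by exact: expRxMexpNx_1.
have e4 : 1 / 4 <= expR (- c) by lra.
have := ler_wpM2l (expR_ge0 c) e4; rewrite e2; lra.
Qed.

Variables (lam : R) (v v1 : R -> R).
Hypothesis lam5 : 5 <= lam.
Hypothesis dv_ : forall x : R, is_derive x (1:R) v (v1 x).
Hypothesis dv1 : forall x : R,
  is_derive x (1:R) v1 (- (lam ^+ 6 * (expR (2 * x) - 1) * v x)).

Let lam0 : 0 < lam. Proof. by apply: lt_le_trans lam5. Qed.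
Let lamn0 : lam != 0. Proof. by rewrite gt_eqF. Qed.
Let h : R := lam ^- 2.
Let h0 : 0 < h. Proof. by rewrite invr_gt0 exprn_gt0. Qed.
Let hE : h * lam ^+ 2 = 1. Proof. by rewrite /h mulVf// expf_neq0. Qed.
Let h24 : 24 * h <= 1.
Proof.
have l5 := lam5; have l : 24 <= lam ^+ 2 by nra.
by have := ler_wpM2l (ltW h0) l; rewrite hE mulrC.
Qed.

Let q x : R := expR (2 * x) - 1.
Let s x : R := Num.sqrt (q x).

Let q_gt0 (x : R) : 0 < x -> 0 < q x.
Proof. by move=> x0; rewrite subr_gt0 expR_gt1 mulr_gt0. Qed.
Let s_gt0 (x : R) : 0 < x -> 0 < s x.
Proof. by move=> x0; rewrite sqrtr_gt0 q_gt0. Qed.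
Let s_sqr (x : R) : 0 < x -> s x ^+ 2 = q x.
Proof. by move=> x0; rewrite sqr_sqrtr// ltW// q_gt0. Qed.
Let q_ge (x : R) : 2 * x <= q x.
Proof. by have := expR_ge1Dx (2 * x); rewrite /q; lra. Qed.
Let s_mono (x y : R) : x <= y -> s x <= s y.
Proof. by move=> xy; rewrite ler_wsqrtr// lerB// ler_expR ler_pM2l. Qed.

Let ds (x : R) : 0 < x -> is_derive x (1:R) s ((s x ^+ 2 + 1) / s x).
Proof.
move=> x0; have s0 := s_gt0 x0.
have dq : is_derive x (1:R) q (2 * (q x + 1)) by rewrite /q; dv; ring.
eapply is_derive_eq; first exact: (sqrt_derive (q_gt0 x0) dq).
by rewrite -/(s x) s_sqr//; field; rewrite gt_eqF.
Qed.

Let S x := lam ^+ 3 * s x.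
(** This is [S' / S^2]. As [W' = S' (v^2 - v1^2 / S^2)] and [(v v1)' = v1^2 - S^2 v^2], it is the
    factor for which these two contributions cancel. *)
Let chi x := lam ^- 3 * ((s x)^-1 + s x ^- 3).
Let W x := S x * v x ^+ 2 + v1 x ^+ 2 / S x.
(* The cross term removes the leading part of [W'], leaving [W2' = chi' v v']. *)
Let W2 x := W x + chi x * (v x * v1 x).
Let chi' x := - (lam ^- 3 * (s x ^- 2 + 3 * s x ^- 4) * ((s x ^+ 2 + 1) / s x)).

Let S_gt0 (x : R) : 0 < x -> 0 < S x.
Proof. by move=> x0; rewrite mulr_gt0 ?exprn_gt0 ?s_gt0. Qed.

Let dchi (x : R) : 0 < x -> is_derive x (1:R) chi (chi' x).
Proof.
move=> x0; have s0 : s x != 0 by rewrite gt_eqF ?s_gt0.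
have dsx := ds x0; rewrite /chi; dv => //; first by rewrite expf_neq0.
by rewrite /chi'; field; rewrite s0.
Qed.

Let chi'_le0 (x : R) : 0 < x -> chi' x <= 0.
Proof.
move=> /s_gt0 s0; rewrite oppr_le0 mulr_ge0//.
  by rewrite mulr_ge0 ?addr_ge0 ?mulr_ge0 ?invr_ge0 ?exprn_ge0// ltW.
by rewrite divr_ge0 ?addr_ge0 ?sqr_ge0 ?ltW.
Qed.

Let dW2 (x : R) : 0 < x -> is_derive x (1:R) W2 (chi' x * (v x * v1 x)).
Proof.
move=> x0; have s0 : s x != 0 by rewrite gt_eqF ?s_gt0.
have S0 : lam ^+ 3 * s x != 0 by rewrite mulf_neq0 ?expf_neq0.
have dsx := ds x0; have dchix := dchi x0.
have dvx := dv_ x; have dv1x := dv1 x.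
rewrite /W2 /W /S; dv => //.
rewrite -/(q x) -(s_sqr x0) [X in _ + (_ + X * _)]/chi.
rewrite /chi; field; by rewrite lamn0 s0.
Qed.

Let chi_bound (x : R) : h <= x -> 0 < chi x <= 3 / 4.
Proof.
move=> hx; have x0 : 0 < x by exact: lt_le_trans hx.
have s0 := s_gt0 x0; have sn : s x != 0 by rewrite gt_eqF.
have l0 := lam0; have l5 := lam5.
(* [s x ^+ 2 >= 2 x >= 2 lam^-2] gives [r^2 <= 1 / 2]. The term [r^3] is of order one near
   [x = lam^-2], which is why the invariant is followed only from there on. *)
pose r := (s x)^-1 / lam.
have r0 : 0 < r by rewrite divr_gt0 ?invr_gt0.
have r2 : r ^+ 2 <= 1 / 2.
  have -> : r ^+ 2 = (s x ^+ 2 * lam ^+ 2)^-1 by rewrite /r; field; rewrite sn lamn0.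
  have t2 : 2 <= s x ^+ 2 * lam ^+ 2.
    rewrite s_sqr//; have l2 : 0 < lam ^+ 2 by rewrite exprn_gt0.
    have := ler_wpM2r (ltW l2) (q_ge x); have := ler_wpM2r (ltW l2) hx; rewrite hE; lra.
  by rewrite mul1r lef_pV2 ?posrE//; exact: lt_le_trans t2.
have r1 : r <= 1 by nra.
have -> : chi x = r * lam ^- 2 + r ^+ 3 by rewrite /chi /r; field; rewrite sn lamn0.
rewrite -/h; apply/andP; split; first by apply: addr_gt0; [exact: mulr_gt0|exact: exprn_gt0].
have rh : r * h <= 1 / 24.
  have := h24; have := h0 => ? ?; nra.
have r3 : r ^+ 3 <= r ^+ 2 by rewrite exprS ler_piMl// sqr_ge0.
lra.
Qed.

Let W_ge0 (x : R) : 0 < x -> 0 <= W x.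
Proof.
move=> x0; rewrite addr_ge0//; first by rewrite mulr_ge0 ?sqr_ge0// ltW// S_gt0.
by rewrite divr_ge0 ?sqr_ge0// ltW// S_gt0.
Qed.

Let cross_le (x : R) : 0 < x -> 2 * `|v x * v1 x| <= W x.
Proof.
move=> x0; have S0 := S_gt0 x0; have Sn : S x != 0 by rewrite gt_eqF.
have a : W x - 2 * (v x * v1 x) = (S x * v x - v1 x) ^+ 2 / S x by rewrite /W; field.
have b : W x + 2 * (v x * v1 x) = (S x * v x + v1 x) ^+ 2 / S x by rewrite /W; field.
have a0 : 0 <= W x - 2 * (v x * v1 x) by rewrite a divr_ge0 ?sqr_ge0 ?ltW.
have b0 : 0 <= W x + 2 * (v x * v1 x) by rewrite b divr_ge0 ?sqr_ge0 ?ltW.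
have [_|_] := ger0P (v x * v1 x); lra.
Qed.

Let W2_bounds (x : R) : h <= x -> W x / 2 <= W2 x /\ W2 x <= 3 / 2 * W x /\ `|v x * v1 x| <= W2 x.
Proof.
move=> hx; have x0 : 0 < x by exact: lt_le_trans hx.
have /andP[c0 c1] := chi_bound hx; have w0 := W_ge0 x0; have := cross_le x0.
rewrite /W2; have := ler_norm (v x * v1 x); have := ler_norm (- (v x * v1 x)); rewrite normrN.
set a := v x * v1 x; set n := `|a| => n1 n2 n3.
have n0 : 0 <= n by exact: normr_ge0.
have := ler_wpM2l (ltW c0) n1; have := ler_wpM2l (ltW c0) n2 => m1 m2.
have m3 := ler_wpM2r n0 c1.
by split; [lra|split; lra].
Qed.

(** Since [|W2'| <= - chi' W2], the product of [W2] with [expR chi] decreases and that with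
    [expR (- chi)] increases; the total change is at most a factor [expR (3 / 4) <= 4]. *)
Let W2_compare (x : R) : h <= x -> W2 x <= 4 * W2 h /\ W2 h <= 4 * W2 x.
Proof.
move=> hx.
have pos y : h <= y -> 0 < y by exact: lt_le_trans.
have /andP[ch0 ch1] := chi_bound (lexx h); have /andP[cx0 cx1] := chi_bound hx.
have W2_ge0 y : h <= y -> 0 <= W2 y.
  by move=> hy; have [_ [_]] := W2_bounds hy; apply: le_trans; exact: normr_ge0.
have up : W2 x * expR (chi x) <= W2 h * expR (chi h).
  apply: (@derive_le0_le R (fun y => W2 y * expR (chi y))
    (fun y => expR (chi y) * (chi' y * (v y * v1 y) + chi' y * W2 y)) h x hx).
    move=> y /andP[hy _]; have d1 := dW2 (pos _ hy); have d2 := dchi (pos _ hy).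
    by dv; ring.
  move=> y /andP[hy _]; have {}hy := ltW hy.
  rewrite pmulr_rle0 ?expR_gt0// -mulrDr mulr_le0_ge0//; first exact: chi'_le0 (pos _ hy).
  have [_ [_ a]] := W2_bounds hy.
  by rewrite addrC -lerBlDr sub0r (le_trans _ a)// -normrN ler_norm.
have dn : W2 h * expR (- chi h) <= W2 x * expR (- chi x).
  apply: (@derive_ge0_le R (fun y => W2 y * expR (- chi y))
    (fun y => expR (- chi y) * (- chi' y * (W2 y - v y * v1 y))) h x hx).
    move=> y /andP[hy _]; have d1 := dW2 (pos _ hy); have d2 := dchi (pos _ hy).
    by dv; ring.
  move=> y /andP[hy _]; have {}hy := ltW hy.
  rewrite mulr_ge0 ?expR_ge0// mulr_ge0 ?oppr_ge0//; first exact: chi'_le0 (pos _ hy).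
  have [_ [_ a]] := W2_bounds hy.
  by rewrite subr_ge0 (le_trans (ler_norm _) a).
have wx := W2_ge0 x hx; have wh := W2_ge0 h (lexx h).
split.
  apply: (@le_trans _ _ (W2 x * expR (chi x))).
    by rewrite ler_peMr// -expR0 ler_expR ltW.
  by apply: (le_trans up); rewrite [leRHS]mulrC ler_wpM2l// expR_le4.
apply: (@le_trans _ _ (4 * (W2 h * expR (- chi h)))).
  have key : 1 <= 4 * expR (- chi h).
    rewrite -(@ler_pM2r _ (expR (chi h))) ?expR_gt0//.
    by rewrite mul1r -mulrA -expRD addNr expR0 mulr1 expR_le4.
  by move: (W2 h) (expR _) wh key => A E A0 E1; rewrite mulrCA ler_peMr.
rewrite ler_pM2l//; apply: (le_trans dn).
by rewrite ler_piMr// expR_le1 oppr_le0 ltW.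
Qed.

(** The factor is [12 = 2 * 4 * (3 / 2)]: from [W] to [W2], along [W2], and back to [W]. *)
Let W_compare (x : R) : h <= x -> W x <= 12 * W h /\ W h <= 12 * W x.
Proof.
move=> hx; have [a1 a2] := W2_compare hx.
have [b1 [b2 _]] := W2_bounds hx; have [c1 [c2 _]] := W2_bounds (lexx h).
move: (W x) (W h) (W2 x) (W2 h) a1 a2 b1 b2 c1 c2 => A B C D a1 a2 b1 b2 c1 c2.
split; lra.
Qed.

Let S_window (x : R) : h <= x -> x <= 3 * h -> lam ^+ 2 <= S x <= 3 * lam ^+ 2.
Proof.
move=> hx x3; have x0 : 0 < x by exact: lt_le_trans hx.
have s0 := s_gt0 x0; have l0 := lam0; have hh := h0; have h2 := h24.
have qx : q x <= 8 * h by rewrite lerBlDl; exact: expR_le_linear.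
have sl : (s x * lam) ^+ 2 = q x * lam ^+ 2 by rewrite exprMn s_sqr.
have sl0 : 0 < s x * lam by exact: mulr_gt0.
have l20 : 0 < lam ^+ 2 by rewrite exprn_gt0.
have sl9 : s x * lam <= 3.
  rewrite -ler_sqr ?nnegrE ?ltW// sl.
  have := ler_wpM2r (ltW l20) qx; rewrite -mulrA hE; lra.
have sl1 : 1 <= s x * lam.
  rewrite -ler_sqr ?nnegrE ?ler01 ?(ltW sl0)// sl expr1n.
  have := ler_wpM2r (ltW l20) (q_ge x); have := ler_wpM2r (ltW l20) hx; rewrite hE; lra.
have -> : S x = lam ^+ 2 * (s x * lam) by rewrite /S; ring.
move: (lam ^+ 2) (s x * lam) l20 sl1 sl9 => A B A0 B1 B9.
by rewrite ler_peMr ?(ltW A0)//= mulrC ler_pM2r.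
Qed.

Lemma action_exists : exists W S : R -> R,
  [/\ forall x : R, 0 < x -> 0 < S x /\ S x ^+ 2 = lam ^+ 6 * (expR (2 * x) - 1),
      forall x : R, W x = S x * v x ^+ 2 + v1 x ^+ 2 / S x,
      forall x : R, lam ^- 2 <= x -> W x <= 12 * W (lam ^- 2) /\ W (lam ^- 2) <= 12 * W x,
      forall x : R, lam ^- 2 <= x -> x <= 3 * lam ^- 2 -> lam ^+ 2 <= S x <= 3 * lam ^+ 2 &
      forall e x : R, 0 < e -> e <= x -> lam ^+ 3 * Num.sqrt (2 * e) <= S x].
Proof.
exists W, S; split => //.
- move=> x x0; split; first exact: S_gt0.
  by rewrite /S exprMn s_sqr// -exprM.
- move=> e x e0 ex; rewrite ler_pM2l ?exprn_gt0 ?lam0//.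
  by apply: le_trans (s_mono ex); rewrite ler_wsqrtr.
Qed.

End TurningPoint.

(** * A large window near the turning point and bounds away from it *)

Section Concentration.
Variable R : realType.
Variables (lam h : R) (v v1 W S : R -> R).
Hypothesis lam5 : 5 <= lam.
Hypothesis hE : h * lam ^+ 2 = 1.
Hypothesis dv_ : forall x : R, is_derive x (1:R) v (v1 x).
Hypothesis dv1 : forall x : R,
  is_derive x (1:R) v1 (- (lam ^+ 6 * (expR (2 * x) - 1) * v x)).
Hypothesis S_gt0 : forall x : R, 0 < x -> 0 < S x.
Hypothesis S_sqr : forall x : R, 0 < x -> S x ^+ 2 = lam ^+ 6 * (expR (2 * x) - 1).
Hypothesis WE : forall x : R, W x = S x * v x ^+ 2 + v1 x ^+ 2 / S x.
Hypothesis W_compare : forall x : R, h <= x -> W x <= 12 * W h /\ W h <= 12 * W x.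
Hypothesis S_window : forall x : R, h <= x -> x <= 3 * h -> lam ^+ 2 <= S x <= 3 * lam ^+ 2.
Hypothesis S_lower : forall e x : R, 0 < e -> e <= x -> lam ^+ 3 * Num.sqrt (2 * e) <= S x.

Let lam0 : 0 < lam. Proof. by apply: lt_le_trans lam5. Qed.
Let lamn0 : lam != 0. Proof. by rewrite gt_eqF. Qed.
Let l20 : 0 < lam ^+ 2. Proof. by rewrite exprn_gt0. Qed.
Let h0 : 0 < h. Proof. by rewrite -(pmulr_lgt0 _ l20) hE. Qed.
Let h4 : lam ^+ 4 * h ^+ 2 = 1.
Proof. by transitivity ((h * lam ^+ 2) ^+ 2); [ring|rewrite hE expr1n]. Qed.

Lemma action_ge0 (x : R) : 0 < x -> 0 <= W x.
Proof.
move=> x0; rewrite WE addr_ge0//; first by rewrite mulr_ge0 ?sqr_ge0// ltW// S_gt0.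
by rewrite divr_ge0 ?sqr_ge0// ltW// S_gt0.
Qed.

Let sqr_le_W (x : R) : 0 < x -> S x * v x ^+ 2 <= W x.
Proof. by move=> x0; rewrite WE lerDl divr_ge0 ?sqr_ge0// ltW// S_gt0. Qed.

Let derive_sqr_le_W (x : R) : 0 < x -> v1 x ^+ 2 <= S x * W x.
Proof.
move=> x0; have S0 := S_gt0 x0; have Sn : S x != 0 by rewrite gt_eqF.
have -> : S x * W x = (S x * v x) ^+ 2 + v1 x ^+ 2.
  by rewrite WE mulrDr [S x * (_ / _)]mulrC divfK//; ring.
by rewrite lerDr sqr_ge0.
Qed.

(* If [v^2] were small on all of [[h, 2h]], then [v'] would be so large there
   that [v] could not stay small. *)
Let bump_point : exists2 x, h <= x <= 2 * h & W h / (144 * lam ^+ 2) <= v x ^+ 2.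
Proof.
have hh := h0; have ll := l20.
apply: contrapT => /forall2NP no.
have small x : h <= x <= 2 * h -> v x ^+ 2 < W h / (144 * lam ^+ 2).
  by move=> hx; have [|/negP] := no x; [move=> /(_ hx)|rewrite -ltNge].
have h2 : h < 2 * h by lra.
have [c /andP[hc c2] e] := mvt h2 (fun x _ => dv_ x).
have hc' : h <= c by exact: ltW.
have x0 : 0 < c by exact: lt_trans hc.
have c3 : c <= 3 * h by lra.
have /andP[S1 S3] := S_window hc' c3.
have [_ Wc] := W_compare hc'.
have S0 := S_gt0 x0.
have vc := small c _; rewrite hc' (ltW c2) in vc; have {}vc := vc isT.
have vh := small h _; rewrite lexx (ltW h2) in vh; have {}vh := vh isT.
have v2h := small (2 * h) _; rewrite lexx (ltW h2) in v2h; have {}v2h := v2h isT.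
(* With [v^2 < K], the bounds [W c >= 12 lam^2 K] and [S c <= 3 lam^2] force [v1^2 >= 9 lam^4 K].
   The increment of [v] over [h] then has square at least [9 K], whereas two values below [sqrt K]
   allow at most [4 K]. *)
pose K := W h / (144 * lam ^+ 2).
have KE : W h = 144 * (lam ^+ 2 * K) by rewrite /K; field.
rewrite -/K in vc vh v2h.
have K0 : 0 <= K by have := sqr_ge0 (v h); lra.
have v1c : 9 * (lam ^+ 4 * K) <= v1 c ^+ 2.
  have -> : v1 c ^+ 2 = S c * (W c - S c * v c ^+ 2) by rewrite WE; field; rewrite gt_eqF.
  have a1 : 9 * (lam ^+ 2 * K) <= W c - S c * v c ^+ 2.
    have := ler_wpM2r K0 S3; have := ler_wpM2l (ltW S0) (ltW vc); rewrite KE in Wc; lra.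
  have -> : 9 * (lam ^+ 4 * K) = lam ^+ 2 * (9 * (lam ^+ 2 * K)) by ring.
  apply: ler_pM => //; first exact: ltW.
  by apply: mulr_ge0 => //; apply: mulr_ge0 => //; exact: ltW.
have e2 : (v (2 * h) - v h) ^+ 2 = v1 c ^+ 2 * h ^+ 2 by rewrite e; ring.
have := ler_wpM2r (sqr_ge0 h) v1c; rewrite -e2.
have -> : 9 * (lam ^+ 4 * K) * h ^+ 2 = 9 * K * (lam ^+ 4 * h ^+ 2) by ring.
rewrite h4 mulr1 => a1.
have := sqr_ge0 (v (2 * h) + v h) => a2.
nra.
Qed.

Lemma bump : exists2 x2, h <= x2 <= 2 * h &
  forall x, x2 <= x <= x2 + h / 144 -> W h / (24 ^+ 2 * lam ^+ 2) <= v x ^+ 2.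
Proof.
have hh := h0; have ll := l20.
have [x2 /andP[hx2 x22] vx2] := bump_point.
exists x2; first by rewrite hx2.
move=> x /andP[xx2 xh].
(* At [x2], [v^2 >= 4 K], and [v1^2 <= S W <= 144^2 lam^4 K] on the window. Over a length [h / 144]
   the value of [v] moves by at most [sqrt K], half of its initial size. *)
have [K KE] : exists K, W h = 24 ^+ 2 * (lam ^+ 2 * K).
  by exists (W h / (24 ^+ 2 * lam ^+ 2)); field.
have -> : W h / (24 ^+ 2 * lam ^+ 2) = K by rewrite KE; field.
have {}vx2 : 4 * K <= v x2 ^+ 2.
  by apply: le_trans vx2; rewrite le_eqVlt; apply/orP; left; apply/eqP; rewrite KE; field.
move: xx2; rewrite le_eqVlt => /orP[/eqP <-|xx2].
  apply: le_trans vx2; have := sqr_ge0 (v x2).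
  have := action_ge0 h0; rewrite KE pmulr_rge0 ?exprn_gt0// pmulr_rge0// => K0 _.
  by rewrite ler_peMl// ler1n.
have K0 : 0 <= K.
  by have := action_ge0 h0; rewrite KE pmulr_rge0 ?exprn_gt0// pmulr_rge0.
have hl : h / 144 <= h by rewrite ler_pdivrMr// ler_peMr ?(ltW h0)// ler1n.
have [c /andP[x2c cx] e] := mvt xx2 (fun x _ => dv_ x).
have hc : h <= c by apply: le_trans hx2 (ltW x2c).
have c0 : 0 < c by exact: lt_le_trans hc.
have c3 : c <= 3 * h.
  by apply: le_trans (ltW cx) _; apply: le_trans xh _; move: (h / 144) hl => t hl; lra.
have /andP[S1 S3] := S_window hc c3.
have [Wc _] := W_compare hc.
have S0 := S_gt0 c0.
have v1c : v1 c ^+ 2 <= 144 ^+ 2 * (lam ^+ 4 * K).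
  apply: (le_trans (derive_sqr_le_W c0)).
  have -> : 144 ^+ 2 * (lam ^+ 4 * K) = (3 * lam ^+ 2) * (12 * W h) by rewrite KE; ring.
  by apply: ler_pM => //; rewrite ?action_ge0// ltW.
have d0 : 0 <= x - x2 by rewrite subr_ge0 ltW.
have dx : (x - x2) ^+ 2 <= (h / 144) ^+ 2.
  by rewrite ler_sqr ?nnegrE// ?lerBlDl// divr_ge0// ltW.
have a : (v x - v x2) ^+ 2 <= K.
  rewrite e exprMn; apply: (@le_trans _ _ (144 ^+ 2 * (lam ^+ 4 * K) * (h / 144) ^+ 2)).
    by apply: ler_pM => //; exact: sqr_ge0.
  have -> : 144 ^+ 2 * (lam ^+ 4 * K) * (h / 144) ^+ 2 = K * (lam ^+ 4 * h ^+ 2) by field.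
  by rewrite h4 mulr1.
move: (v x) (v x2) vx2 a => A B vx2 a.
have := sqr_ge0 (A + (A - B)); nra.
Qed.

Lemma oscillatory_bound (e : R) : 0 < e -> h <= e ->
  forall x, e <= x -> v x ^+ 2 <= 12 / Num.sqrt (2 * e) * (W h / lam ^+ 3).
Proof.
move=> e0 he x ex; have hx := le_trans he ex; have x0 : 0 < x by exact: lt_le_trans ex.
have [Wx _] := W_compare hx.
have S0 := S_gt0 x0; have l3 : 0 < lam ^+ 3 by rewrite exprn_gt0// lam0.
have r0 : 0 < Num.sqrt (2 * e) by rewrite sqrtr_gt0 mulr_gt0.
have -> : 12 / Num.sqrt (2 * e) * (W h / lam ^+ 3) = 12 * W h / (lam ^+ 3 * Num.sqrt (2 * e)).
  by field; rewrite lamn0 gt_eqF.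
rewrite ler_pdivlMr ?mulr_gt0//.
apply: le_trans Wx; apply: le_trans (sqr_le_W x0).
by rewrite mulrC ler_wpM2r ?sqr_ge0// S_lower.
Qed.

(** On [x <= 0] the function [v^2] is convex, with half-slope [P = v v1] starting from [0] at the
    inner sphere [- X0]. A value at [- e] is amplified by [lam^6] up to the turning point, where [v]
    is controlled by [v1], and [v1] by the action at [h]. *)
Lemma evanescent_bound (X X0 e : R) : 0 < e -> 0 < X0 -> X0 <= X -> v (- X0) = 0 ->
  forall x, - X0 <= x -> x <= - e ->
  v x ^+ 2 <= 24 * X ^+ 2 / ((1 - expR (- e)) * e ^+ 2) * (W h / lam ^+ 3).
Proof.
move=> e0 X00 X0X vX x X0x xe.
pose Qx y := lam ^+ 6 * (expR (2 * y) - 1).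
pose P y := v y * v1 y.
have dP (y : R) : is_derive y (1:R) P (v1 y ^+ 2 - Qx y * v y ^+ 2).
  have a1 := dv_; have a2 := dv1; rewrite /P; dv; rewrite /Qx; ring.
have dv2 (y : R) : is_derive y (1:R) (fun z => v z ^+ 2) (2 * P y).
  have a1 := dv_; dv; rewrite /P; ring.
have l6 : 0 < lam ^+ 6 by rewrite exprn_gt0// lam0.
have Q0 y : y <= 0 -> Qx y <= 0.
  by move=> y0; rewrite mulr_ge0_le0 ?(ltW l6)// subr_le0 expR_le1; lra.
have dP0 y : y <= 0 -> 0 <= v1 y ^+ 2 - Qx y * v y ^+ 2.
  move=> /Q0 qy; have := sqr_ge0 (v1 y); have := sqr_ge0 (v y); nra.
have Pmono y z : y <= z -> z <= 0 -> P y <= P z.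
  move=> yz z0; apply: (derive_ge0_le yz (fun t _ => dP t)) => t /andP[_ tz].
  by apply: dP0; lra.
have P0 y : - X0 <= y -> y <= 0 -> 0 <= P y.
  by move=> Xy y0; have := Pmono _ _ Xy y0; rewrite /P vX mul0r.
have vmono y z : - X0 <= y -> y <= z -> z <= 0 -> v y ^+ 2 <= v z ^+ 2.
  move=> Xy yz z0; apply: (derive_ge0_le yz (fun t _ => dv2 t)) => t /andP[yt tz].
  by rewrite mulr_ge0// P0//; lra.
have eX : e <= X0 by lra.
have xe2 : v x ^+ 2 <= v (- e) ^+ 2 by apply: vmono; lra.
apply: (le_trans xe2).
have c10 : 0 < 1 - expR (- e) by rewrite subr_gt0 expR_lt1; lra.
set c1 := 1 - expR (- e) in c10 *.
(* On the first half of [[- e, 0]] one has [expR (2 y) <= expR (- e)], so [P] grows; the second half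
   turns this into growth of [v^2]. *)
have P2 : lam ^+ 6 * c1 * (e / 2) * v (- e) ^+ 2 <= P (- e / 2).
  have ee : - e < - e / 2 by lra.
  have [c /andP[ec ce] eq] := mvt ee (fun t _ => dP t).
  have Pe : 0 <= P (- e) by apply: P0; lra.
  have Qc : lam ^+ 6 * c1 <= - Qx c.
    rewrite /Qx -mulrN ler_pM2l// /c1 opprB lerB// ler_expR; lra.
  have vc : v (- e) ^+ 2 <= v c ^+ 2 by apply: vmono; lra.
  have a1 : lam ^+ 6 * c1 * v (- e) ^+ 2 <= - Qx c * v c ^+ 2.
    by apply: ler_pM => //; rewrite ?sqr_ge0// mulr_ge0 ?ltW.
  have a2 := sqr_ge0 (v1 c).
  have a3 : lam ^+ 6 * c1 * v (- e) ^+ 2 <= v1 c ^+ 2 - Qx c * v c ^+ 2 by lra.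
  have e20 : 0 <= - e / 2 - - e by lra.
  have := ler_wpM2r e20 a3; rewrite -eq; lra.
have V0 : lam ^+ 6 * c1 * (e ^+ 2 / 2) * v (- e) ^+ 2 <= v 0 ^+ 2.
  have ee : - e / 2 < 0 by lra.
  have [c /andP[ec ce] eq] := mvt ee (fun t _ => dv2 t).
  have Pc : P (- e / 2) <= P c by apply: Pmono; lra.
  have := sqr_ge0 (v (- e / 2)); have := ler_wpM2r (ltW e0) (le_trans P2 Pc).
  lra.
(* Convexity gives [v(0)^2 <= 2 X v(0) v1(0)]; a square removes one factor [v(0)]. *)
have V1 : v 0 ^+ 2 <= 4 * X ^+ 2 * v1 0 ^+ 2.
  have ee : - X0 < 0 by lra.
  have [c /andP[ec ce] eq] := mvt ee (fun t _ => dv2 t).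
  have Pc : P c <= P 0 by apply: Pmono; lra.
  have P00 : 0 <= P 0 by apply: P0; lra.
  have a : v 0 ^+ 2 <= 2 * X * P 0.
    rewrite vX in eq.
    have -> : v 0 ^+ 2 = 2 * P c * X0 by rewrite -[LHS](subr0) -[X in _ - X](expr0n _ 2) eq; ring.
    have Pc0 : 0 <= P c by apply: P0; lra.
    have := ler_pM Pc0 (ltW X00) Pc X0X; lra.
  have := sqr_ge0 (v 0 - 2 * X * v1 0); rewrite /P in a; nra.
(* The energy [Q v^2 + v1^2] increases with [x]; it is [v1^2] at the turning point and [S W] at
   [h]. *)
have F0 : v1 0 ^+ 2 <= 3 * lam ^+ 2 * W h.
  pose F y := Qx y * v y ^+ 2 + v1 y ^+ 2.
  have dF (y : R) : is_derive y (1:R) F (2 * lam ^+ 6 * expR (2 * y) * v y ^+ 2).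
    have a1 := dv_; have a2 := dv1; rewrite /F /Qx; dv; ring.
  have : F 0 <= F h.
    apply: (derive_ge0_le (ltW h0) (fun t _ => dF t)) => t _.
    apply: mulr_ge0; last exact: sqr_ge0.
    by apply: mulr_ge0; [apply: mulr_ge0 => //; exact: ltW|exact: expR_ge0].
  have -> : F 0 = v1 0 ^+ 2 by rewrite /F /Qx mulr0 expR0; ring.
  have S0 := S_gt0 h0.
  have -> : F h = S h * W h.
    by rewrite /F /Qx -(S_sqr h0) WE; field; rewrite gt_eqF.
  move=> /le_trans; apply; rewrite ler_wpM2r ?action_ge0//.
  have hh := h0; have h3 : h <= 3 * h by lra.
  by have /andP[] := S_window (lexx h) h3.
(* The argument yields [lam^-4]; one power is given up to match the oscillatory side. *)
have l1 : 1 <= lam by have := lam5; lra.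
have e2 : 0 < e ^+ 2 by rewrite exprn_gt0.
have l0 := lam0; have Wh := action_ge0 h0.
have -> : 24 * X ^+ 2 / (c1 * e ^+ 2) * (W h / lam ^+ 3) =
   24 * X ^+ 2 * W h / (c1 * e ^+ 2 * lam ^+ 3) by field; rewrite lamn0 !gt_eqF.
rewrite ler_pdivlMr ?mulr_gt0 ?exprn_gt0//.
have X2 := sqr_ge0 X.
have main : lam ^+ 6 * c1 * (e ^+ 2 / 2) * v (- e) ^+ 2 <= 12 * X ^+ 2 * lam ^+ 2 * W h.
  apply: (le_trans V0); apply: (le_trans V1).
  have := ler_wpM2l X2 F0; lra.
rewrite -(ler_pM2l l20); apply: (@le_trans _ _ (2 * (lam ^+ 6 * c1 * (e ^+ 2 / 2) * v (- e) ^+ 2))).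
  have -> : 2 * (lam ^+ 6 * c1 * (e ^+ 2 / 2) * v (- e) ^+ 2) =
    lam * (lam ^+ 5 * (c1 * e ^+ 2 * v (- e) ^+ 2)) by field.
  have -> : lam ^+ 2 * (v (- e) ^+ 2 * (c1 * e ^+ 2 * lam ^+ 3)) =
    lam ^+ 5 * (c1 * e ^+ 2 * v (- e) ^+ 2) by ring.
  rewrite ler_peMl//; apply: mulr_ge0; first by apply: exprn_ge0; exact: ltW.
  apply: mulr_ge0; last exact: sqr_ge0.
  by apply: mulr_ge0; exact: ltW.
lra.
Qed.

End Concentration.

(** * From the index of a zero to the phase integral *)

Section BesselZeros.
Variable R : realType.
Implicit Types (nu Rr a t : R) (f : R -> R) (k : nat).

Definition log_frequency nu t : R := expR t ^+ 2 - nu ^+ 2.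

Lemma log_solution nu f :
  (exists f1 f2 : R -> R, forall z : R, 0 < z ->
    [/\ is_derive z (1:R) f (f1 z), is_derive z (1:R) f1 (f2 z) &
        z ^+ 2 * f2 z + z * f1 z + (z ^+ 2 - nu ^+ 2) * f z = 0]) ->
  exists V1 : R -> R, forall t : R,
    is_derive t (1:R) (fun t => f (expR t)) (V1 t) /\
    is_derive t (1:R) V1 (- (log_frequency nu t * f (expR t))).
Proof.
move=> [f1 [f2 h]]; exists (fun t => expR t * f1 (expR t)) => t.
have [d1 d2 e] := h _ (expR_gt0 t).
have de := is_derive_expR t.
split.
  by eapply is_derive_eq; [exact: (dv_comp d1 de)|rewrite mulrC].
eapply is_derive_eq.
  by eapply (dv_mul (f := expR)); [exact: de|exact: (dv_comp d2 de)].
by move: e; rewrite /log_frequency; lra.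
Qed.

(** Backward uniqueness by Gronwall: [K] dominates [|1 - Q|] to the left of [tau], so
    [(v^2 + v1^2) expR (K x)] increases up to its value [0] at [tau]. *)
Lemma solution_zero nu (v v1 : R -> R) (tau t : R) :
  (forall x : R, is_derive x (1:R) v (v1 x)) ->
  (forall x : R, is_derive x (1:R) v1 (- (log_frequency nu x * v x))) ->
  v tau = 0 -> v1 tau = 0 -> t <= tau -> v t = 0.
Proof.
move=> dv0 dv1 v0 v10 tt.
pose K := 1 + nu ^+ 2 + expR tau ^+ 2.
pose E x := (v x ^+ 2 + v1 x ^+ 2) * expR (K * x).
pose E' x := (2 * v x * v1 x * (1 - log_frequency nu x) + K * (v x ^+ 2 + v1 x ^+ 2)) * expR (K * x).
have dE (x : R) : is_derive x (1:R) E (E' x).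
  by rewrite /E; dv; rewrite /E'; ring.
have Et : E t <= E tau.
  apply: (derive_ge0_le tt (fun x _ => dE x)) => x /andP[_ xtau].
  apply: mulr_ge0; last exact: expR_ge0.
  have Q1 : expR x ^+ 2 <= expR tau ^+ 2.
    by rewrite ler_sqr ?nnegrE ?expR_ge0// ler_expR ltW.
  have Q2 := sqr_ge0 (expR x); have n2 := sqr_ge0 nu.
  rewrite /K /log_frequency.
  move: (expR x ^+ 2) (expR tau ^+ 2) (nu ^+ 2) Q1 Q2 n2 => A B N Q1 Q2 n2.
  have h1 := sqr_ge0 (v x + v1 x); have h2 := sqr_ge0 (v x - v1 x).
  have [D|D] := lerP 0 (1 - (A - N)).
    have := mulr_ge0 D h1; have := sqr_ge0 (v x); have := sqr_ge0 (v1 x).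
    move: (v x) (v1 x) => y z; rewrite !expr2; nra.
  have D' : 0 <= - (1 - (A - N)) by lra.
  have := mulr_ge0 D' h2; have := sqr_ge0 (v x); have := sqr_ge0 (v1 x).
  move: (v x) (v1 x) => y z; rewrite !expr2; nra.
have : E t <= 0 by apply: (le_trans Et); rewrite /E v0 v10; lra.
rewrite /E pmulr_lle0 ?expR_gt0// => h.
have := sqr_ge0 (v1 t); have := sqr_ge0 (v t) => a1 a2.
by apply/eqP; rewrite -sqrf_eq0; apply/eqP; lra.
Qed.

(** Otherwise the [k] points [a / 2, ..., a / (k + 1)] would be zeros below [a], where only [k - 1]
    are allowed. *)
Lemma kth_pos_zero_nontrivial f k a :
  kth_pos_zero f k a -> ~ (forall z, 0 < z -> f z = 0).
Proof.
move=> [k0 [a0 [_ [s [us [ss sP]]]]]] f0.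
pose pt (i : nat) : R := a / i.+2%:R.
have : (size (map pt (iota 0 k)) <= size s)%N.
  apply: uniq_leq_size.
    rewrite map_inj_uniq ?iota_uniq// => i j /(mulfI (lt0r_neq0 a0)) /invr_inj.
    by move=> /eqP; rewrite eqr_nat => /eqP[].
  move=> _ /mapP[i _ ->]; apply/sP.
  have p0 : 0 < pt i by rewrite divr_gt0.
  split => //; split; last exact: f0.
  by rewrite ltr_pdivrMr// ltr_pMr// ltr1n.
by rewrite size_map size_iota ss; case: k k0 {ss} => // k _; rewrite ltnn.
Qed.

(** The primitive is an integral from a fixed left end, which is why the phase is differentiated
    only beyond [t0]. *)
Lemma primitive_right (f : R -> R) (t0 : R) : continuous f ->
  exists F : R -> R, forall t, t0 < t -> is_derive t (1:R) F (f t).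
Proof.
move=> cf; exists (fun x => \int[lebesgue_measure]_(t in `[t0, x]) f t) => t t0t.
have fi : (@lebesgue_measure R).-integrable `[t0, t + 1] (EFin \o f).
  apply: continuous_compact_integrable; first exact: segment_compact.
  by apply: continuous_subspaceT.
have tt1 : t < t + 1 by rewrite ltrDl.
have [d e] := continuous_FTC1_closed tt1 fi t0t (cf t).
by split; [|rewrite -derive1E].
Qed.

Lemma small_lower_bound (s : seq R) (b : R) : 0 < b -> (forall x, x \in s -> 0 < x) ->
  exists2 m, 0 < m < b & forall x, x \in s -> m < x.
Proof.
move=> b0; elim: s => [|x s IH] sp.
  by exists (b / 2) => //; apply/andP; split; lra.
have [y ys|m /andP[m0 mb] hm] := IH; first by apply: sp; rewrite inE ys orbT.
have x0 : 0 < x by apply: sp; rewrite inE eqxx.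
exists (Num.min m (x / 2)).
  by rewrite lt_min m0 gt_min mb/= andbT; lra.
move=> y; rewrite inE gt_min => /orP[/eqP ->|/hm ->//].
by apply/orP; right; lra.
Qed.

Lemma zero_phase_aux nu Rr k a f (J J1 Y Y1 : R -> R) (W : R) :
  0 < nu -> 1 < Rr ->
  (forall t : R, is_derive t (1:R) J (J1 t)) ->
  (forall t : R, is_derive t (1:R) J1 (- (log_frequency nu t * J t))) ->
  (forall t : R, is_derive t (1:R) Y (Y1 t)) ->
  (forall t : R, is_derive t (1:R) Y1 (- (log_frequency nu t * Y t))) ->
  0 < W -> (forall t, J t * Y1 t - J1 t * Y t = W) ->
  (forall t, f (expR t) = 0 <-> J t * Y (t + ln Rr) - Y t * J (t + ln Rr) = 0) ->
  kth_pos_zero f k a ->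
  forall n : nat, `|k%:R * pi - phase_integral Rr nu a|
    <= Rr * a * (ln Rr / n.+1%:R) + ln Rr + n.+1%:R * pi.
Proof.
move=> nu0 R1 dJ dJ1 dY dY1 W0 WE fE [k0 [a0 [fa [s [us [ss sP]]]]]] n.
have Rr0 : 0 < Rr by exact: lt_trans R1.
have T0 : 0 < ln Rr by exact: ln_gt0.
(* [m] lies below every zero, so none is lost by counting from [c = ln m - 1]; [m < nu / Rr] puts
   the whole first window [[c, c + ln Rr]] on the nonoscillatory side. *)
have b0 : 0 < Num.min a (nu / Rr) by rewrite lt_min a0 divr_gt0.
have [x /sP[]//|m /andP[m0]] := small_lower_bound b0 (s := s).
rewrite lt_min => /andP[ma mnu] hm.
pose c := ln m - 1; pose t0 := c - 1.
have [alpha dalpha] : exists alpha : R -> R, forall t, t0 < t ->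
    is_derive t (1:R) alpha (W / (J t ^+ 2 + Y t ^+ 2)).
  apply: primitive_right => t.
  have N0 := modulus_gt0 W0 WE t.
  have [d hd] : exists d : R, is_derive t (1:R) (fun x => W / (J x ^+ 2 + Y x ^+ 2)) d.
    eexists; dv_step => //.
    by rewrite gt_eqF.
  exact: dv_continuous hd.
have lna : expR (ln a) = a by rewrite lnK.
have expT t : expR (t + ln Rr) = Rr * expR t by rewrite expRD [expR (ln _)]lnK// mulrC.
have t0c : t0 < c by rewrite /t0; lra.
have clm : c < ln m by rewrite /c; lra.
have cta : c < ln a by apply: lt_trans clm _; rewrite ltr_ln.
have Qc t : c <= t <= c + ln Rr -> log_frequency nu t <= 0.
  move=> /andP[_ tc]; rewrite subr_le0 ler_sqr ?nnegrE ?expR_ge0 ?(ltW nu0)//.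
  apply: (@le_trans _ _ (expR (ln m + ln Rr))); first by rewrite ler_expR; lra.
  by rewrite expT [expR _]lnK// mulrC -ler_pdivlMr// ltW.
have dQ (t : R) : is_derive t (1:R) (log_frequency nu) (2 * expR t ^+ 2).
  by rewrite /log_frequency; dv; ring.
have Q1 t : 0 < 2 * expR t ^+ 2 by rewrite mulr_gt0// exprn_gt0// expR_gt0.
have count : alpha (ln a + ln Rr) - alpha (ln a) = k%:R * pi.
  have -> : k%:R = (size (map (@ln R) s)).+1%:R :> R by rewrite size_map ss prednK.
  apply: (phase_shift_count dJ dJ1 dY dY1 W0 WE dalpha T0 dQ Q1 t0c cta Qc).
  - by apply/fE; rewrite lna.
  - rewrite map_inj_in_uniq// => x y /sP[x0 _] /sP[y0 _]; exact: ln_inj.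
  move=> t; split.
    move=> /mapP[x xs ->]; have [x0 [xa fx]] := (sP x).1 xs.
    rewrite ltr_ln// xa andbT; split; first by rewrite (lt_trans clm)// ltr_ln// hm.
    by apply/fE; rewrite lnK.
  move=> [/andP[ct ta] vt]; apply/mapP; exists (expR t); last by rewrite expRK.
  apply/sP; split; first exact: expR_gt0.
  by split; [rewrite -lna ltr_expR|apply/fE].
have AB : ln a <= ln a + ln Rr by rewrite lerDl ltW.
have := phase_riemann_sum dJ dJ1 dY dY1 W0 WE dalpha
  (q := log_slope nu) (Th := fun t => theta nu (expR t)) n (lt_trans t0c cta) AB
  (fun t _ => log_slope_ge0 t nu0) (fun s t _ st _ => log_slope_mono nu0 st)
  (fun t _ => log_slope_sqr_ge t nu0) (fun t _ => log_slope_sqr nu0)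
  (fun s t _ st _ => theta_log_chord nu0 st).
have BA : ln a + ln Rr - ln a = ln Rr by rewrite addrAC subrr add0r.
rewrite /= count expT lna -/(phase_integral Rr nu a) BA => /le_trans; apply.
rewrite lerD2r lerD2r ler_wpM2r//; first by rewrite divr_ge0// ltW.
by apply: (le_trans (log_slope_le _ nu0)); rewrite expT lna.
Qed.

(** The Wronskian is constant in [t]. If it is negative, [J] and [Y] are exchanged; if it were zero,
    for each [t] the cross product would be a solution with zero Cauchy data at [t + ln Rr], and [f]
    would vanish identically. *)
Lemma bessel_zero_phase nu Rr k a : 0 < nu -> 1 < Rr ->
  kth_pos_zero (fBessel nu Rr) k a ->
  forall n : nat, `|k%:R * pi - phase_integral Rr nu a|
    <= Rr * a * (ln Rr / n.+1%:R) + ln Rr + n.+1%:R * pi.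
Proof.
move=> nu0 R1 zk.
have [J1 hJ] := log_solution (BesselJ_ode nu).
have [Y1 hY] := log_solution (BesselY_ode nu).
have Rr0 : 0 < Rr by exact: lt_trans R1.
have expT t : expR (t + ln Rr) = Rr * expR t by rewrite expRD [expR (ln _)]lnK// mulrC.
have [J [Y [fE dJ dJ1 dY dY1]]] : exists J Y : R -> R,
    [/\ forall t, fBessel nu Rr (expR t) = J t * Y (t + ln Rr) - Y t * J (t + ln Rr),
       forall t : R, is_derive t (1:R) J (J1 t),
       forall t : R, is_derive t (1:R) J1 (- (log_frequency nu t * J t)),
       forall t : R, is_derive t (1:R) Y (Y1 t) &
       forall t : R, is_derive t (1:R) Y1 (- (log_frequency nu t * Y t))].
  exists (fun t => BesselJ nu (expR t)), (fun t => BesselY nu (expR t)).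
  by split=> t; [rewrite /fBessel expT|exact: (hJ t).1|exact: (hJ t).2|exact: (hY t).1|exact: (hY t).2].
pose C t := J t * Y1 t - J1 t * Y t.
have dC (t : R) : is_derive t (1:R) C 0.
  by rewrite /C; dv; ring.
have C0 t : C t = C 0.
  have [t0|/ltW t0] := lerP t 0; first exact: (derive_eq0_cst t0 (fun x _ => dC x)).
  exact/esym/(derive_eq0_cst t0 (fun x _ => dC x)).
have [Clt|Cgt|C00] := ltrgtP (C 0) 0.
- have Cn : 0 < - C 0 by rewrite oppr_gt0.
  have CE t : Y t * J1 t - Y1 t * J t = - C 0 by rewrite -(C0 t) /C; ring.
  have fE' t : fBessel nu Rr (expR t) = 0 <-> Y t * J (t + ln Rr) - J t * Y (t + ln Rr) = 0.
    by rewrite fE; split => /eqP; rewrite subr_eq0 => /eqP ->; rewrite subrr.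
  exact: zero_phase_aux nu0 R1 dY dY1 dJ dJ1 Cn CE fE' zk.
- have fE' t : fBessel nu Rr (expR t) = 0 <-> J t * Y (t + ln Rr) - Y t * J (t + ln Rr) = 0.
    by rewrite fE.
  exact: zero_phase_aux nu0 R1 dJ dJ1 dY dY1 Cgt C0 fE' zk.
exfalso; apply: (kth_pos_zero_nontrivial zk) => z z0.
rewrite -(lnK (x := z)) ?posrE// fE; set t := ln z.
pose v x := J x * Y (t + ln Rr) - Y x * J (t + ln Rr).
pose v1 x := J1 x * Y (t + ln Rr) - Y1 x * J (t + ln Rr).
have d1 (x : R) : is_derive x (1:R) v (v1 x) by rewrite /v; dv; rewrite /v1; ring.
have d2 (x : R) : is_derive x (1:R) v1 (- (log_frequency nu x * v x)).
  by rewrite /v1; dv; rewrite /v; ring.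
have e1 : v (t + ln Rr) = 0 by rewrite /v mulrC subrr.
have e2 : v1 (t + ln Rr) = 0.
  by move: (C0 (t + ln Rr)); rewrite C00 /C /v1 => e; rewrite -[RHS]oppr0 -e; ring.
have tt : t <= t + ln Rr by rewrite lerDl ltW// ln_gt0.
exact: solution_zero d1 d2 e1 e2 tt.
Qed.

End BesselZeros.

(** * The radial factor centred at its turning point *)

Section CrossProduct.
Variable R : realType.

Definition bessel_cross (nu a z : R) : R :=
  BesselJ nu a * BesselY nu z - BesselY nu a * BesselJ nu z.

Lemma bessel_cross_log_ode (nu a : R) : 0 < nu ->
  exists v1 : R -> R, forall x : R,
    is_derive x (1:R) (fun x => bessel_cross nu a (nu * expR x)) (v1 x) /\
    is_derive x (1:R) v1
      (- (nu ^+ 2 * (expR (2 * x) - 1) * bessel_cross nu a (nu * expR x))).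
Proof.
move=> nu0.
have [J1 hJ] := log_solution (BesselJ_ode nu).
have [Y1 hY] := log_solution (BesselY_ode nu).
have eE x : nu * expR x = expR (x + ln nu) by rewrite expRD [expR (ln _)]lnK// mulrC.
have [J [Y [JE dJ dJ1 dY dY1]]] : exists J Y : R -> R,
    [/\ forall x, bessel_cross nu a (nu * expR x) =
          BesselJ nu a * Y (x + ln nu) - BesselY nu a * J (x + ln nu),
       forall t : R, is_derive t (1:R) J (J1 t),
       forall t : R, is_derive t (1:R) J1 (- (log_frequency nu t * J t)),
       forall t : R, is_derive t (1:R) Y (Y1 t) &
       forall t : R, is_derive t (1:R) Y1 (- (log_frequency nu t * Y t))].
  exists (fun t => BesselJ nu (expR t)), (fun t => BesselY nu (expR t)).
  by split=> t; [rewrite /bessel_cross eE|exact: (hJ t).1|exact: (hJ t).2|exact: (hY t).1|exact: (hY t).2].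
have shift (f : R -> R) (l x : R) : is_derive (x + ln nu) (1:R) f l ->
    is_derive x (1:R) (fun x => f (x + ln nu)) l.
  move=> df; eapply is_derive_eq.
    by eapply (dv_comp (f := f) (g := fun x => x + ln nu)); [exact: df|dv_step].
  by rewrite addr0 mulr1.
have -> : (fun x => bessel_cross nu a (nu * expR x)) =
   (fun x => BesselJ nu a * Y (x + ln nu) - BesselY nu a * J (x + ln nu)).
  by apply/funext => x; rewrite JE.
exists (fun x => BesselJ nu a * Y1 (x + ln nu) - BesselY nu a * J1 (x + ln nu)) => x.
have s1 := shift _ _ _ (dJ (x + ln nu)); have s2 := shift _ _ _ (dJ1 (x + ln nu)).
have s3 := shift _ _ _ (dY (x + ln nu)); have s4 := shift _ _ _ (dY1 (x + ln nu)).
split; first by dv; ring.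
dv; rewrite JE /log_frequency -eE.
have -> : expR (2 * x) = expR x ^+ 2 by rewrite expRM_natl.
ring.
Qed.

Lemma bessel_concentration (nu a lam : R) : 5 <= lam -> lam ^+ 3 = nu -> 0 < a ->
  let v x := bessel_cross nu a (nu * expR x) in
  exists2 M, 0 <= M &
  [/\ exists2 x2, lam ^- 2 <= x2 <= 2 * lam ^- 2 & forall x,
        x2 <= x <= x2 + lam ^- 2 / 144 -> M / (24 ^+ 2 * lam ^+ 2) <= v x ^+ 2,
      forall e, 0 < e -> lam ^- 2 <= e -> forall x, e <= x ->
        v x ^+ 2 <= 12 / Num.sqrt (2 * e) * (M / lam ^+ 3) &
      forall X e, 0 < e -> a < nu -> ln (nu / a) <= X -> forall x,
        - ln (nu / a) <= x -> x <= - e ->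
        v x ^+ 2 <= 24 * X ^+ 2 / ((1 - expR (- e)) * e ^+ 2) * (M / lam ^+ 3)].
Proof.
move=> lam5 lamE a0 v.
have lam0 : 0 < lam by exact: lt_le_trans lam5.
have nu0 : 0 < nu by rewrite -lamE exprn_gt0.
have [v1 hv] := bessel_cross_log_ode a nu0.
have dv0 (x : R) : is_derive x (1:R) v (v1 x) by exact: (hv x).1.
have dv1 (x : R) : is_derive x (1:R) v1 (- (lam ^+ 6 * (expR (2 * x) - 1) * v x)).
  have nu2 : nu ^+ 2 = lam ^+ 6 by rewrite -lamE -exprM.
  by rewrite -nu2; exact: (hv x).2.
(* This abscissa is the inner sphere: there [nu * expR x = a]. *)
have vX : v (- ln (nu / a)) = 0.
  have -> : v (- ln (nu / a)) = bessel_cross nu a a.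
    by rewrite /v expRN [expR _]lnK ?posrE ?divr_gt0// invf_div mulrC divfK// gt_eqF.
  by rewrite /bessel_cross mulrC subrr.
clearbody v.
have [W [S [SP WE Wc Sw Sl]]] := action_exists lam5 dv0 dv1.
have S0 x x0 := (SP x x0).1; have S2 x x0 := (SP x x0).2.
have hE : lam ^- 2 * lam ^+ 2 = 1 by rewrite mulVf// expf_neq0// gt_eqF.
exists (W (lam ^- 2)); first by apply: (action_ge0 S0 WE); rewrite invr_gt0 exprn_gt0.
split.
- exact: bump lam5 hE dv0 S0 WE Wc Sw.
- by move=> e; exact: oscillatory_bound lam5 S0 WE Wc Sl e.
- move=> X e e0 anu lnX x.
  have X0 : 0 < ln (nu / a) by rewrite ln_gt0// ltr_pdivlMr// mul1r.
  exact: (evanescent_bound lam5 hE dv0 dv1 S0 S2 WE Sw e0 X0 lnX vX).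
Qed.

End CrossProduct.

(** * The quotient of norms for one eigenfunction *)

Section SingleMode.
Variable R : realType.

Lemma LpNorm_eq0 d (p : R) (A : set 'rV[R]_d) (u : 'rV[R]_d -> R) : 0 < p ->
  (forall x, A x -> u x = 0) -> LpNorm p A u = 0.
Proof.
move=> p0 uA.
have iint0 n : iint n (fun _ => 0%E : \bar R) = 0%E.
  by elim: n => //= n IH; under eq_integral do rewrite IH; rewrite integral0.
rewrite /LpNorm /intRd (_ : (fun s => _) = (fun=> 0%E)).
  by rewrite iint0 powR0// gt_eqF// invr_gt0.
apply/funext => s; rewrite indicE; have [/set_mem/uA->|_] := boolP (_ \in A).
  by rewrite normr0 powR0 ?mulr0// gt_eqF.
by rewrite mul0r.
Qed.

Variables (d : nat) (p Rr e : R).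
Hypothesis d2 : (2 <= d)%N.
Hypothesis p0 : 0 < p.
Hypothesis R1 : 1 < Rr.
Hypothesis e0 : 0 < e.

Let K : R := 12 / Num.sqrt (2 * e) + 24 * (ln Rr) ^+ 2 / ((1 - expR (- e)) * e ^+ 2).
Let D : R := Rr `^ (d%:R / 2 - 1).

(** [K] adds the constants of the two sides, [D] bounds the variation of the weight [r^(1 - d/2)],
    [24] comes from the height of the window and [144] from its width. *)
Definition mode_constant : R := (24 * Num.sqrt K * D) `^ p * (144 * Rr ^+ d).

Let Rr0 : 0 < Rr. Proof. exact: lt_trans R1. Qed.
Let D0 : 0 < D. Proof. exact: powR_gt0. Qed.

Let K1 : 0 <= 12 / Num.sqrt (2 * e). Proof. by rewrite divr_ge0 ?sqrtr_ge0. Qed.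
Let K2 : 0 <= 24 * (ln Rr) ^+ 2 / ((1 - expR (- e)) * e ^+ 2).
Proof.
rewrite divr_ge0//; first by rewrite mulr_ge0// sqr_ge0.
by rewrite mulr_ge0 ?sqr_ge0// subr_ge0 expR_le1 oppr_le0 ltW.
Qed.
Let K0 : 0 <= K. Proof. exact: addr_ge0. Qed.

Lemma radial_weight (r : R) : 1 <= r -> r <= Rr -> D^-1 <= r `^ (1 - d%:R / 2) <= 1.
Proof.
move=> r1 rR; have r0 : 0 < r by exact: lt_le_trans r1.
have q0 : (0:R) <= d%:R / 2 - 1.
  by rewrite subr_ge0 ler_pdivlMr// mul1r ler_nat.
have -> : 1 - d%:R / 2 = - (d%:R / 2 - 1) :> R by ring.
rewrite powRN; apply/andP; split.
  by rewrite lef_pV2 ?posrE ?powR_gt0// ge0_ler_powR// nnegrE ltW.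
rewrite invf_le1 ?powR_gt0// -[leLHS](powRr0 r); exact: ler_powR.
Qed.

Lemma single_mode_bound (l : nat) (nu a lam : R) (Y : 'rV[R]_d -> R) (A : set 'rV[R]_d) :
  5 <= lam -> lam ^+ 3 = nu -> 0 < a -> 1 < nu / a ->
  nu / a * expR (3 * lam ^- 2) < Rr -> lam ^- 2 <= e ->
  A `<=` shell (d := d) Rr ->
  (forall x, A x -> e <= `|ln (eucl x) - ln (nu / a)|) ->
  sph_harm l Y ->
  0 <= LpNorm p A (u_eig nu a Y) / LpNorm p (shell (d := d) Rr) (u_eig nu a Y)
    <= (mode_constant * lam `^ (2 - p / 2)) `^ p^-1.
Proof.
move=> lam5 lamE a0 tau1 tauR he AS Ae [P [homP [_ YP]]].
have lam0 : 0 < lam by exact: lt_le_trans lam5.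
have [M M0] := bessel_concentration lam5 lamE a0.
set h := lam ^- 2; have h0 : 0 < h by rewrite invr_gt0 exprn_gt0.
move=> [[x2 /andP[hx2 x2h] low] osc eva].
set tau := nu / a in tau1 tauR Ae eva *.
have tau0 : 0 < tau by exact: lt_trans tau1.
have ar (r : R) : 0 < r -> a * r = nu * expR (ln r - ln tau).
  move=> r0; rewrite expRD expRN [expR (ln r)]lnK// [expR (ln tau)]lnK//.
  by rewrite /tau invf_div; field; rewrite !gt_eqF// -lamE exprn_gt0.
pose phi r := r `^ (1 - d%:R / 2) * bessel_cross nu a (a * r).
have uE : u_eig nu a Y = fun x => phi (eucl x) * Y ((eucl x)^-1 *: x) by [].
have upper x : A x -> phi (eucl x) ^+ 2 <= K * (M / lam ^+ 3).
  move=> Ax; have /andP[r1 rR] := AS _ Ax; have := Ae _ Ax.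
  move: (eucl x) r1 rR => r r1 rR er.
  have r0 : 0 < r by exact: lt_trans r1.
  have ML : 0 <= M / lam ^+ 3 by rewrite divr_ge0// exprn_ge0// ltW.
  have /andP[_ w1] := radial_weight (ltW r1) (ltW rR).
  apply: (@le_trans _ _ (bessel_cross nu a (a * r) ^+ 2)).
    rewrite /phi exprMn ler_piMl ?sqr_ge0//.
    by rewrite expr_le1// powR_ge0.
  rewrite ar//.
  have lr : 0 < ln r by exact: ln_gt0.
  have [xe|xe] := lerP e (ln r - ln tau).
    apply: (le_trans (osc e e0 he _ xe)).
    by rewrite ler_wpM2r// lerDl.
  have {}xe : ln r - ln tau <= - e.
    by move: er; rewrite ler_normr => /orP[|]; lra.
  have anu : a < nu by rewrite -[a]mul1r -ltr_pdivlMr.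
  have tauX : ln tau <= ln Rr.
    rewrite ler_ln ?posrE// ltW// (le_lt_trans _ tauR)// ler_peMr ?(ltW tau0)//.
    by rewrite -expR0 ler_expR mulr_ge0// ltW.
  have xl : - ln tau <= ln r - ln tau by lra.
  apply: (le_trans (eva (ln Rr) e e0 anu tauX _ xl xe)).
  by rewrite ler_wpM2r// lerDr.
(* If the action is zero, the eigenfunction vanishes on [A] and the quotient is [0]. *)
move: M0; rewrite le_eqVlt => /orP[/eqP M0|M0].
  rewrite (LpNorm_eq0 p0 (A := A)) ?mul0r ?lexx ?powR_ge0// => x /upper.
  rewrite -M0 mul0r mulr0 => phi0; rewrite uE.
  have -> : phi (eucl x) = 0.
    by apply/eqP; rewrite -sqrf_eq0 eq_le phi0 sqr_ge0.
  by rewrite mul0r.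
pose b := D^-1 * (Num.sqrt M / (24 * lam)).
have b0 : 0 < b by rewrite mulr_gt0 ?invr_gt0// divr_gt0 ?sqrtr_gt0// mulr_gt0.
(* Upper bound on [A] over lower bound [b] on the window: the squares are of order [M / lam^3] and
   [M / lam^2], whence [lam^(-1/2)]. *)
pose kappa := 24 * Num.sqrt K * D * lam `^ (- 2^-1).
have kappa0 : 0 <= kappa.
  by rewrite mulr_ge0 ?powR_ge0// mulr_ge0 ?powR_ge0// mulr_ge0 ?sqrtr_ge0.
have b2 : b ^+ 2 = D^-1 ^+ 2 * (M / (24 ^+ 2 * lam ^+ 2)).
  transitivity (D^-1 ^+ 2 * (Num.sqrt M ^+ 2 / (24 ^+ 2 * lam ^+ 2))); last by rewrite sqr_sqrtr// ltW.
  by rewrite /b; move: (Num.sqrt M) => m; field; rewrite !gt_eqF.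
have kb2 : (kappa * b) ^+ 2 = K * (M / lam ^+ 3).
  rewrite exprMn b2 /kappa powRN powR12_sqrt ?(ltW lam0)// !exprMn.
  have -> : (Num.sqrt lam)^-1 ^+ 2 = lam^-1 by rewrite exprVn sqr_sqrtr// ltW.
  rewrite (sqr_sqrtr K0); field.
  by rewrite !gt_eqF.
pose r1 := tau * expR x2; pose r2 := tau * expR (x2 + h / 144).
have h144 : 0 < h / 144 by exact: divr_gt0.
have h144h : h / 144 <= h by rewrite ler_pdivrMr// ler_peMr ?(ltW h0)// ler1n.
have x20 : 0 < x2 by exact: lt_le_trans hx2.
have r11 : 1 <= r1.
  rewrite -[1]mulr1; apply: ler_pM => //; first exact: ltW.
  by rewrite -expR0 ler_expR ltW.
have r12 : r1 < r2 by rewrite ltr_pM2l// ltr_expR ltrDl.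
have r2R : r2 < Rr.
  apply: le_lt_trans tauR; rewrite ler_pM2l// ler_expR.
  have -> : 3 * h = 2 * h + h by ring.
  exact: lerD.
have window : h / 144 <= r2 - r1.
  have -> : r2 - r1 = r1 * (expR (h / 144) - 1) by rewrite /r2 /r1 expRD; ring.
  have ge : h / 144 <= expR (h / 144) - 1 by rewrite lerBrDl expR_ge1Dx.
  by rewrite -[leLHS]mul1r; apply: ler_pM => //; exact: ltW.
have homB x : A x -> `|phi (eucl x)| <= kappa * b.
  have kb0 : 0 <= kappa * b by apply: mulr_ge0 => //; exact: ltW.
  move=> Ax; rewrite -(@ler_sqr R) ?nnegrE//.
  by rewrite real_normK ?num_real// kb2 upper.
have low' r : r1 < r <= r2 -> b <= `|phi r|.
  move=> /andP[rr1 rr2]; have r0 : 0 < r by apply: lt_trans rr1; exact: lt_le_trans r11.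
  rewrite -(@ler_sqr R) ?nnegrE ?(ltW b0)// real_normK ?num_real// b2 /phi exprMn ar//.
  have /andP[w1 _] := radial_weight (le_trans r11 (ltW rr1)) (le_trans rr2 (ltW r2R)).
  have lnE (t : R) : ln (tau * expR t) = ln tau + t by rewrite lnM ?posrE ?expR_gt0// expRK.
  have tp (t : R) : 0 < tau * expR t by rewrite mulr_gt0 ?expR_gt0.
  have lr1 : ln tau + x2 <= ln r by rewrite -lnE ler_ln ?posrE//; exact: (ltW rr1).
  have lr2 : ln r <= ln tau + (x2 + h / 144) by rewrite -lnE ler_ln ?posrE.
  apply: ler_pM.
  - by rewrite sqr_ge0.
  - by rewrite divr_ge0 ?(ltW M0)// mulr_ge0 ?sqr_ge0.
  - by rewrite ler_sqr ?nnegrE ?powR_ge0 ?invr_ge0 ?(ltW D0).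
  - by apply: low; rewrite lerBrDl lr1 lerBlDl lr2.
have d0 : (0 < d)%N by exact: leq_trans d2.
have := LpNorm_ratio_bound p0 homP YP d0 r11 r12 r2R b0 AS homB low'.
rewrite -uE => /andP[-> /le_trans]; apply.
have bp0 : 0 < b `^ p by exact: powR_gt0.
have kp0 : 0 <= kappa `^ p by exact: powR_ge0.
have r210 : 0 < r2 - r1 by rewrite subr_gt0.
rewrite ge0_ler_powR ?nnegrE ?invr_ge0 ?(ltW p0)//.
- by rewrite divr_ge0// mulr_ge0 ?powR_ge0// ?exprn_ge0 ?(ltW Rr0) ?(ltW r210).
- by rewrite mulr_ge0 ?powR_ge0// mulr_ge0 ?powR_ge0// mulr_ge0// exprn_ge0// ltW.
have kpE : kappa `^ p = (24 * Num.sqrt K * D) `^ p * lam `^ (- (p / 2)).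
  rewrite /kappa powRM ?powR_ge0//; last by rewrite mulr_ge0 ?(ltW D0)// mulr_ge0 ?sqrtr_ge0.
  by rewrite -powRrM; congr (_ * _ `^ _); ring.
have lamE2 : lam `^ (2 - p / 2) = lam `^ (- (p / 2)) * lam ^+ 2.
  rewrite -powR_mulrn ?(ltW lam0)// -powRD; first by congr (_ `^ _); ring.
  by rewrite (gt_eqF lam0) implybT.
have rhsE : mode_constant * lam `^ (2 - p / 2) = kappa `^ p * Rr ^+ d / (h / 144).
  rewrite /mode_constant kpE lamE2 /h; move: (lam `^ _) ((_ * D) `^ p) => X1 X2.
  by field; rewrite gt_eqF.
rewrite rhsE powRM ?(ltW b0)//.
have -> : kappa `^ p * b `^ p * Rr ^+ d / (b `^ p * (r2 - r1)) =
    kappa `^ p * Rr ^+ d / (r2 - r1) by field; rewrite !gt_eqF.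
rewrite ler_wpM2l ?mulr_ge0 ?exprn_ge0 ?(ltW Rr0)//.
by rewrite lef_pV2 ?posrE.
Qed.

End SingleMode.

(** * Limits of the orders and of the zeros *)

Section Limits.
Variable R : realType.

Lemma nu_l_bounds (d l : nat) (c : R) : (2 <= d)%N -> 0 <= c ->
  l%:R <= nu_l d l c <= l%:R + (d%:R / 2 - 1 + c).
Proof.
move=> d2 c0; rewrite /nu_l.
have D0 : (0:R) <= d%:R / 2 - 1 by rewrite subr_ge0 ler_pdivlMr// mul1r ler_nat.
have l0 : (0:R) <= l%:R by exact: ler0n.
set D := d%:R / 2 - 1 in D0 *; set L : R := l%:R in l0 *.
rewrite -addrA -/D; have A0 : 0 <= L + D by exact: addr_ge0.
apply/andP; split.
  apply: (@le_trans _ _ (Num.sqrt ((L + D) ^+ 2))).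
    by rewrite sqrtr_sqr ger0_norm// lerDl.
  by rewrite ler_wsqrtr// lerDl sqr_ge0.
apply: (@le_trans _ _ (Num.sqrt ((L + D + c) ^+ 2))).
  rewrite ler_wsqrtr// -subr_ge0.
  have -> : (L + D + c) ^+ 2 - ((L + D) ^+ 2 + c ^+ 2) = 2 * ((L + D) * c) by ring.
  by rewrite mulr_ge0// mulr_ge0.
by rewrite sqrtr_sqr ger0_norm; lra.
Qed.

Lemma near_gt_pinfty (u : nat -> R) (M : R) : u @ \oo --> +oo -> \forall n \near \oo, M < u n.
Proof. by move=> /cvgryPgt /(_ M). Qed.

Lemma cvg_cst_div_pinfty (u : nat -> R) (C : R) : u @ \oo --> +oo -> (fun n => C / u n) @ \oo --> 0.
Proof.
move=> uoo; rewrite -(mulr0 C); apply: cvgM; first exact: cvg_cst.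
by apply/gtr0_cvgV0 => //; exact: near_gt_pinfty.
Qed.

Lemma nu_l_ratio_cvg (d : nat) (c w : R) (l k : nat -> nat) : (2 <= d)%N -> 0 <= c ->
  ((fun n => (k n)%:R : R) @ \oo --> +oo) ->
  ((fun n => (l n)%:R / (k n)%:R : R) @ \oo --> w) ->
  (fun n => nu_l d (l n) c / (k n)%:R) @ \oo --> w.
Proof.
move=> d2 c0 koo lk; pose C := d%:R / 2 - 1 + c.
apply: (@squeeze_cvgr _ _ _ _ (fun n => (l n)%:R / (k n)%:R)
  (fun n => (l n)%:R / (k n)%:R + C / (k n)%:R)) => //.
  near=> n; have /andP[a1 a2] := @nu_l_bounds d (l n) c d2 c0.
  have k0 : (0:R) <= (k n)%:R^-1 by rewrite invr_ge0 ler0n.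
  by rewrite ler_wpM2r//= -mulrDl ler_wpM2r.
rewrite -[X in _ --> X](addr0 w); apply: cvgD => //; exact: cvg_cst_div_pinfty.
Unshelve. all: by end_near.
Qed.

Lemma powR_decay (C q r : R) (u : nat -> R) : 0 <= C -> 0 < q -> 0 < r ->
  u @ \oo --> +oo -> (fun n => (C * u n `^ (- q)) `^ r) @ \oo --> 0.
Proof.
move=> C0 q0 r0 uoo; apply/cvgrPdist_le => e e0; near=> n.
have Cp : 0 < C + 1 by lra.
set M := (e `^ r^-1 / (C + 1)) `^ (- q^-1).
have uM : M < u n by near: n; exact: near_gt_pinfty.
have B0 : 0 < e `^ r^-1 / (C + 1) by rewrite divr_gt0// powR_gt0.
have M0 : 0 < M by exact: powR_gt0.
have u0 : 0 < u n by exact: lt_trans uM.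
rewrite sub0r normrN ger0_norm ?powR_ge0//.
have -> : e = (e `^ r^-1) `^ r by rewrite -powRrM mulVf ?powRr1 ?ltW// gt_eqF.
rewrite ge0_ler_powR ?nnegrE ?powR_ge0 ?(ltW r0)//; first by rewrite mulr_ge0 ?powR_ge0.
have key : u n `^ (- q) <= e `^ r^-1 / (C + 1).
  have -> : e `^ r^-1 / (C + 1) = M `^ (- q).
    rewrite /M -powRrM mulrNN mulVf ?gt_eqF// powRr1// divr_ge0 ?powR_ge0//; exact: ltW.
  rewrite !powRN lef_pV2 ?posrE ?(powR_gt0 _ M0) ?(powR_gt0 _ u0)//.
  by apply: ge0_ler_powR; rewrite ?nnegrE ltW.
rewrite ler_pdivlMr// in key; apply: le_trans key; rewrite mulrC ler_wpM2l ?powR_ge0//.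
by rewrite lerDl.
Unshelve. all: by end_near.
Qed.

(** The scaled phase tends to [pi], and near [y] the limiting phase is strictly increasing because
    the turning point lies inside the shell. Monotonicity in [z] at each finite stage then traps
    [z n]. *)
Lemma zero_ratio_cvg (Rr w y T : R) (nu a : nat -> R) (k : nat -> nat) :
  1 < Rr -> 0 < w -> 0 < y -> y < w -> w < Rr * y -> phase_integral Rr w y = pi -> 0 <= T ->
  (forall n, 0 < a n) -> (\forall n \near \oo, 0 < nu n) ->
  ((fun n => (k n)%:R : R) @ \oo --> +oo) ->
  (fun n => nu n / (k n)%:R) @ \oo --> w ->
  (\forall n \near \oo, forall m : nat, `|(k n)%:R * pi - phase_integral Rr (nu n) (a n)|
    <= Rr * a n * (T / m.+1%:R) + T + m.+1%:R * pi) ->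
  (fun n => a n / (k n)%:R) @ \oo --> y.
Proof.
move=> R1 w0 y0 yw wRy phi T0 a0 nu0 koo nuk err.
have Rr0 : 0 < Rr by exact: lt_trans R1.
pose z n := a n / (k n)%:R; pose x n := nu n / (k n)%:R.
have k0 : \forall n \near \oo, (0:R) < (k n)%:R by exact: near_gt_pinfty.
have err' : \forall n \near \oo, forall m : nat, `|pi - phase_integral Rr (x n) (z n)|
    <= Rr * z n * (T / m.+1%:R) + (T + m.+1%:R * pi) / (k n)%:R.
  near=> n.
  have e : forall m : nat, `|(k n)%:R * pi - phase_integral Rr (nu n) (a n)|
    <= Rr * a n * (T / m.+1%:R) + T + m.+1%:R * pi by near: n.
  move=> m; have e1 := e m.
  have kn : (0:R) < (k n)%:R by near: n.
    have nuE : nu n = (k n)%:R * x n by rewrite /x mulrCA divff ?mulr1// gt_eqF.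
  have aE : a n = (k n)%:R * z n by rewrite /z mulrCA divff ?mulr1// gt_eqF.
  rewrite nuE {1}aE phase_integral_scale// -mulrBr normrM (gtr0_norm kn) in e1.
  rewrite -(ler_pM2l kn); apply: (le_trans e1); rewrite aE le_eqVlt; apply/orP; left.
  by apply/eqP; field; rewrite gt_eqF//= nat1r.
have lim0 (m : nat) : (fun n => (T + m.+1%:R * pi) / (k n)%:R) @ \oo --> (0:R).
  exact: cvg_cst_div_pinfty.
have z0 : \forall n \near \oo, 0 < z n by near=> n; rewrite divr_gt0//; near: n.
have x0 : \forall n \near \oo, 0 < x n.
  by near=> n; rewrite divr_gt0//; near: n.
(* The linear growth of the phase in [z] bounds [z n]. *)
have [Z Z0 zZ] : exists2 Z, 0 < Z & \forall n \near \oo, z n <= Z.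
  pose m := Num.truncn (2 * Rr * T / (Rr - 1)).
  have mE : Rr * (T / m.+1%:R) <= (Rr - 1) / 2.
    have := truncnS_gt (2 * Rr * T / (Rr - 1)); rewrite -/m ltr_pdivrMr ?subr_gt0// => mT.
    rewrite mulrA ler_pdivrMr//; lra.
  exists ((pi + 3 * (w + 1) + 1) / ((Rr - 1) / 2)).
    by rewrite divr_gt0 ?divr_gt0 ?subr_gt0//; have := pi_gt0 R; lra.
  near=> n.
  have zn : 0 < z n by near: n.
  have xn : 0 < x n by near: n.
  have xw : x n <= w + 1 by near: n; apply: (cvgr_le w) => //; rewrite ltrDl.
  have en : (T + m.+1%:R * pi) / (k n)%:R <= 1 by near: n; apply: (cvgr_le 0 (lim0 m)).
  have e : `|pi - phase_integral Rr (x n) (z n)|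
    <= Rr * z n * (T / m.+1%:R) + (T + m.+1%:R * pi) / (k n)%:R.
    by near: n; apply: filterS err' => i; exact.
  have low := phase_integral_lower R1 xn zn.
  have := ler_norm (- (pi - phase_integral Rr (x n) (z n))); rewrite normrN => e2.
  have mz : Rr * z n * (T / m.+1%:R) <= (Rr - 1) / 2 * z n.
    by rewrite mulrAC ler_wpM2r// ltW.
  rewrite ler_pdivlMr ?divr_gt0 ?subr_gt0//.
  move: (Rr * z n * (T / m.+1%:R)) ((T + m.+1%:R * pi) / (k n)%:R) mz en e => A B mz en e.
  move: (phase_integral Rr (x n) (z n)) low e e2 => F low e e2; lra.
have Phi : (fun n => phase_integral Rr (x n) (z n)) @ \oo --> pi.
  apply/cvgrPdist_le => e e0.
  (* The number of cells depends on [e] only; afterwards [n] tends to infinity and removes the cost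
     of one half-turn per cell. *)
  pose m := Num.truncn (2 * Rr * Z * T / e).
  have mE : Rr * Z * (T / m.+1%:R) <= e / 2.
    have := truncnS_gt (2 * Rr * Z * T / e); rewrite -/m ltr_pdivrMr// => mT.
    rewrite mulrA ler_pdivrMr//; lra.
  near=> n.
  have zn : z n <= Z by near: n.
  have en : (T + m.+1%:R * pi) / (k n)%:R <= e / 2.
    by near: n; apply: (cvgr_le 0 (lim0 m)); exact: divr_gt0.
  have er : `|pi - phase_integral Rr (x n) (z n)|
    <= Rr * z n * (T / m.+1%:R) + (T + m.+1%:R * pi) / (k n)%:R.
    by near: n; apply: filterS err' => i; exact.
  apply: (le_trans er); rewrite [e]splitr lerD//; apply: le_trans mE.
  by rewrite ler_wpM2r ?divr_ge0// ler_pM2l.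
have cvgPhi y' : (fun n => phase_integral Rr (x n) y') @ \oo --> phase_integral Rr w y'.
  apply: cvgB; apply: cvg_theta => //; try exact: cvg_cst; by rewrite gt_eqF.
have thy : theta w y = 0 by apply: theta0 => //; rewrite !ltW.
apply/cvgrPdist_le => e e0.
have wR : w / Rr < y by rewrite ltr_pdivrMr// mulrC.
(* Both [y - dl] and [y + dl] stay in [[w / Rr, w]]: the inner [theta] vanishes there and the outer
   one is strictly increasing. *)
have [dl [dl0 dle dlw dlR]] : exists dl, [/\ 0 < dl, dl <= e, y + dl <= w & w <= Rr * (y - dl)].
  exists (Num.min e (Num.min (w - y) (y - w / Rr))); split.
  - by rewrite !lt_min e0 !subr_gt0 yw.
  - by rewrite ge_min lexx.
  - by rewrite -lerBrDl !ge_min lexx/= orbT.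
  - by rewrite mulrC -ler_pdivrMr// lerBrDr addrC -lerBrDr !ge_min lexx !orbT.
have yd0 : 0 < y - dl by rewrite -(pmulr_rgt0 _ Rr0) (lt_le_trans w0).
have yd1 : y - dl <= w by lra.
have up : pi < phase_integral Rr w (y + dl).
  rewrite -phi /phase_integral thy (theta0 w0 (z := y + dl)) ?dlw ?addr_ge0 ?(ltW y0) ?(ltW dl0)//.
  by rewrite !subr0 theta_lt ?(ltW wRy)// ltr_pM2l// ltrDl.
have dn : phase_integral Rr w (y - dl) < pi.
  rewrite -phi /phase_integral thy (theta0 w0 (z := y - dl)) ?yd1 ?(ltW yd0)//.
  by rewrite !subr0 theta_lt// ltr_pM2l// gtrDl oppr_lt0.
near=> n.
have zn : 0 < z n by near: n.
have xn : 0 < x n by near: n.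
have h1 : phase_integral Rr (x n) (z n) < (pi + phase_integral Rr w (y + dl)) / 2.
  near: n; apply: (cvgr_lt pi) => //; lra.
have h2 : (pi + phase_integral Rr w (y + dl)) / 2 < phase_integral Rr (x n) (y + dl).
  near: n; apply: (cvgr_gt _ (cvgPhi _)); lra.
have h3 : (pi + phase_integral Rr w (y - dl)) / 2 < phase_integral Rr (x n) (z n).
  near: n; apply: (cvgr_gt pi) => //; lra.
have h4 : phase_integral Rr (x n) (y - dl) < (pi + phase_integral Rr w (y - dl)) / 2.
  near: n; apply: (cvgr_lt _ (cvgPhi _)); lra.
have zu : z n < y + dl.
  rewrite ltNge; apply/negP => /(phase_integral_ndecr R1 xn (addr_gt0 y0 dl0)) h5.
  by have := lt_trans h1 h2; rewrite ltNge h5.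
have zl : y - dl < z n.
  rewrite ltNge; apply/negP => /(phase_integral_ndecr R1 xn zn) h5.
  by have := lt_trans h4 h3; rewrite ltNge h5.
rewrite ler_norml -/(z n); apply/andP; split.
  by rewrite lerNl opprB lerBlDl (le_trans (ltW zu))// lerD2l.
by rewrite lerBlDl -lerBlDr (le_trans _ (ltW zl))// lerD2l lerN2.
Unshelve. all: by end_near.
Qed.

End Limits.

(** * From Euclidean to logarithmic distance, and the limit *)

(** From [expR u >= 1 + u] at [u = ln y - ln x]. It translates the condition defining [Dset] into
    the variable of the concentration bounds. *)
Lemma ln_dist_ge (R : realType) (x y M : R) : 0 < x -> x <= M -> 0 < y -> y <= M ->
  `|x - y| <= M * `|ln x - ln y|.
Proof.
move=> x0 xM y0 yM; wlog yx : x y x0 xM y0 yM / y <= x.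
  move=> H; have /orP[yx|xy] := le_total y x; first exact: (H x y).
  by rewrite distrC (distrC (ln x)); exact: (H y x).
have lyx : ln y <= ln x by rewrite ler_ln.
rewrite !ger0_norm ?subr_ge0//.
have := expR_ge1Dx (ln y - ln x).
rewrite expRD expRN [expR (ln y)]lnK// [expR (ln x)]lnK// ler_pdivlMr// => h.
have D0 : 0 <= ln x - ln y by rewrite subr_ge0.
have := ler_wpM2r D0 xM; lra.
Qed.

Theorem theorem3p5 (R : realType) (d : nat) (c Rr : R)
  (g : R -> R) (s : R) (eps p w : R)
  (l k : nat -> nat) (a : nat -> R) (Y : nat -> 'rV[R]_d -> R) :
  (2 <= d)%N -> 0 <= c -> 1 < Rr ->
  is_gR Rr g -> 0 < s -> g s = s ->
  (forall s', 0 < s' -> g s' = s' -> s' = s) ->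
  0 < eps -> 4 < p -> s < w ->
  ((fun n => (l n)%:R : R) @ \oo --> +oo) ->
  ((fun n => (k n)%:R : R) @ \oo --> +oo) ->
  ((fun n => (l n)%:R / (k n)%:R : R) @ \oo --> w) ->
  (forall n, kth_pos_zero (fBessel (nu_l d (l n) c) Rr) (k n) (a n)) ->
  (forall n, sph_harm (l n) (Y n) /\ sphere_L2sq (Y n) = 1) ->
  (fun n =>
     LpNorm p (Dset (d := d) (w / g w) eps `&` shell (d := d) Rr)
            (u_eig (nu_l d (l n) c) (a n) (Y n)) /
     LpNorm p (shell (d := d) Rr) (u_eig (nu_l d (l n) c) (a n) (Y n)))
    @ \oo --> (0 : R).
Proof.
move=> d2 c0 R1 hg s0 gs s1 eps0 p4 sw loo koo lk zk YP.
have w0 : 0 < w by exact: lt_trans sw.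
have Rr0 : 0 < Rr by exact: lt_trans R1.
have [wRy phi] := gR_phase_integral R1 hg s0 s1 w0.
have yw : g w < w by exact: gR_lt_id R1 hg s0 gs s1 _ sw.
have y0 : 0 < g w by rewrite -(pmulr_rgt0 _ Rr0) (lt_trans w0).
have a0 n : 0 < a n by have [_ []] := zk n.
pose nu n := nu_l d (l n) c.
have nuoo : nu @ \oo --> +oo.
  apply/cvgryPge => A; near=> n.
  have /andP[lnu _] := @nu_l_bounds R d (l n) c d2 c0.
  by apply: le_trans lnu; near: n; have /cvgryPge := loo; apply.
have nu0 : \forall n \near \oo, 0 < nu n by exact: near_gt_pinfty.
have nuk : (fun n => nu n / (k n)%:R) @ \oo --> w by exact: nu_l_ratio_cvg.
have ak : (fun n => a n / (k n)%:R) @ \oo --> g w.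
  apply: (zero_ratio_cvg R1 w0 y0 yw wRy phi (ltW (ln_gt0 R1)) a0 nu0 koo nuk).
  near=> n; have nun : 0 < nu n by near: n.
  exact: (bessel_zero_phase nun R1 (zk n)).
have tau : (fun n => nu n / a n) @ \oo --> w / g w.
  have q : (fun n => (nu n / (k n)%:R) / (a n / (k n)%:R)) @ \oo --> w / g w.
    by apply: cvgM => //; apply: cvgV => //; rewrite gt_eqF.
  apply: cvg_trans q; apply: near_eq_cvg; near=> n.
  have kn : (0 : R) < (k n)%:R by near: n; exact: near_gt_pinfty.
  by field; rewrite !gt_eqF.
have tau1 : 1 < w / g w by rewrite ltr_pdivlMr// mul1r.
have tauR : w / g w < Rr by rewrite ltr_pdivrMr.
pose lam n := nu n `^ 3^-1.
have lamoo : lam @ \oo --> +oo.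
  apply/cvgryPge => A; near=> n.
  have A0 : `|A| ^+ 3 <= nu n by near: n; have /cvgryPge := nuoo; apply.
  apply: le_trans (ler_norm A) _.
  have -> : `|A| = (`|A| ^+ 3) `^ 3^-1.
    by rewrite -powR_mulrn// -powRrM divff// powRr1.
  apply: ge0_ler_powR => //; rewrite nnegrE ?exprn_ge0//.
  exact: le_trans A0.
have lam3 : \forall n \near \oo, lam n ^+ 3 = nu n.
  near=> n; have nun : 0 < nu n by near: n.
  by rewrite -powR_mulrn ?powR_ge0// -powRrM mulVf// powRr1// ltW.
have lam_inv : (fun n => lam n ^- 2) @ \oo --> 0.
  have li : (fun n => 1 / lam n) @ \oo --> 0 by exact: cvg_cst_div_pinfty.
  have -> : (fun n => lam n ^- 2) = (fun n => 1 / lam n * (1 / lam n)).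
    by apply/funext => n; rewrite !mul1r -invfM.
  by rewrite -(mulr0 0); exact: cvgM.
have tau_window : (fun n => nu n / a n * expR (3 * lam n ^- 2)) @ \oo --> w / g w.
  rewrite -[X in _ --> X]mulr1; apply: cvgM => //.
  rewrite -[X in _ --> X]expR0; apply: continuous_cvg; first exact: continuous_expR.
  by rewrite -[X in _ --> X](mulr0 3); apply: cvgM => //; exact: cvg_cst.
(* Half of [eps] pays for replacing [w / g w] by [nu n / a n]; the factor [Rr] comes from passing to
   logarithms of radii at most [Rr]. *)
pose e := eps / (2 * Rr).
have e0 : 0 < e by rewrite divr_gt0// mulr_gt0.
have p0 : 0 < p by lra.
have q0 : 0 < p / 2 - 2 by lra.
have C0 : 0 <= mode_constant d p Rr e.
  by rewrite mulr_ge0 ?powR_ge0// mulr_ge0// exprn_ge0// ltW.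
apply: (@squeeze_cvgr _ _ _ _ (fun=> 0) (fun n =>
  (mode_constant d p Rr e * lam n `^ (- (p / 2 - 2))) `^ p^-1)).
- near=> n; rewrite opprB; have [Yn _] := YP n.
  have tw : nu n / a n * expR (3 * lam n ^- 2) < Rr by near: n; exact: cvgr_lt tauR.
  have t1 : 1 < nu n / a n by near: n; exact: cvgr_gt tau1.
  have tR : nu n / a n <= Rr by near: n; exact: cvgr_le tauR.
  have td : `|w / g w - nu n / a n| <= eps / 2.
    by near: n; have /cvgrPdist_le := tau; apply; exact: divr_gt0.
  apply: (single_mode_bound d2 p0 R1 e0 (l := l n) (nu := nu n) (lam := lam n)) => //.
  + by near: n; have /cvgryPge := lamoo; apply.
  + by near: n.
  + by near: n; exact: cvgr_le e0.
  move=> x [xD /andP[x1 xR]].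
  have x0 : 0 < eucl x by exact: lt_trans x1.
  have t0 : 0 < nu n / a n by exact: lt_trans t1.
  have := ln_dist_ge x0 (ltW xR) t0 tR; rewrite -ler_pdivrMl// => h.
  apply: le_trans h; rewrite ler_pdivlMl//.
  have -> : Rr * e = eps / 2 by rewrite /e; field; rewrite gt_eqF.
  have := ler_distD (nu n / a n) (eucl x) (w / g w); rewrite /Dset/= in xD.
  rewrite (distrC (nu n / a n)); lra.
- exact: cvg_cst.
- by apply: powR_decay => //; rewrite invr_gt0.
Unshelve. all: by end_near.
Qed.
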